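(* Fix an even integer $d \geq 20$ and a prime $p$ with $d - 3 \geq p \geq d/2 + 5$. Put $k = d/2 - 1$ and $u = p - k - 2$. For $A, B, C, D \in \mathbb{Q}$ let $f = f_{A,B,C,D} \in \mathbb{Q}[x]$ be the unique polynomial with $f'(x) = (2k+2)(x - C)(x^k + A x^u + B)^2$ and $f(0) = D$. Then there are infinitely many $(A,B,C,D) \in \mathbb{Q}^4$ for which $0$ is not a periodic point of $f$, every iterate $f^{\circ n}(x)$ is separable, and the arboreal Galois representation $\phi: \operatorname{Gal}(\overline{\mathbb{Q}}/\mathbb{Q}) \to \operatorname{Aut}(T_\infty)$ attached to $f$ and $t = 0$ is surjective.
   Context: $f^{\circ n}$ is the $n$-th iterate of $f$, $f^{\circ 0}(x)=x$. For $f \in \mathbb{Q}[x]$ of degree $d$ and $t=0$ non-periodic with all $f^{\circ n}(x)$ separable, the preimage tree $T_\infty$ has as vertices the roots in $\overline{\mathbb{Q}}$ of $f^{\circ n}(x)$ for all $n \geq 0$ (level $n$; root $0$), with an edge between $\alpha,\beta$ whenever $f(\alpha)=\beta$; it is a complete rooted $d$-ary tree, and the Galois action defines the arboreal Galois representation $\phi$. *)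

(* Defs.v *)
From HB Require Import structures.
From mathcomp Require Import all_boot all_order all_algebra all_field.
From mathcomp Require Import boolp classical_sets cardinality.

Set Implicit Arguments.
Unset Strict Implicit.
Unset Printing Implicit Defensive.

Import GRing.Theory Num.Theory.
Local Open Scope ring_scope.

Definition poly_iter (R : nzRingType) (f : {poly R}) (n : nat) : {poly R} :=
  iter n (fun g => f \Po g) 'X.

Definition periodic_point (R : nzRingType) (f : {poly R}) (x : R) : Prop :=
  exists2 n : nat, (0 < n)%N & iter n (horner f) x = x.

Lemma horner_poly_iter (R : comNzRingType) (f : {poly R}) n x :
  (poly_iter f n).[x] = iter n (horner f) x.
Proof.
by elim: n => [|n IHn] /=; [rewrite hornerX | rewrite horner_comp -IHn].
Qed.

(* [algC] is an algebraic closure of the rationals, and a ring morphism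
   automatically fixes the rationals. *)
Record galQ := GalQ {
  galQ_fun :> {rmorphism algC -> algC};
  galQ_bij : bijective galQ_fun }.

Section PreimageTree.

Variable f : {poly rat}.

Definition preimage_vertex : pred algC :=
  fun a => `[< exists n : nat, root (map_poly ratr (poly_iter f n)) a >].

Definition vertex := {a : algC | preimage_vertex a}.

Lemma root_vertexP : preimage_vertex 0.
Proof. by apply/asboolP; exists 0%N; rewrite /= map_polyX rootX. Qed.

Definition root_vertex : vertex := exist _ 0 root_vertexP.

Definition adjacent (x y : vertex) : bool :=
  ((map_poly ratr f).[val x] == val y) || ((map_poly ratr f).[val y] == val x).

Record tree_aut := TreeAut {
  tree_aut_fun :> vertex -> vertex;
  tree_aut_bij : bijective tree_aut_fun;
  tree_aut_root : tree_aut_fun root_vertex = root_vertex;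
  tree_aut_adj : forall x y,
    adjacent (tree_aut_fun x) (tree_aut_fun y) = adjacent x y }.

Lemma tree_aut_eqP (s t : tree_aut) : s =1 t -> s = t.
Proof.
case: s t => [s s1 s2 s3] [t t1 t2 t3] /= /funext est.
by subst t; congr TreeAut; apply: Prop_irrelevance.
Qed.

Lemma map_ratr_gal (s : {rmorphism algC -> algC}) (g : {poly rat}) :
  map_poly s (map_poly ratr g) = map_poly ratr g.
Proof.
by rewrite -map_poly_comp; apply: eq_map_poly => a /=; rewrite fmorph_rat.
Qed.

Lemma preimage_vertex_gal (s : {rmorphism algC -> algC}) a :
  preimage_vertex (s a) = preimage_vertex a.
Proof.
have E n : root (map_poly ratr (poly_iter f n)) (s a)
         = root (map_poly ratr (poly_iter f n)) a.
  by rewrite -(map_ratr_gal s) fmorph_root map_ratr_gal.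
by apply: asbool_equiv_eq; split=> -[n rn]; exists n; rewrite ?E // -E.
Qed.

Definition gal_vertex (s : galQ) (x : vertex) : vertex :=
  exist _ (s (val x)) (etrans (preimage_vertex_gal s (val x)) (valP x)).

Lemma gal_vertex_bij s : bijective (gal_vertex s).
Proof.
have [g sK gK] := galQ_bij s.
have gP (x : vertex) : preimage_vertex (g (val x)).
  by rewrite -(preimage_vertex_gal s) gK (valP x).
exists (fun x => exist _ (g (val x)) (gP x)) => x; apply: val_inj => /=.
  exact: sK.
exact: gK.
Qed.

Lemma gal_vertex_root s : gal_vertex s root_vertex = root_vertex.
Proof. by apply: val_inj; rewrite /= rmorph0. Qed.

Lemma gal_vertex_adj s x y :
  adjacent (gal_vertex s x) (gal_vertex s y) = adjacent x y.
Proof.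
rewrite /adjacent /= -{1 2}[map_poly ratr f](map_ratr_gal s) !horner_map.
by rewrite !(inj_eq (fmorph_inj s)).
Qed.

Definition arboreal_rep (s : galQ) : tree_aut :=
  TreeAut (gal_vertex_bij s) (gal_vertex_root s) (gal_vertex_adj s).

End PreimageTree.

Lemma antideriv_exists_unique (g : {poly rat}) (c : rat) :
  exists! f : {poly rat}, f^`() = g /\ f.[0] = c.
Proof.
pose h := \poly_(i < (size g).+1)
  (if i is j.+1 then g`_j / j.+1%:R else c).
exists h; split.
  split; last by rewrite horner_coef0 coef_poly.
  apply/polyP => i; rewrite coef_deriv coef_poly ltnS.
  have [lti|lei] := ltnP i (size g); last by rewrite mul0rn nth_default.
  by rewrite -[LHS]mulr_natr divfK // pnatr_eq0.
move=> f' [df f0]; apply/polyP => -[|i].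
  by rewrite -(horner_coef0 f') f0 coef_poly.
have n0 : i.+1%:R != 0 :> rat by rewrite pnatr_eq0.
have E : f'`_i.+1 * i.+1%:R = g`_i by rewrite mulr_natr -df coef_deriv.
apply: (mulIf n0); rewrite E coef_poly ltnS.
have [lti|lei] := ltnP i (size g); first by rewrite divfK.
by rewrite mul0r nth_default.
Qed.

(* Main.v *)
Require Import Defs.
From HB Require Import structures.
From mathcomp Require Import all_boot all_order all_algebra all_field.
From mathcomp Require Import boolp classical_sets cardinality filter.
From mathcomp Require Import ring zify.

(** Scale [x = D y], so that [f] becomes [g(y) = 1 + T F(y)] with [T = D^(d-1)] and
    [F(y) = \int_0^y d (y - kap) (y^k + A y^u + B)^2].  The parameters are [A = 1/(2d)],
    [B = 1/(p r)], the value of [kap] for which [F(1) = 0] (so that [0 -> 1 -> 1] under [g]) and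
    [D = N/(p r)^2]; here [r] is a prime modulo which [-1] and [2d] are squares, and [N] is
    divisible exactly once by some prime [l] and by all the bad primes other than [p] and [r], is
    prime to [p], and is not a square modulo [r].

    Every iterate is Eisenstein at [l], which gives separability and transitivity on levels.  The
    critical value [g^n(kap)] is neither [s^2] nor [-s^2] for a rational [s] (look at it modulo
    [r]), so it has odd valuation at a good prime; a suitable inertia element there acts on level
    [n] as a product of an odd number of sibling transpositions.  The Newton polygons at [r] and
    [p] of the fiber over the root of level [n - 1] that is closest to [1] exclude nontrivial
    Galois-invariant partitions of the sibling sets.  Induction on the level then produces all
    sibling transpositions, so every automorphism of the truncated tree is realized, and a
    compactness argument over the levels finishes the proof.

    Valuations are handled through places of [algC]: a valuation ring together with its maximal
    ideal. *)

Set Implicit Arguments.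
Unset Strict Implicit.
Unset Printing Implicit Defensive.

Import GRing.Theory Num.Theory Order.TTheory.
Local Open Scope classical_set_scope.
Local Open Scope ring_scope.

(** * Automorphisms of the algebraic numbers *)

(** The critical points of g are [kap], which is simple, and the roots of y^k + A y^u + B, where g
    is ramified of index 3. Index 3 yields only 3-cycles, so oddness comes from [kap] alone: up to
    squares and units at the good prime, the product of the discriminants of the fibers over level n
    is g^(n+1)(kap). Its class at r is under control because T is N times a square, g(kap) is close
    to -2dN/16 times a square, and further on g(y) is close to T y^d with d even; hence the
    conditions on -1, 2d and N modulo r.

    No completions are used. At p and r the fixed point 1 is strongly repelling, so each level has
    one vertex strictly closest to 1. That vertex behaves as if it were p-adically or r-adically
    rational: in a trace weighted by (x - 1)^-K it dominates, so quantities attached to it have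
    integral valuation.

    B has valuation -1 at p and r, which leaves two integral roots, near 0 and 1, in the fibers that
    matter. The choice of A makes the coefficient of y^p in F equal to 1/p; this breaks the Newton
    polygon at p into the slopes 1/(k + u) and 1/(k - u), while at r there is the single slope
    1/k. *)

Notation autC := {rmorphism algC -> algC}.

(** Galois theory in the splitting field of the minimal polynomial of x: each of its automorphisms
    extends to [algC], so x lies in the fixed field of the whole Galois group. *)
Lemma autC_sep (x : algC) : (forall nu : autC, nu x = x) -> x \in Crat.
Proof.
move=> fx.
have [q [_ mon_q] /(_ q) qx0] := minCpolyP x; rewrite dvdpp in qx0.
have [r Dr] := closed_field_poly_normal (map_poly ratr q : {poly algC}).
rewrite lead_coef_map (monicP mon_q) rmorph1 scale1r in Dr.
have xr : x \in r by rewrite -root_prod_XsubC -Dr.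
have [Qr [QrC [rr Drr genQr]]] := num_field_exists r.
have [xx Dx]: {xx | QrC xx = x}.
  by move: xr; rewrite -Drr => /mapP/sig2_eqW[zz]; exists zz.
pose pr := map_poly (in_alg Qr) q.
have Qpr: pr \is a polyOver 1%AS.
  by apply/polyOverP=> i; rewrite coef_map memvZ ?memv_line.
have split_pr: splittingFieldFor 1 pr {:Qr}.
  exists rr => //; congr (_ %= _): (eqpxx pr); apply/(map_poly_inj QrC).
  rewrite -map_poly_comp (eq_map_poly (g := ratr)); last first.
    by move=> a; rewrite /= rmorphZ_num rmorph1 mulr1.
  rewrite Dr -Drr big_map rmorph_prod /=; apply: eq_bigr => zz _.
  by rewrite map_polyXsubC.
have Qn_ax : FieldExt_isSplittingField _ Qr by constructor; exists pr.
pose Qn : splittingFieldType rat := HB.pack_for (splittingFieldType rat) Qr Qn_ax.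
have galQn : galois 1 {:Qn}.
  apply/and3P; split; first exact: sub1v.
    by apply/separableP=> y _; apply: pcharf0_separable => i; rewrite pchar_lalg pchar_num.
  by apply/splitting_normalField; [exact: sub1v | exists pr].
have fxx : (xx : Qn) \in (1%VS : {vspace Qn}).
  rewrite -(galois_fixedField galQn).
  apply/fixedFieldP; first exact: memvf.
  move=> s _; apply: (fmorph_inj QrC).
  have [nu Dnu] := extend_algC_subfield_aut QrC s.
  by rewrite Dnu Dx fx.
by have /vlineP[c xxE] := fxx; rewrite -Dx xxE rmorphZ_num rmorph1 mulr1 Crat_rat.
Qed.

Lemma autC_conj_finite (x : algC) :
  exists s : seq algC, forall nu : autC, nu x \in s.
Proof.
have [r Dr] := closed_field_poly_normal (minCpoly x).
exists r => nu; rewrite -root_prod_XsubC.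
have /eqP lc1 := minCpoly_monic x; rewrite lc1 scale1r in Dr.
by rewrite -Dr -(minCpoly_aut nu) root_minCpoly.
Qed.

Lemma ultra_finite_value (T : Type) (V : eqType) (F : set_system T) (f : T -> V)
    (s : seq V) : UltraFilter F -> (forall t, f t \in s) ->
  exists v, F [set t | f t = v].
Proof.
move=> FU; elim: s => [|v s IHs] in f * => fs.
  by have [t] := @filter_ex _ F _ setT filterT; have := fs t.
have [Fv|Fv] := in_ultra_setVsetC [set t | f t = v] FU; first by exists v.
have [t ntv] := @filter_ex _ F _ _ Fv.
have ts : f t \in s by have := fs t; rewrite inE => /orP[/eqP//|].
(* The value v is missed on a set of the ultrafilter, so redirecting it to another value changes f
   only on a negligible set and shortens the list of values. *)
pose f' t' := if f t' == v then f t else f t'.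
have f's t' : f' t' \in s.
  by rewrite /f'; case: eqP (fs t') => // /eqP nv; rewrite inE (negbTE nv).
have [w Fw] := IHs f' f's.
exists w; apply: filterS (filterI Fv Fw) => t' [/= n].
by rewrite /f'; case: eqP.
Qed.

(** Compactness of the absolute Galois group. [algC] is countable, so there are solutions on an
    exhausting sequence of finite sets; each x has finitely many conjugates, so these solutions
    converge pointwise along an ultrafilter finer than the cofinite filter. *)
Lemma autC_compact (Q : algC -> algC -> Prop) :
  (forall s : seq algC, exists nu : autC, forall x, x \in s -> Q x (nu x)) ->
  exists nu : autC, forall x, Q x (nu x).
Proof.
move=> finQ.
pose en n := pmap (fun i => unpickle i : option algC) (iota 0 n).
have enP (x : algC) n : (pickle x < n)%N -> x \in en n.
  move=> ltn; rewrite mem_pmap; apply/mapP; exists (pickle x).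
    by rewrite mem_iota.
  by rewrite pickleK.
pose nu n : autC := sval (cid (finQ (en n))).
have nuQ n x : x \in en n -> Q x (nu n x).
  by rewrite /nu; case: cid => /= m; apply.
have [U [UU oU]] := ultraFilterLemma eventually_filter.
have evQ x : U [set n | Q x (nu n x)].
  apply: oU; exists (pickle x).+1 => // n /= lt.
  by apply: nuQ; apply: enP.
have lim x : exists y, U [set n | nu n x = y].
  by have [s xs] := autC_conj_finite x; apply: ultra_finite_value (fun n => xs (nu n)).
pose h x := sval (cid (lim x)).
have hP x : U [set n | nu n x = h x] by rewrite /h; case: cid.
have UE (A B : set nat) : U A -> U B -> exists n, A n /\ B n.
  by move=> UA UB; have [n] := @filter_ex _ U _ _ (filterI UA UB); exists n.
have hB : zmod_morphism h.
  move=> x y; have [n [/= [<- <-] <-]] := UE _ _ (filterI (hP x) (hP y)) (hP (x - y)).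
  exact: rmorphB.
have hM : monoid_morphism h.
  split=> [|x y]; first by have [n [/= _ <-]] := UE _ _ (hP 1) (hP 1); exact: rmorph1.
  have [n [/= [<- <-] <-]] := UE _ _ (filterI (hP x) (hP y)) (hP (x * y)).
  exact: rmorphM.
pose hzM := GRing.isZmodMorphism.Build _ _ h hB.
pose hmM := GRing.isMonoidMorphism.Build _ _ h hM.
pose hRM : autC := HB.pack h hzM hmM.
by exists hRM => x; have [n [/= qx <-]] := UE _ _ (evQ x) (hP x).
Qed.

Lemma autC_bij (nu : autC) : bijective nu.
Proof. by exists (algC_invaut nu); [exact: algC_autK | exact: algC_invautK]. Qed.

(** * Places *)

(** The value group stays implicit. [vmax_arch] and [vring_arch] replace a real-valued valuation by
    comparison with powers of q, and [vring_frac] (the ring is a localization of [Aint]) allows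
    inertia to be tested on algebraic integers only. *)
Record place (q : nat) := Place {
  vring : pred algC;
  vmax : pred algC;
  vring1 : vring 1;
  vringB : forall x y, vring x -> vring y -> vring (x - y);
  vringM : forall x y, vring x -> vring y -> vring (x * y);
  vmaxW : forall x, vmax x -> vring x;
  vmaxB : forall x y, vmax x -> vmax y -> vmax (x - y);
  vmaxMl : forall x y, vring x -> vmax y -> vmax (x * y);
  vmax1 : vmax 1 = false;
  vringV : forall x, vring x -> ~~ vmax x -> vring x^-1;
  vring_total : forall x, ~~ vring x -> vmax x^-1;
  vmax_char : vmax q%:R;
  vring_Aint : forall x, x \in Aint -> vring x;
  vmax_arch : forall x, vmax x -> exists2 j, (0 < j)%N & vring (x ^+ j / q%:R);
  vring_arch : forall x, exists K, vring (q%:R ^+ K * x);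
  vring_frac : forall x, vring x ->
    exists a s, [/\ a \in Aint, s \in Aint, ~~ vmax s & x = a / s] }.

(** * Existence of a place: the algebraic integers localized at a maximal ideal above q *)

Section PlaceExists.

Variable q : nat.
Hypothesis q_pr : prime q.

Definition Aint_ideal (P : set algC) := [/\ (forall x, P x -> x \in Aint),
  P q%:R, ~ P 1, (forall x y, P x -> P y -> P (x - y)) &
  (forall a x, a \in Aint -> P x -> P (a * x))].

Lemma Aint_maximal_ideal : exists P, Aint_ideal P /\
  forall a, a \in Aint -> ~ P a -> exists2 b, b \in Aint & P (1 - b * a).
Proof.
pose PP (X : set algC) := Aint_ideal X \/ X = set0.
have q0 : q%:R != 0 :> algC by rewrite pnatr_eq0 -lt0n prime_gt0.
have [A [PA Amax]] : exists A, PP A /\ forall B, A `<` B -> ~ PP B.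
  apply: Zorn_bigcup => F FP totF.
  have [[X FX [x Xx]]|F0] := pselect (exists2 X, F X & exists x, X x); last first.
    right; apply/seteqP; split=> [x [X FX Xx]|] //.
    by case: F0; exists X => //; exists x.
  have idl Y y : F Y -> Y y -> Aint_ideal Y.
    by move=> FY Yy; have [//|Y0] := FP _ FY; rewrite Y0 in Yy.
  left; split.
  - by move=> y [Y FY Yy]; have [YA _ _ _ _] := idl _ _ FY Yy; apply: YA.
  - by exists X => //; have [] := idl _ _ FX Xx.
  - by move=> [Y FY Yy]; have [_ _ nY _ _] := idl _ _ FY Yy.
  - move=> y z [Y FY Yy] [Z FZ Zz].
    have [_ _ _ YB _] := idl _ _ FY Yy; have [_ _ _ ZB _] := idl _ _ FZ Zz.
    have [YZ|ZY] := totF _ _ FY FZ.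
      by exists Z => //; apply: ZB => //; apply: YZ.
    by exists Y => //; apply: YB => //; apply: ZY.
  - move=> a y aA [Y FY Yy]; exists Y => //.
    by have [_ _ _ _ YM] := idl _ _ FY Yy; apply: YM.
have {PA}IA : Aint_ideal A.
  have [//|A0] := PA; exfalso.
  (* The principal ideal of q is proper, 1/q being rational and not integral; so a maximal A is not
     the empty set. *)
  apply: (Amax [set x | exists2 y, y \in Aint & x = q%:R * y]).
    rewrite A0; split=> // /(_ 0); apply.
    by exists 0; rewrite ?Aint0 ?mulr0.
  left; split.
  - by move=> x [y yA ->]; rewrite rpredM // -[q%:R]/(q%:~R) Aint_int.
  - by exists 1; rewrite ?Aint1 ?mulr1.
  - move=> [y yA qy].
    have yE : y = ratr (q%:R^-1) by rewrite fmorphV rmorph_nat; apply: (mulfI q0); rewrite -qy divff.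
    have : y \in Num.int by apply: Cint_rat_Aint => //; rewrite yE Crat_rat.
    case/intrP => m ym; move: qy; rewrite ym -[q%:R]/((q%:Z)%:~R) -intrM -[1]/(1%:~R).
    move/intr_inj => qm; have /prime_gt1 := q_pr.
    have : (q%:Z %| 1)%Z by apply/dvdzP; exists m; rewrite mulrC.
    by rewrite dvdzE dvdn1 => /eqP /= ->.
  - by move=> x y [x' xA ->] [y' yA ->]; exists (x' - y'); rewrite ?rpredB // mulrBr.
  - by move=> a x aA [x' xA ->]; exists (a * x'); rewrite ?rpredM // mulrCA.
exists A; split=> // a aA nAa; have [AA Aq A1 AB AM] := IA.
pose B := [set x | exists y b, [/\ A y, b \in Aint & x = y + b * a]].
have A0 : A 0 by have := AB _ _ Aq Aq; rewrite subrr.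
have [/= B1|nB1] := pselect (B 1).
  case: B1 => y [b [Ay bA E]]; exists b => //.
  by rewrite E addrK.
exfalso; apply: (Amax B).
  split; first by move=> x Ax; exists x, 0; rewrite Aint0 mul0r addr0.
  by move=> /(_ a) BA; apply: nAa; apply: BA; exists 0, 1; rewrite Aint1 mul1r add0r.
left; split=> //.
- by move=> x [y [b [Ay bA ->]]]; apply: rpredD; [exact: AA | exact: rpredM].
- by exists q%:R, 0; rewrite Aint0 mul0r addr0.
- move=> x1 x2 [y1 [b1 [Ay1 b1A ->]]] [y2 [b2 [Ay2 b2A ->]]].
  exists (y1 - y2), (b1 - b2); rewrite ?rpredB //; split=> //; first exact: AB.
  by rewrite mulrBl opprD addrACA.
- move=> c x cA [y [b [Ay bA ->]]]; exists (c * y), (c * b).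
  by split; rewrite ?rpredM ?mulrDr ?mulrA //; apply: AM.
Qed.

Lemma root_monic_Aint_Aint (p : {poly algC}) x :
  p \is monic -> root p x -> (forall i, p`_i \in Aint) -> x \in Aint.
Proof.
move=> mon_p px0 pA.
have [|r mon_r rx0] := @integral_root_monic int algC intr x p mon_p px0.
  move=> _ /(nthP 0)[i lti <-].
  have /floorpP[r Dr] : minCpoly p`_i \is a polyOver Num.int by apply: pA.
  exists r; last by rewrite -Dr root_minCpoly.
  move: (minCpoly_monic p`_i); rewrite Dr !monicE lead_coef_map_inj //=; last exact: intr_inj.
  by rewrite -[X in _ == X](rmorph1 (intr : int -> algC)) (inj_eq (@intr_inj algC)).
apply: root_monic_Aint rx0 _ _; first exact: monic_map.
by apply/polyOverP=> i; rewrite coef_map /= rpred_int.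
Qed.

(** Dividing by the content leaves a coefficient prime to q, hence a relation for x that stays
    nontrivial modulo the maximal ideal. *)
Lemma primitive_int_root (x : algC) : exists p : {poly int},
  root (map_poly intr p) x /\ exists i, ~~ (q%:Z %| p`_i)%Z.
Proof.
have [r [_ mon_r] /(_ r)] := minCpolyP x; rewrite dvdpp => rx0.
have [s [a a0 Dr]] := rat_poly_scale r.
have s0 : s != 0.
  apply: contraTneq (monic_neq0 mon_r) => s0.
  by rewrite Dr s0 map_poly0 scaler0 eqxx.
exists (zprimitive s); split; last first.
  apply: contrapT => H.
  have : (q%:Z %| zcontents (zprimitive s))%Z.
    rewrite dvdz_contents; apply/polyOverP => i.
    by apply: contrapT => /negP Hi; apply: H; exists i.
  rewrite zcontents_primitive s0 dvdzE dvdn1 => /eqP /= q1.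
  by move: q_pr; rewrite q1.
have : root (map_poly ratr (map_poly (intr : int -> rat) s)) x.
  move: rx0; rewrite Dr map_polyZ rootZ // fmorph_eq0 invr_eq0.
  by rewrite intr_eq0.
rewrite {1}(zpolyEprim s) map_polyZ map_polyZ rootZ; last first.
  by rewrite fmorph_eq0 intr_eq0 zcontents_eq0.
by rewrite -map_poly_comp (eq_map_poly (g := intr)) // => m /=; rewrite ratr_int.
Qed.

Variable P : set algC.
Hypothesis idP : Aint_ideal P.
Hypothesis maxP :
  forall a, a \in Aint -> ~ P a -> exists2 b, b \in Aint & P (1 - b * a).

Let PA x : P x -> x \in Aint. Proof. by case: idP => H _ _ _ _; apply: H. Qed.
Let Pq : P q%:R. Proof. by case: idP. Qed.
Let P1 : ~ P 1. Proof. by case: idP. Qed.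
Let PB x y : P x -> P y -> P (x - y). Proof. by case: idP => _ _ _ H _; apply: H. Qed.
Let PM a x : a \in Aint -> P x -> P (a * x). Proof. by case: idP => _ _ _ _ H; apply: H. Qed.
Let P0 : P 0. Proof. by have := PB Pq Pq; rewrite subrr. Qed.
Let PN x : P x -> P (- x). Proof. by rewrite -sub0r; apply: PB. Qed.
Let PD x y : P x -> P y -> P (x + y). Proof. by move=> Px /PN/(PB Px); rewrite opprK. Qed.

Lemma Aint_ideal_prime a b : a \in Aint -> b \in Aint -> ~ P a -> ~ P b -> ~ P (a * b).
Proof.
move=> aA bA /(maxP aA)[c cA Pc] nPb Pab; apply: nPb.
have -> : b = b * (1 - c * a) + c * (a * b) by ring.
exact: PD (PM bA Pc) (PM cA Pab).
Qed.

Let den s := s \in Aint /\ ~ P s.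
Let den0 s : den s -> s != 0. Proof. by case=> _ nP; apply: contra_notN nP => /eqP ->. Qed.
Let denM s t : den s -> den t -> den (s * t).
Proof. by case=> sA nPs [tA nPt]; split; rewrite ?rpredM //; apply: Aint_ideal_prime. Qed.
Let den1 : den 1. Proof. by split; rewrite ?Aint1. Qed.

Let O (x : algC) := exists a s, [/\ a \in Aint, den s & x = a / s].
Let M (x : algC) := exists a s, [/\ P a, den s & x = a / s].

Let OA x : x \in Aint -> O x.
Proof. by move=> xA; exists x, 1; split; rewrite ?divr1. Qed.

Let OB x y : O x -> O y -> O (x - y).
Proof.
move=> [a [s [aA ds ->]]] [b [t [bA dt ->]]]; exists (a * t - b * s), (s * t).
split; [|exact: denM|by field; rewrite !den0].
by have [[sA _] [tA _]] := (ds, dt); rewrite rpredB ?rpredM.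
Qed.

Let OM x y : O x -> O y -> O (x * y).
Proof.
move=> [a [s [aA ds ->]]] [b [t [bA dt ->]]]; exists (a * b), (s * t).
by split; [rewrite rpredM|exact: denM|field; rewrite !den0].
Qed.

Let MO x : M x -> O x.
Proof. by move=> [a [s [Pa ds ->]]]; exists a, s; rewrite PA. Qed.

Let MB x y : M x -> M y -> M (x - y).
Proof.
move=> [a [s [aA ds ->]]] [b [t [bA dt ->]]]; exists (a * t - b * s), (s * t).
split; [|exact: denM|by field; rewrite !den0].
have [[sA _] [tA _]] := (ds, dt).
by apply: PB; rewrite mulrC; apply: PM.
Qed.

Let MM x y : O x -> M y -> M (x * y).
Proof.
move=> [a [s [aA ds ->]]] [b [t [bA dt ->]]]; exists (a * b), (s * t).
by split; [apply: PM|exact: denM|field; rewrite !den0].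
Qed.

Let MP a : a \in Aint -> M a -> P a.
Proof.
move=> aA [b [s [Pb ds E]]]; apply: contrapT => nPa.
have := Aint_ideal_prime aA (proj1 ds) nPa (proj2 ds).
by rewrite E divfK ?den0.
Qed.

Let M1 : ~ M 1. Proof. by move/(MP Aint1). Qed.

Let OV x : O x -> ~ M x -> O x^-1.
Proof.
move=> [a [s [aA ds ->]]] nM; exists s, a; rewrite invf_div; split=> //.
  by case: ds.
by split=> // Pa; apply: nM; exists a, s.
Qed.

Let O1 : O 1. Proof. exact: OA Aint1. Qed.
Let O0 : O 0. Proof. exact: OA Aint0. Qed.
Let M0 : M 0. Proof. by exists 0, 1; split; rewrite ?divr1. Qed.
Let ON x : O x -> O (- x). Proof. by rewrite -sub0r; apply: OB. Qed.
Let OD x y : O x -> O y -> O (x + y). Proof. by move=> Ox /ON/(OB Ox); rewrite opprK. Qed.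
Let MN x : M x -> M (- x). Proof. by rewrite -sub0r; apply: MB. Qed.
Let MD x y : M x -> M y -> M (x + y). Proof. by move=> Ox /MN/(MB Ox); rewrite opprK. Qed.
Let OX x n : O x -> O (x ^+ n).
Proof. by move=> Ox; elim: n => [|n IH]; rewrite ?expr0 // exprS; apply: OM. Qed.

Let common_den (s : seq algC) : (forall x, x \in s -> O x) ->
  exists t, den t /\ forall x, x \in s -> t * x \in Aint.
Proof.
elim: s => [|y s IH] sO; first by exists 1.
have [|t [dt tA]] := IH; first by move=> x xs; apply: sO; rewrite inE xs orbT.
have [b [v [bA dv Ey]]] := sO y (mem_head _ _).
exists (t * v); split; first exact: denM.
move=> x; rewrite inE => /orP[/eqP ->|xs].
  rewrite Ey mulrACA divff ?den0 // mulr1 rpredM //; exact: (proj1 dt).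
by rewrite mulrAC rpredM ?tA //; case: dv.
Qed.

(** With t a common denominator of the coefficients, t x is a root of a monic polynomial over the
    algebraic integers; so the localization is integrally closed. *)
Let O_int (p : {poly algC}) x : p \is monic -> root p x -> (forall i, O p`_i) -> O x.
Proof.
move=> mon_p px0 pO.
have [|t [dt tA]] := common_den (s := p).
  by move=> y /(nthP 0)[i _ <-].
have tAi i : t * p`_i \in Aint.
  have [lt|le] := ltnP i (size p); first by rewrite tA ?mem_nth.
  by rewrite nth_default // mulr0 Aint0.
exists (t * x), t; split=> //; last by rewrite mulrC mulKf ?den0.
pose n := (size p).-1.
have sz : size p = n.+1 by rewrite /n prednK // size_poly_gt0 monic_neq0.
pose r := \poly_(i < n.+1) (t ^+ (n - i) * p`_i).
have lc : p`_n = 1 by rewrite -[RHS](eqP mon_p) lead_coefE sz.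
apply: (@root_monic_Aint_Aint r).
- by rewrite monicE lead_coef_poly // ?subnn ?expr0 mul1r lc // oner_eq0.
- rewrite rootE horner_poly; apply/eqP.
  transitivity (t ^+ n * p.[x]); last by rewrite (rootP px0) mulr0.
  rewrite horner_coef sz mulr_sumr; apply: eq_bigr => i _.
  have lei : (i <= n)%N by rewrite -ltnS.
  by rewrite exprMn mulrACA -exprD subnK.
move=> i; rewrite coef_poly; case: ltnP => // lti.
have tA1 : t \in Aint by case: dt.
move: lti; rewrite ltnS leq_eqVlt => /orP[/eqP ->|lti]; first by rewrite subnn mul1r lc Aint1.
by rewrite -(subnSK lti) exprSr -mulrA rpredM ?rpredX.
Qed.

(* Seidenberg: peel off the leading coefficient, which becomes integral. *)
Let seidenberg_step n (c : nat -> algC) (x : algC) : (forall i, O (c i)) ->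
  \sum_(i < n.+2) c i * x ^+ i = 0 -> O (c n.+1 * x).
Proof.
move=> cO E; pose a := c n.+1.
pose r := \poly_(i < n.+2) (if i == n.+1 :> nat then 1 else a ^+ (n - i) * c i).
apply: (O_int (p := r)).
- by rewrite monicE lead_coef_poly // eqxx ?oner_eq0.
- rewrite rootE horner_poly; apply/eqP.
  transitivity (a ^+ n * \sum_(i < n.+2) c i * x ^+ i); last by rewrite E mulr0.
  rewrite mulr_sumr; apply: eq_bigr => i _; case: eqP => [->|/eqP ni].
    by rewrite -/a mul1r exprMn mulrA -exprSr.
  have lei : (i <= n)%N by have := ltn_ord i; rewrite ltnS leq_eqVlt (negbTE ni).
  by rewrite exprMn mulrACA -exprD subnK.
move=> i; rewrite coef_poly; case: ltnP => // _; case: eqP => // _.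
by apply: OM; [apply/OX/cO | exact: cO].
Qed.

(** If the leading coefficient is outside M, x is in O. Otherwise the integral element c_(n+1) x is
    absorbed into the next coefficient and the degree drops. A coefficient outside M can only be
    lost this way when c_(n+1) x is itself outside M, and then 1/x = c_(n+1) / (c_(n+1) x) is in
    O. *)
Let seidenberg n (c : nat -> algC) (x : algC) : (forall i, O (c i)) ->
  \sum_(i < n.+1) c i * x ^+ i = 0 -> (exists2 i, (i <= n)%N & ~ M (c i)) -> O x \/ O x^-1.
Proof.
elim: n c => [|n IH] c cO E [i lei nM].
  move: lei E; rewrite leqn0 => /eqP i0; rewrite big_ord1 expr0 mulr1 => c0.
  by case: nM; rewrite i0 c0.
have Ob := seidenberg_step cO E.
have [Ma|nMa] := pselect (M (c n.+1)); last first.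
  left; have := OM Ob (OV (cO n.+1) nMa).
  rewrite mulrC mulrA mulVf ?mul1r //.
  by apply: contra_notN nMa => /eqP ->.
pose c' j := if j == n then c n + c n.+1 * x else c j.
have c'O j : O (c' j) by rewrite /c'; case: eqP => // _; apply: OD.
have E' : \sum_(j < n.+1) c' j * x ^+ j = 0.
  rewrite -[RHS]E 2!big_ord_recr big_ord_recr /= /c' eqxx mulrDl addrA; congr (_ + _ + _).
    apply: eq_bigr => j _; case: eqP (ltn_ord j) => // ->; by rewrite ltnn.
  by rewrite exprS mulrA.
have [Mb|nMb] := pselect (M (c n + c n.+1 * x)); last first.
  by apply: (IH c' c'O E'); exists n => //; rewrite /c' eqxx.
have {lei}lei : (i <= n)%N.
  by move: lei; rewrite leq_eqVlt => /orP[/eqP Ei|//]; rewrite Ei in nM.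
move: lei; rewrite leq_eqVlt => /orP[/eqP Ei|lti]; last first.
  apply: (IH c') => //; exists i; first exact: ltnW.
  by rewrite /c'; case: eqP lti => // ->; rewrite ltnn.
have nMax : ~ M (c n.+1 * x).
  by move=> Max; apply: nM; rewrite Ei; have := MB Mb Max; rewrite addrK.
right; have := OM (cO n.+1) (OV Ob nMax).
rewrite invfM mulrA divff ?mul1r //.
by apply: contra_notN nMax => /eqP ->; rewrite mul0r.
Qed.

Let intA (z : int) : (z%:~R : algC) \in Aint. Proof. exact: Aint_int. Qed.

Let nM_int (z : int) : ~~ (q%:Z %| z)%Z -> ~ M z%:~R.
Proof.
move=> ndv /(MP (intA z)) Pz.
have : coprimez z q%:Z.
  by rewrite coprimezE coprime_sym prime_coprime.
case/coprimezP => -[a b] /= E; apply: P1.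
have -> : 1 = a%:~R * z%:~R + b%:~R * q%:R :> algC.
  by rewrite -[q%:R]/((q%:Z)%:~R) -!intrM -intrD E.
by apply: PD; apply: PM.
Qed.

Let int_rel (x : algC) : exists p : {poly int},
  [/\ \sum_(i < size p) (p`_i)%:~R * x ^+ i = 0,
      exists2 i, (i < size p)%N & ~~ (q%:Z %| p`_i)%Z & (1 < size p)%N].
Proof.
have [p [px [i ndv]]] := primitive_int_root x; exists p.
have szE : size (map_poly intr p : {poly algC}) = size p.
  by apply: size_map_inj_poly => //; exact: intr_inj.
have sum0 : \sum_(j < size p) (p`_j)%:~R * x ^+ j = 0.
  move/rootP: px; rewrite horner_coef szE => E; rewrite -[RHS]E.
  by apply: eq_bigr => j _; rewrite coef_map.
have lti : (i < size p)%N.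
  by rewrite ltnNge; apply: contra ndv => le; rewrite nth_default.
split=> //; first by exists i.
case sz: (size p) sum0 lti => [//|[|//]]; rewrite big_ord1 expr0 mulr1 => /eqP.
rewrite intr_eq0 => /eqP p0; rewrite ltnS leqn0 => /eqP i0.
by move: ndv; rewrite i0 p0 dvdz0.
Qed.

Lemma place_of_ideal : place q.
Proof.
have Oc (p : {poly int}) i : O (p`_i)%:~R by apply: OA.
apply: (@Place q (fun x => `[< O x >]) (fun x => `[< M x >])).
- exact/asboolP.
- by move=> x y /asboolP Ox /asboolP Oy; apply/asboolP/OB.
- by move=> x y /asboolP Ox /asboolP Oy; apply/asboolP/OM.
- by move=> x /asboolP Mx; apply/asboolP/MO.
- by move=> x y /asboolP Ox /asboolP Oy; apply/asboolP/MB.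
- by move=> x y /asboolP Ox /asboolP Oy; apply/asboolP/MM.
- exact/asboolP.
- by move=> x /asboolP Ox /asboolP nM; apply/asboolP/OV.
- move=> x /asboolP nO; apply/asboolP.
  have [p [sum0 [i lti ndv] _]] := int_rel x.
  move: sum0 lti; case: (size p) => [//|n] sum0; rewrite ltnS => lti.
  have [|//|OVx] := seidenberg (Oc p) sum0.
    by exists i => //; apply: nM_int.
  apply: contrapT => nM; apply: nO; rewrite -[x]invrK; exact: OV.
- by apply/asboolP; exists q%:R, 1; split; rewrite ?divr1.
- by move=> x xA; apply/asboolP/OA.
- move=> x /asboolP Mx.
  have [p [sum0 exi _]] := int_rel x.
  have exb : exists i, ~~ (q%:Z %| p`_i)%Z by case: exi => i _; exists i.
  pose j := ex_minn exb; have [ndv minj] : ~~ (q%:Z %| p`_j)%Z /\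
      forall i, (i < j)%N -> (q%:Z %| p`_i)%Z.
    rewrite /j; case: ex_minnP => m nd mn; split=> // i lti.
    by apply: contraLR lti => /mn; rewrite -leqNgt.
  have ltj : (j < size p)%N.
    by rewrite ltnNge; apply: contra ndv => le; rewrite nth_default.
  have MX n : M (x ^+ n.+1) by rewrite exprS mulrC; apply: MM => //; apply/OX/MO.
  have bigO (m : nat) (F : 'I_m -> algC) (Pr : pred 'I_m) :
    (forall i, Pr i -> O (F i)) -> O (\sum_(i | Pr i) F i).
    by move=> H; elim/big_ind: _ => //; exact: OD.
  (* j is the lowest index with coefficient prime to q: the terms below it are divisible by q, those
     above it lie in M once x^j is taken out, so x^j is q times an element of O. *)
  pose A := \sum_(i < size p | (i < j)%N) ((p`_i %/ q)%Z)%:~R * x ^+ i.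
  pose B := \sum_(i < size p | (j < i)%N) (p`_i)%:~R * x ^+ (i - j).
  have OAA : O A.
    by apply: bigO => i _; apply: OM; [exact: OA | apply/OX/MO].
  have MB' : M B.
    rewrite /B; elim/big_rec: _ => [|i y lt My]; first exact: M0.
    apply: MD => //; apply: MM; first exact: OA.
    by rewrite -(subnSK lt); apply: MX.
  have E : q%:R * A + x ^+ j * ((p`_j)%:~R + B) = 0.
    rewrite -[RHS]sum0 (bigID (fun i : 'I_(size p) => (i < j)%N)) /=; congr (_ + _).
      rewrite mulr_sumr; apply: eq_bigr => i lt; rewrite mulrA; congr (_ * _).
      by rewrite -[q%:R]/((q%:Z)%:~R) -intrM mulrC divzK ?minj.
    rewrite (bigD1 (Ordinal ltj)) /=; last by rewrite ltnn.
    rewrite mulrDr mulrC; congr (_ + _).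
    rewrite /B mulr_sumr; apply: eq_big => [i|i lt].
      by rewrite -leqNgt ltn_neqAle eq_sym andbC -val_eqE.
    by rewrite mulrCA -exprD addnC subnK // ltnW.
  have nMu : ~ M ((p`_j)%:~R + B).
    by move/(MB)/(_ MB'); rewrite addrK; apply: nM_int.
  have u0 : (p`_j)%:~R + B != 0 by apply: contra_notN nMu => /eqP ->.
  have Ou : O ((p`_j)%:~R + B) by apply: OD; [exact: OA | exact: MO].
  have q0 : q%:R != 0 :> algC by rewrite pnatr_eq0 -lt0n prime_gt0.
  have Ex : x ^+ j = - (q%:R * A) / ((p`_j)%:~R + B).
    apply: (mulIf u0); rewrite divfK //; apply/eqP.
    by rewrite eq_sym eqr_oppLR -addr_eq0 E.
  exists j.
    rewrite lt0n; apply: contra_not_neq nMu => j0.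
    move: E; rewrite j0 expr0 mul1r /A big_pred0; last by move=> i; rewrite j0.
    by rewrite mulr0 add0r => ->.
  apply/asboolP; rewrite Ex.
  have -> : - (q%:R * A) / ((p`_j)%:~R + B) / q%:R = - A / ((p`_j)%:~R + B).
    by field; rewrite q0 u0.
  by apply: OM; [exact: ON | exact: OV].
(* The leading coefficient times x is integral by [seidenberg_step], and that coefficient is a power
   of q times a unit. *)
- move=> x; have [p [sum0 [i lti ndv] lt1]] := int_rel x.
  have [n sz] : exists n, size p = n.+2 by case: (size p) lt1 => [|[|n]] //; exists n.
  rewrite sz in sum0; have Ob := seidenberg_step (Oc p) sum0.
  have lc0 : p`_n.+1 != 0.
    have -> : p`_n.+1 = lead_coef p by rewrite lead_coefE sz.
    by rewrite lead_coef_eq0 -size_poly_gt0 sz.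
  pose a := absz (p`_n.+1); have a0 : (0 < a)%N by rewrite absz_gt0.
  have [m cqm Ea] := pfactor_coprime q_pr a0.
  have ndm : ~~ (q%:Z %| m%:Z)%Z by rewrite dvdzE -prime_coprime.
  have nMm := nM_int ndm.
  have m0 : (m%:Z)%:~R != 0 :> algC by apply: contra_notN nMm => /eqP ->.
  have OVm : O ((m%:Z)%:~R)^-1 by apply: OV => //; apply: OA.
  exists (logn q a); apply/asboolP.
  have Osg : O ((-1) ^+ (p`_n.+1 < 0)%R) by apply/OX/ON.
  have := OM OVm (OM Osg Ob); congr O.
  have -> : (p`_n.+1)%:~R = (-1) ^+ (p`_n.+1 < 0)%R * (m%:~R * q%:R ^+ logn q a) :> algC.
    rewrite [in LHS](intEsign p`_n.+1) -/a {1}Ea PoszM rmorphM rmorphM /= rmorphXn /= rmorphN1.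
    by rewrite -natrX -natz.
  set sg := (-1) ^+ _; have sg2 : sg * sg = 1 :> algC by rewrite -expr2 sqrr_sign.
  by transitivity (sg * sg * (q%:R ^+ logn q a * x)); [field | rewrite sg2 mul1r].
- move=> x /asboolP[a [s [aA [sA nPs] E]]]; exists a, s; split=> //.
  by apply/asboolP => /(MP sA).
Qed.

End PlaceExists.

Lemma place_exists q : prime q -> inhabited (place q).
Proof.
move=> q_pr; have [P [idP maxP]] := Aint_maximal_ideal q_pr.
by split; apply: place_of_ideal idP maxP.
Qed.

(** * Calculus with units and the maximal ideal of a place *)

Section PlaceTheory.

Variables (q : nat) (V : place q).
Local Notation O := (vring V).
Local Notation M := (vmax V).

Definition vunit x := O x && ~~ M x.
Local Notation U := vunit.

Lemma vring0 : O 0. Proof. by have := vringB (vring1 V) (vring1 V); rewrite subrr. Qed.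
Lemma vmax0 : M 0.
Proof. by have := vmaxB (vmax_char V) (vmax_char V); rewrite subrr. Qed.
Hint Resolve vring0 vmax0 vring1 : core.

Lemma vringN x : O x -> O (- x). Proof. by rewrite -sub0r; apply: vringB. Qed.
Lemma vringD x y : O x -> O y -> O (x + y).
Proof. by move=> Ox /vringN/(vringB Ox); rewrite opprK. Qed.
Lemma vmaxN x : M x -> M (- x). Proof. by rewrite -sub0r; apply: vmaxB. Qed.
Lemma vmaxD x y : M x -> M y -> M (x + y).
Proof. by move=> Ox /vmaxN/(vmaxB Ox); rewrite opprK. Qed.
Lemma vmaxMr x y : M x -> O y -> M (x * y).
Proof. by rewrite mulrC => Mx Oy; apply: vmaxMl. Qed.
Lemma vringX x n : O x -> O (x ^+ n).
Proof. by move=> Ox; elim: n => [|n IH]; rewrite ?expr0 // exprS vringM. Qed.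
Lemma vmaxX x n : M x -> (0 < n)%N -> M (x ^+ n).
Proof. by case: n => // n Mx _; rewrite exprS vmaxMr // vringX // vmaxW. Qed.

Lemma vring_sum (I : Type) (r : seq I) (P : pred I) F :
  (forall i, P i -> O (F i)) -> O (\sum_(i <- r | P i) F i).
Proof. by move=> H; elim/big_ind: _ => //; exact: vringD. Qed.
Lemma vmax_sum (I : Type) (r : seq I) (P : pred I) F :
  (forall i, P i -> M (F i)) -> M (\sum_(i <- r | P i) F i).
Proof. by move=> H; elim/big_ind: _ => //; exact: vmaxD. Qed.
Lemma vring_prod (I : Type) (r : seq I) (P : pred I) F :
  (forall i, P i -> O (F i)) -> O (\prod_(i <- r | P i) F i).
Proof. by move=> H; elim/big_ind: _ => //; exact: vringM. Qed.

Lemma vringMn x n : O x -> O (x *+ n).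
Proof. by move=> Ox; elim: n => [|n IH]; rewrite ?mulr0n // mulrS vringD. Qed.
Lemma vring_nat n : O n%:R. Proof. exact: vringMn. Qed.
Lemma vring_int (z : int) : O z%:~R.
Proof. by apply: vring_Aint; rewrite Aint_int. Qed.
Hint Resolve vring_nat vring_int : core.

Lemma vunit_ring x : U x -> O x. Proof. by case/andP. Qed.
Lemma vunit_nmax x : U x -> M x = false. Proof. by case/andP=> _ /negbTE. Qed.
Lemma vunit_neq0 x : U x -> x != 0.
Proof. by move/vunit_nmax; apply: contraFneq => ->. Qed.
Lemma vunit1 : U 1. Proof. by rewrite /U vring1 vmax1. Qed.
Lemma vunitVr x : U x -> O x^-1. Proof. by case/andP; apply: vringV. Qed.


Lemma vmax_nV x : x != 0 -> M x -> O x^-1 = false.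
Proof.
move=> x0 Mx; apply/negP => OV.
by have := vmaxMr Mx OV; rewrite divff // vmax1.
Qed.

Lemma vunitE x : x != 0 -> O x -> O x^-1 -> U x.
Proof. by move=> x0 Ox OV; rewrite /U Ox /=; apply: contraTN OV => /(vmax_nV x0) ->. Qed.

Lemma vunitV x : U x -> U x^-1.
Proof.
by move=> Ux; apply: vunitE; rewrite ?invrK ?invr_eq0 ?vunit_neq0 ?vunitVr ?vunit_ring.
Qed.

Lemma vunitM x y : U x -> U y -> U (x * y).
Proof.
move=> Ux Uy; apply: vunitE; first by rewrite mulf_neq0 ?vunit_neq0.
  by rewrite vringM ?vunit_ring.
by rewrite invfM vringM ?vunitVr.
Qed.

Lemma vunitN x : U x -> U (- x).
Proof.
move=> Ux; rewrite /U vringN ?vunit_ring //=.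
by apply: contraFN (vunit_nmax Ux) => /vmaxN; rewrite opprK.
Qed.

Lemma vunitX x n : U x -> U (x ^+ n).
Proof. by move=> Ux; elim: n => [|n IH]; rewrite ?expr0 ?vunit1 // exprS vunitM. Qed.

Lemma vunit_prod (I : Type) (r : seq I) (P : pred I) F :
  (forall i, P i -> U (F i)) -> U (\prod_(i <- r | P i) F i).
Proof. by move=> H; elim/big_ind: _ => //; [exact: vunit1 | exact: vunitM]. Qed.

Lemma vunitD x y : U x -> M y -> U (x + y).
Proof.
move=> Ux My; apply/andP; split; first by apply: vringD; [exact: vunit_ring | exact: vmaxW].
by apply: contraFN (vunit_nmax Ux) => /vmaxB/(_ My); rewrite addrK.
Qed.

Lemma vunit1D y : M y -> U (1 + y). Proof. by apply: vunitD; exact: vunit1. Qed.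

Lemma vunitMr x y : U x -> U (x * y) = U y.
Proof.
move=> Ux; apply/idP/idP => [|Uy]; last exact: vunitM.
by move=> Uxy; rewrite -(mulKf (vunit_neq0 Ux) y) vunitM // vunitV.
Qed.

Lemma vunit_eqmax x y : U x -> M (x - y) -> U y.
Proof. by move=> Ux /vmaxN/(vunitD Ux); rewrite opprB addrC subrK. Qed.

Lemma vmaxM_unit x y : U x -> M (x * y) = M y.
Proof.
move=> Ux; apply/idP/idP => [Mxy|My]; last by apply: vmaxMl => //; exact: vunit_ring.
by rewrite -(mulKf (vunit_neq0 Ux) y); apply: vmaxMl => //; exact: vunitVr.
Qed.

Lemma vringM_unit x y : U x -> O (x * y) = O y.
Proof.
move=> Ux; apply/idP/idP => [Mxy|My]; last by apply: vringM => //; exact: vunit_ring.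
by rewrite -(mulKf (vunit_neq0 Ux) y); apply: vringM => //; exact: vunitVr.
Qed.

Lemma vring_case x : O x -> U x \/ M x.
Proof. by rewrite /U => ->; case: (M x); [right | left]. Qed.

Lemma vmax_prime x y : O x -> O y -> M (x * y) -> M x \/ M y.
Proof.
move=> /vring_case[Ux|]; last by left.
by move=> _; rewrite vmaxM_unit //; right.
Qed.

Lemma vmax_prod (I : eqType) (r : seq I) (P : pred I) F :
  (forall i, i \in r -> P i -> O (F i)) -> M (\prod_(i <- r | P i) F i) ->
  exists2 i, i \in r & P i && M (F i).
Proof.
elim: r => [|j r IH] OF; first by rewrite big_nil vmax1.
have OFr i : i \in r -> P i -> O (F i) by move=> ir; apply: OF; rewrite inE ir orbT.
have IH' : M (\prod_(i <- r | P i) F i) -> exists2 i, i \in j :: r & P i && M (F i).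
  by case/(IH OFr) => i ir Hi; exists i => //; rewrite inE ir orbT.
rewrite big_cons; case Pj: (P j) => //.
have Oj := OF _ (mem_head _ _) Pj.
have Or : O (\prod_(i <- r | P i) F i).
  by rewrite big_seq_cond; apply: vring_prod => i /andP[]; apply: OFr.
case/(vmax_prime Oj Or) => // Mj.
by exists j; rewrite ?mem_head ?Pj.
Qed.

Lemma nvring_neq0 x : ~~ O x -> x != 0. Proof. by apply: contraNneq => ->. Qed.

Lemma vringX_inv x n : (0 < n)%N -> O (x ^+ n) -> O x.
Proof.
move=> n0 Oxn; apply: contraT => nO; have Mx := vring_total nO.
have := vmaxMl Oxn (vmaxX Mx n0).
by rewrite exprVn divff ?vmax1 // expf_neq0 ?nvring_neq0.
Qed.

Lemma vmaxX_inv x n : M (x ^+ n) -> M x.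
Proof.
case: n => [|n Mx]; first by rewrite expr0 vmax1.
have Ox : O x by apply: (@vringX_inv x n.+1) => //; exact: vmaxW.
by case: (vring_case Ox) => // /(vunitX n.+1)/vunit_nmax; rewrite Mx.
Qed.

Lemma vunitX_inv x n : (0 < n)%N -> U (x ^+ n) -> U x.
Proof.
move=> n0 Uxn; apply: vunitE.
- by apply: contraTneq (vunit_neq0 Uxn) => ->; rewrite expr0n gtn_eqF // eqxx.
- by apply: (@vringX_inv _ n) => //; exact: vunit_ring.
by apply: (@vringX_inv _ n) => //; rewrite exprVn vunitVr.
Qed.

Lemma vring_root (p : {poly algC}) x : (forall i, O p`_i) -> U (lead_coef p) ->
  root p x -> O x.
Proof.
move=> Op Ul px0; apply: contraT => nO; have Mx := vring_total nO.
have x0 := nvring_neq0 nO.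
have p0 : p != 0 by rewrite -lead_coef_eq0 vunit_neq0.
have [n sz] : exists n, size p = n.+1.
  by exists (size p).-1; rewrite prednK ?size_poly_gt0.
have E : \sum_(i < n) p`_i * x^-1 ^+ (n - i) + lead_coef p = 0.
  have := rootP px0; rewrite horner_coef sz big_ord_recr /= lead_coefE sz /= => E.
  apply: (mulIf (expf_neq0 n x0)); rewrite mul0r -[RHS]E mulrDl mulr_suml.
  congr (_ + _); apply: eq_bigr => i _; rewrite -mulrA; congr (_ * _).
  have lei : (i <= n)%N by rewrite ltnW.
  have -> : x ^+ n = x ^+ (n - i) * x ^+ i by rewrite -exprD subnK.
  by rewrite mulrA exprVn mulVf ?mul1r // expf_neq0.
have : M (lead_coef p).
  rewrite -[lead_coef p](addKr (\sum_(i < n) p`_i * x^-1 ^+ (n - i))) E addr0.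
  apply/vmaxN/vmax_sum => i _; apply: vmaxMl => //; apply: vmaxX => //.
  by rewrite subn_gt0.
by rewrite vunit_nmax.
Qed.

Lemma vring_horner (p : {poly algC}) x : (forall i, O p`_i) -> O x -> O p.[x].
Proof. by move=> Op Ox; rewrite horner_coef; apply: vring_sum => i _; rewrite vringM ?vringX. Qed.

Lemma vmax_subX x y n : O x -> O y -> M (x - y) -> M (x ^+ n - y ^+ n).
Proof.
move=> Ox Oy Mxy; rewrite subrXX vmaxMr //.
by apply: vring_sum => i _; rewrite vringM ?vringX.
Qed.

Lemma vmax_horner (p : {poly algC}) x y : (forall i, O p`_i) -> O x -> O y ->
  M (x - y) -> M (p.[x] - p.[y]).
Proof.
move=> Op Ox Oy Mxy; rewrite !horner_coef -sumrB; apply: vmax_sum => i _.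
by rewrite -mulrBr vmaxMl // vmax_subX.
Qed.

Lemma vmax_horner0 (p : {poly algC}) x : (forall i, M p`_i) -> O x -> M p.[x].
Proof. by move=> Op Ox; rewrite horner_coef; apply: vmax_sum => i _; rewrite vmaxMr ?vringX. Qed.

Lemma vmax_trans x y z : M (x - y) -> M (y - z) -> M (x - z).
Proof. by move=> Mx /(vmaxD Mx); rewrite addrA subrK. Qed.

Lemma vmax_sym x y : M (x - y) = M (y - x).
Proof. by apply/idP/idP => /vmaxN; rewrite opprB. Qed.

Hypothesis q_pr : prime q.

Lemma vunit_coprime n : coprime q n -> U n%:R.
Proof.
move=> cqn; rewrite /U vring_nat /=; apply/negP => Mn.
have : coprimez n%:Z q%:Z by rewrite coprimezE coprime_sym.
case/coprimezP => -[a b] /= E; suff : M 1 by rewrite vmax1.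
have -> : 1 = a%:~R * n%:R + b%:~R * q%:R :> algC.
  by rewrite -[q%:R]/((q%:Z)%:~R) -[n%:R]/((n%:Z)%:~R) -!intrM -intrD E.
by apply: vmaxD; apply: vmaxMl => //; exact: vmax_char.
Qed.

Lemma vchar_neq0 : q%:R != 0 :> algC.
Proof. by rewrite pnatr_eq0 -lt0n prime_gt0. Qed.
Hint Resolve vchar_neq0 : core.

(** A power of m is divisible by q and a power of q makes x integral, so high powers of m dominate
    any fixed x. *)
Lemma vmax_archM m x : M m -> exists K0, forall K, (K0 <= K)%N -> M (m ^+ K * x).
Proof.
move=> Mm; have [j j0 Oj] := vmax_arch Mm; have [K OK] := vring_arch V x.
have Omj n : O (m ^+ (j * n) / q%:R ^+ n).
  by rewrite exprM -expr_div_n vringX.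
exists (j * K).+1 => n ltn.
rewrite -(subnK ltn) addnS -addSn exprD -mulrA.
apply: vmaxMr; first exact: vmaxX.
have -> : m ^+ (j * K) * x = m ^+ (j * K) / q%:R ^+ K * (q%:R ^+ K * x).
  by rewrite mulrA divfK ?expf_neq0.
exact: vringM (Omj K) OK.
Qed.

Lemma vmax_nat n : M n%:R = (q %| n)%N.
Proof.
apply/idP/idP => [|/dvdnP[m ->]]; last by rewrite natrM vmaxMl // vmax_char.
by apply: contraTT; rewrite -prime_coprime // => /vunit_coprime/vunit_nmax ->.
Qed.

Lemma vunit_nat n : U n%:R = ~~ (q %| n)%N.
Proof. by rewrite /U vring_nat vmax_nat. Qed.

Lemma vunit_expz (i : int) : U (q%:R ^ i) -> i = 0.
Proof.
have H n : U (q%:R ^+ n) -> n = 0%N.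
  by case: n => // n /vunit_nmax; rewrite vmaxX // vmax_char.
case: i => [n /H -> //|n]; rewrite NegzE -exprnN => /vunitV.
by rewrite invrK => /H.
Qed.

(** Together with [vunit_expz] this stands in for the q-adic valuation of a rational: i is its
    opposite, and it is unique. *)
Lemma vunit_rat (x : algC) : x \in Crat -> x != 0 -> exists i : int, U (x * q%:R ^ i).
Proof.
have Hn (n : nat) : (0 < n)%N -> exists2 i : nat, U (n%:R / q%:R ^+ i) & i = logn q n.
  move=> n0; have [m cqm E] := pfactor_coprime q_pr n0.
  by exists (logn q n) => //; rewrite {1}E natrM natrX mulfK ?expf_neq0 ?vunit_coprime.
case/CratP => a -> ; rewrite fmorph_eq0 => a0.
have [i Ui _] := Hn `|numq a|%N ltac:(by rewrite absz_gt0 numq_eq0).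
have [j Uj _] := Hn `|denq a|%N ltac:(by rewrite absz_gt0 denq_eq0).
exists (j%:Z - i%:Z).
have -> : ratr a = (-1) ^+ (numq a < 0)%R * (`|numq a|%N%:R / `|denq a|%N%:R) :> algC.
  rewrite /ratr {1}(intEsign (numq a)) -{1}(absz_denq a).
  by rewrite rmorphM /= rmorph_sign mulrA.
rewrite expfzDr // -mulrA vunitMr; last by rewrite vunitX // vunitN // vunit1.
have := vunitM Ui (vunitV Uj); congr U.
rewrite -exprnN invf_div; have qj := expf_neq0 j vchar_neq0.
rewrite -!exprnP; field.
by rewrite ?vchar_neq0 ?pnatr_eq0 ?absz_eq0 ?denq_eq0 ?expf_neq0.
Qed.

End PlaceTheory.

(** * Orbits, traces and Newton polygons *)

Lemma autC_perm (nu : autC) (L : seq algC) : uniq L ->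
  {homo nu : x / x \in L} -> perm_eq (map nu L) L.
Proof.
move=> uL nuL; have um : uniq (map nu L) by rewrite map_inj_uniq //; exact: fmorph_inj.
apply: uniq_perm => //.
have [|_ //] := @uniq_min_size _ (map nu L) L um _ ltac:(by rewrite size_map).
by move=> _ /mapP[x xL ->]; apply: nuL.
Qed.

Lemma autC_sum_Crat (L : seq algC) (psi : algC -> algC) : uniq L ->
  (forall (nu : autC) x, x \in L -> nu x \in L) ->
  (forall (nu : autC) x, x \in L -> nu (psi x) = psi (nu x)) ->
  \sum_(x <- L) psi x \in Crat.
Proof.
move=> uL nuL psiL; apply: autC_sep => nu.
rewrite rmorph_sum /= big_seq (eq_bigr (psi \o nu)); last by move=> x /psiL ->.
by rewrite -big_seq -(big_map nu predT) (perm_big L) // autC_perm // => x; apply: nuL.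
Qed.

Lemma autC_prod_Crat (L : seq algC) (psi : algC -> algC) : uniq L ->
  (forall (nu : autC) x, x \in L -> nu x \in L) ->
  (forall (nu : autC) x, x \in L -> nu (psi x) = psi (nu x)) ->
  \prod_(x <- L) psi x \in Crat.
Proof.
move=> uL nuL psiL; apply: autC_sep => nu.
rewrite rmorph_prod /= big_seq (eq_bigr (psi \o nu)); last by move=> x /psiL ->.
by rewrite -big_seq -(big_map nu predT) (perm_big L) // autC_perm // => x; apply: nuL.
Qed.

Lemma autC_orbit (x : algC) : exists s : seq algC, uniq s /\
  forall y, (y \in s) <-> (exists nu : autC, nu x = y).
Proof.
have [t xt] := autC_conj_finite x.
exists [seq y <- undup t | `[< exists nu : autC, nu x = y >]].
split; first by rewrite filter_uniq // undup_uniq.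
move=> y; rewrite mem_filter mem_undup.
split=> [/andP[/asboolP//]|[nu nuxy]].
by apply/andP; split; [apply/asboolP; exists nu | rewrite -nuxy].
Qed.

Definition autC_inv (nu : autC) : autC := algC_invaut nu.

Lemma autC_invK (nu : autC) : cancel nu (autC_inv nu). Proof. exact: algC_autK. Qed.
Lemma autC_invKV (nu : autC) : cancel (autC_inv nu) nu. Proof. exact: algC_invautK. Qed.

Section PlaceRoots.

Variables (q : nat) (V : place q).
Hypothesis q_pr : prime q.
Local Notation O := (vring V).
Local Notation M := (vmax V).
Local Notation U := (vunit V).

(** The product over the orbit is rational and has valuation (size of the orbit) / m, which
    therefore is an integer. *)
Lemma orbit_size_dvd (x : algC) (m : nat) :
  (forall nu : autC, U (nu x ^+ m / q%:R)) ->
  exists s : seq algC, [/\ uniq s, (forall y, (y \in s) <-> (exists nu : autC, nu x = y))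
     & (m %| size s)%N].
Proof.
move=> Hx; have [s [us sP]] := autC_orbit x; exists s; split=> //.
pose t := \prod_(y <- s) y.
have tQ : t \in Crat.
  apply: autC_prod_Crat => // nu y /sP[mu <-]; apply/sP.
  by exists (nu \o mu).
have tU : U (t ^+ m / q%:R ^+ size s).
  have <- : \prod_(y <- s) (y ^+ m / q%:R) = t ^+ m / q%:R ^+ size s.
    rewrite /t; elim: (s) => [|y l IH]; first by rewrite !big_nil expr1n expr0 divr1.
    by rewrite !big_cons IH exprMn exprS invfM mulrACA.
  rewrite big_seq; by apply: vunit_prod => y /sP[nu <-].
have qs0 : q%:R ^+ size s != 0 :> algC by rewrite expf_neq0 // vchar_neq0.
have [m0|m_gt0] := posnP m.
  by move: tU; rewrite m0 expr0 mul1r => /vunitV; rewrite invrK exprnP => /vunit_expz [->].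
have t0 : t != 0.
  by apply: contraTneq (vunit_neq0 tU) => ->; rewrite expr0n gtn_eqF // mul0r eqxx.
have [i Ui] := vunit_rat V q_pr tQ t0.
have : U (q%:R ^ (i * m%:Z + (size s)%:Z)).
  have := vunitM (vunitX m Ui) (vunitV tU); rewrite exprMn invf_div.
  rewrite expfzDr ?vchar_neq0 // -exprz_exp -!exprnP; congr U.
  by field; rewrite expf_neq0.
move/vunit_expz => E; suff : (m%:Z %| (size s)%:Z)%Z by [].
by apply/dvdzP; exists (- i); rewrite mulNr; apply/eqP; rewrite eq_sym eqr_oppLR -addr_eq0 addrC addrC E.
Qed.

(* For large K the term of the isolated root xs dominates the trace of (x - 1)^-K psi(x). *)
Lemma isolated_dvd (L : seq algC) (xs : algC) (psi : algC -> algC) (s e : nat) :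
  uniq L -> (forall (nu : autC) x, x \in L -> nu x \in L) ->
  xs \in L -> (forall x, x \in L -> x != 1) ->
  (forall x, x \in L -> x != xs -> M ((xs - 1) / (x - 1))) ->
  (forall (nu : autC) x, x \in L -> nu (psi x) = psi (nu x)) ->
  U (psi xs ^+ s * q%:R ^+ e) -> (0 < s)%N -> (s %| e)%N.
Proof.
move=> uL nuL xsL L1 iso psiL Us s_gt0.
have ps0 : psi xs != 0.
  by apply: contraTneq (vunit_neq0 Us) => ->; rewrite expr0n gtn_eqF // mul0r eqxx.
have xs1 : xs - 1 != 0 by rewrite subr_eq0 L1.
have [K [HK1 HK2]] : exists K, (forall x, x \in L -> x != xs -> M (((xs - 1) / (x - 1)) ^+ K)) /\
   (forall x, x \in L -> x != xs -> M (((xs - 1) / (x - 1)) ^+ K * (psi x / psi xs))).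
  have H (z : algC -> algC) : exists K0, forall K, (K0 <= K)%N -> forall x, x \in L -> x != xs ->
      M (((xs - 1) / (x - 1)) ^+ K * z x).
    have : {subset L <= L} by []; move: {1 3}L => l; elim: l => [|x l IH] sub; first by exists 0%N.
    have [|K0 HK0] := IH; first by move=> y yl; apply: sub; rewrite inE yl orbT.
    have [->|nx] := eqVneq x xs.
      exists K0 => K leK y; rewrite inE => /orP[/eqP -> /eqP //|yl]; exact: HK0.
    have [K1 HK1] := vmax_archM q_pr (z x) (iso x (sub _ (mem_head _ _)) nx).
    exists (maxn K0 K1) => K; rewrite geq_max => /andP[leK0 leK1] y.
    rewrite inE => /orP[/eqP -> _|yl]; first exact: HK1.
    exact: HK0.
  have [K0 H0] := H (fun=> 1); have [K1 H1] := H (fun x => psi x / psi xs).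
  exists (maxn K0 K1); split=> x xL nx; last by apply: H1; rewrite ?leq_maxr.
  by rewrite -[X in M X]mulr1; apply: H0; rewrite ?leq_maxl.
have main (z : algC -> algC) : z xs != 0 ->
    (forall (nu : autC) x, x \in L -> nu (z x) = z (nu x)) ->
    (forall x, x \in L -> x != xs -> M (((xs - 1) / (x - 1)) ^+ K * (z x / z xs))) ->
    exists2 t, t \in Crat /\ t != 0 & exists2 v, U v & t = (xs - 1) ^- K * z xs * v.
  move=> zs0 zL Hz; pose t := \sum_(x <- L) (x - 1) ^- K * z x.
  have tE : t = (xs - 1) ^- K * z xs *
      (1 + \sum_(x <- L | x != xs) ((xs - 1) / (x - 1)) ^+ K * (z x / z xs)).
    rewrite /t (bigD1_seq xs) //= mulrDr mulr1; congr (_ + _).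
    rewrite mulr_sumr big_seq_cond [RHS]big_seq_cond; apply: eq_bigr => x /andP[xL nx].
    rewrite expr_div_n; field.
    by rewrite zs0 !expf_neq0 // subr_eq0 L1.
  have Uv : U (1 + \sum_(x <- L | x != xs) ((xs - 1) / (x - 1)) ^+ K * (z x / z xs)).
    apply: vunit1D; rewrite big_seq_cond; apply: vmax_sum => x /andP[]; exact: Hz.
  exists t; last by eexists; [exact: Uv | exact: tE].
  split; last by rewrite tE mulf_neq0 ?(vunit_neq0 Uv) // mulf_neq0 // invr_eq0 expf_neq0.
  apply: autC_sum_Crat => // nu x xL.
  by rewrite rmorphM /= zL // fmorphV rmorphXn rmorphB rmorph1.
(* The traces with weights 1 and [psi] are both rational, and their quotient is [psi xs] up to a
   unit; so the valuation -e/s of [psi xs] is an integer. *)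
have [|nu x xL|x xL nx|t0 [t0Q t00] [v0 Uv0 t0E]] := main (fun=> 1); rewrite ?oner_eq0 ?rmorph1 //.
  by rewrite divr1 mulr1; apply: HK1.
have [t1 [t1Q t10] [v1 Uv1 t1E]] := main psi ps0 psiL HK2.
have tE : t1 / t0 = psi xs * (v1 / v0).
  rewrite t1E t0E; field.
  by rewrite (vunit_neq0 Uv0) expf_neq0.
have t10' : t1 / t0 != 0 by rewrite mulf_neq0 ?invr_eq0.
have [i Ui] := vunit_rat V q_pr (rpred_div t1Q t0Q) t10'.
have : U (psi xs * q%:R ^ i).
  by move: Ui; rewrite tE mulrAC [_ * (v1 / v0)]mulrC (vunitMr _ (vunitM Uv1 (vunitV Uv0))).
move=> /(vunitX s)/vunitV/(vunitM Us).
rewrite exprMn invfM mulrACA divff ?expf_neq0 // mul1r.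
have q0 := vchar_neq0 q_pr.
rewrite !exprnP exprz_exp invr_expz -expfzDr // => /vunit_expz E.
suff : (s%:Z %| e%:Z)%Z by [].
by apply/dvdzP; exists i; apply/eqP; rewrite -subr_eq0 E.
Qed.

(** Linear factors normalized to be primitive: modulo M a factor becomes 'X, 'X minus a nonzero
    constant, or 1. The reduction of the product thus has order [count M w] at 0 and degree
    [count O w], which is the slope-zero part of the Newton polygon. *)
Let fac z : {poly algC} := if O z then 'X - z%:P else 1 - z^-1 *: 'X.
Let redP (w : seq algC) := \prod_(z <- w) fac z.

Lemma red_spec w : let a := count M w in let e := count O w in
  [/\ (forall i, O (redP w)`_i), (forall i, (i < a)%N -> M (redP w)`_i),
      U (redP w)`_a, U (redP w)`_e & (forall i, (e < i)%N -> M (redP w)`_i)].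
Proof.
rewrite /redP; elim: w => [|z w]; first rewrite big_nil /=.
  split=> [i|//|||i]; rewrite ?coef1 ?vunit1 //; first by case: eqP => // _; exact: vring_nat.
  by case: i => // i _; exact: vmax0.
rewrite big_cons; set H := \prod_(_ <- w) _ => /= -[HO Ha Ua Ue He].
rewrite /fac; case Oz: (O z); last first.
  have zV : M z^-1 by apply: vring_total; rewrite Oz.
  have -> : M z = false by apply: contraFF Oz => /vmaxW.
  have cE i : ((1 - z^-1 *: 'X) * H)`_i = H`_i - z^-1 * ('X * H)`_i.
    by rewrite mulrBl mul1r coefB -scalerAl coefZ.
  have MX i : M (z^-1 * ('X * H)`_i).
    apply: vmaxMr => //; rewrite coefXM; case: eqP => // _; exact: vring0.
  rewrite /= !add0n; split=> [i|i lti|||i lti]; rewrite cE.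
  - by apply: vringB => //; exact: vmaxW.
  - by apply: vmaxB => //; exact: Ha.
  - by apply: vunitD => //; exact: vmaxN.
  - by apply: vunitD => //; exact: vmaxN.
  - by apply: vmaxB => //; exact: He.
have cE i : (('X - z%:P) * H)`_i = (if i is j.+1 then H`_j else 0) - z * H`_i.
  by rewrite mulrBl coefB coefXM coefCM; case: i.
have Oall i : O (('X - z%:P) * H)`_i.
  rewrite cE; apply: vringB; last exact: vringM.
  by case: i => // ; exact: vring0.
case Mz: (M z); rewrite /= ?add1n ?add0n.
  have Mzi i : M (z * H`_i) by apply: vmaxMr.
  split=> [//|i lti|||i lti]; rewrite cE.
  - apply: vmaxB => //; case: i lti => [|i lti]; [by move=> _; exact: vmax0 | exact: Ha].
  - by apply: vunitD => //; exact: vmaxN.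
  - by apply: vunitD => //; exact: vmaxN.
  - apply: vmaxB => //; case: i lti => // i; exact: He.
have Uz : U z by rewrite /vunit Oz Mz.
split=> [//|i lti|||i lti]; rewrite cE.
- apply: vmaxB; last by rewrite vmaxMl // Ha.
  by case: i lti => [_|i /ltnW]; [exact: vmax0 | exact: Ha].
- rewrite addrC; apply: vunitD; first by rewrite vunitN // vunitM.
  by case: (count M w) Ha => [_|a Ha]; [exact: vmax0 | exact: Ha].
- by apply: vunitD => //; apply/vmaxN/vmaxMl => //; exact: He.
- apply: vmaxB; last by apply: vmaxMl => //; apply: He; exact: ltnW.
  by case: i lti => // i; exact: He.
Qed.

Lemma unit_coef_prod_XsubC w : {in w, forall z, O z} ->
  U (\prod_(z <- w) ('X - z%:P))`_(count M w).
Proof.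
move=> wO; have [_ _ + _ _] := red_spec w.
have -> // : redP w = \prod_(z <- w) ('X - z%:P).
by apply: eq_big_seq => z zw; rewrite /fac wO.
Qed.

Lemma low_coef_prod_XsubC w i : {in w, forall z, O z} -> (i < count M w)%N ->
  M (\prod_(z <- w) ('X - z%:P))`_i.
Proof.
move=> wO; have [_ + _ _ _] := red_spec w => /(_ i).
have -> // : redP w = \prod_(z <- w) ('X - z%:P).
by apply: eq_big_seq => z zw; rewrite /fac wO.
Qed.

(** G is proportional to the normalized product of [red_spec]; both have integral coefficients and
    one unit among them, so the factor is a unit and the first and last unit coefficients agree. *)
Lemma root_count (G : {poly algC}) (w : seq algC) (c : algC) (a e : nat) :
  G = c *: \prod_(z <- w) ('X - z%:P) -> (forall i, O G`_i) ->
  (forall i, (i < a)%N -> M G`_i) -> U G`_a -> U G`_e ->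
  (forall i, (e < i)%N -> M G`_i) -> count M w = a /\ count O w = e.
Proof.
move=> GE GO Ga UGa UGe Ge; have [HO Ha Ua Ue He] := red_spec w.
set H := redP w in HO Ha Ua Ue He.
have [u GH] : exists u, G = u *: H.
  suff [v vE] : exists v, \prod_(z <- w) ('X - z%:P) = v *: H.
    by exists (c * v); rewrite GE vE scalerA.
  rewrite /H /redP; elim: (w) => [|z w' [v IH]]; first by exists 1; rewrite !big_nil scale1r.
  rewrite !big_cons IH /fac; case: ifP => [_|nO]; first by exists v; rewrite -scalerAr.
  have z0 : z != 0 by apply: (@nvring_neq0 _ V); rewrite nO.
  have -> : 'X - z%:P = (- z) *: (1 - z^-1 *: 'X) :> {poly algC}.
    by rewrite scalerBr scalerA mulNr divff // !scaleNr scale1r opprK alg_polyC addrC.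
  by exists (v * - z); rewrite -scalerAr -scalerAl scalerA.
have cE i : G`_i = u * H`_i by rewrite GH coefZ.
have Ou : O u.
  have := GO (count M w); rewrite cE mulrC vringM_unit //.
have Uu : U u.
  by case: (vring_case Ou) => // Mu; have := vunit_nmax UGa; rewrite cE vmaxMr.
have UH i : U G`_i = U H`_i by rewrite cE vunitMr.
have MH i : M G`_i = M H`_i by rewrite cE vmaxM_unit.
split.
  case: (ltngtP (count M w) a) => // lt.
    by have := vunit_nmax Ua; rewrite -MH Ga.
  by have := vunit_nmax UGa; rewrite MH Ha.
case: (ltngtP (count O w) e) => // lt.
  by have := vunit_nmax UGe; rewrite MH He.
by have := vunit_nmax Ue; rewrite -MH Ge.
Qed.

End PlaceRoots.

(** * Inertia *)

Section Inertia.

Variables (q : nat) (V : place q).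
Hypothesis q_pr : prime q.
Local Notation O := (vring V).
Local Notation M := (vmax V).
Local Notation U := (vunit V).

(** Gauss's lemma: the lowest coefficients outside M multiply to a coefficient outside M, all the
    other contributions to it being in M. *)
Lemma vmax_polyM (p r : {poly algC}) : (forall i, O p`_i) -> (forall i, O r`_i) ->
  (forall i, M (p * r)`_i) -> (forall i, M p`_i) \/ (forall i, M r`_i).
Proof.
move=> Op Or Mpr.
have [Mp|nMp] := pselect (forall i, M p`_i); first by left.
have [Mr|nMr] := pselect (forall i, M r`_i); first by right.
have minx (p' : {poly algC}) : ~ (forall i, M p'`_i) ->
    exists2 i, ~~ M p'`_i & forall j, (j < i)%N -> M p'`_j.
  move=> nM; have ex : exists i, ~~ M p'`_i.
    by apply: contrapT => H; apply: nM => i; apply: contraT => Hi; case: H; exists i.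
  exists (ex_minn ex); case: ex_minnP => // m nm mn j.
  by apply: contraTT => /mn; rewrite -leqNgt.
have [i nMi mi] := minx _ nMp; have [j nMj mj] := minx _ nMr.
suff : M (p`_i * r`_j).
  by case/(vmax_prime (Op i) (Or j)) => [Mi|Mj]; [rewrite Mi in nMi | rewrite Mj in nMj].
have := Mpr (i + j)%N; rewrite coefM.
have lti : (i < (i + j).+1)%N by rewrite ltnS leq_addr.
rewrite (bigD1 (Ordinal lti)) //= addKn => MS.
rewrite -[X in M X](addrK (\sum_(k < (i + j).+1 | k != Ordinal lti) p`_k * r`_(i + j - k))).
apply: vmaxB => //; apply: vmax_sum => k nk.
have [ltk|] := ltnP k i; first by rewrite vmaxMr // mi.
rewrite leq_eqVlt => /orP[/eqP Ek|ltk]; first by case/eqP: nk; apply: val_inj.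
apply: vmaxMl => //; apply: mj.
rewrite ltn_subLR; last by rewrite -ltnS.
by rewrite ltn_add2r.
Qed.

Lemma vmax_poly_prod (I : eqType) (l : seq I) (P : pred I) (F : I -> {poly algC}) :
  (forall y, y \in l -> forall i, O (F y)`_i) ->
  (forall i, M (\prod_(y <- l | P y) F y)`_i) ->
  exists2 y, y \in l & P y /\ forall i, M (F y)`_i.
Proof.
elim: l => [|y l IH] OF Mi.
  by have := Mi 0%N; rewrite big_nil coef1 vmax1.
have OFl z : z \in l -> forall i, O (F z)`_i by move=> zl; apply: OF; rewrite inE zl orbT.
have step : (forall i, M (\prod_(y <- l | P y) F y)`_i) ->
    exists2 z, z \in y :: l & P z /\ forall i, M (F z)`_i.
  by case/(IH OFl) => z zl Hz; exists z => //; rewrite inE zl orbT.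
move: Mi; rewrite big_cons; case: ifP => // Py Mi.
have Ol i : O (\prod_(y <- l | P y) F y)`_i.
  move: i; rewrite big_seq_cond; elim/big_rec: _ => [i|z r /andP[zl _] Or i].
    by rewrite coef1; exact: vring_nat.
  by rewrite coefM; apply: vring_sum => k _; apply: vringM => //; exact: OFl.
case: (vmax_polyM (OF _ (mem_head _ _)) Ol Mi) => // My.
by exists y; rewrite ?mem_head.
Qed.

(** An inertia element without ramification theory. Embeddings of a number field containing [de] and
    [La] are split according to the image of [de]; oddness of the valuation forces the two halves to
    have the same characteristic polynomials modulo M, so an embedding of one half is congruent to
    one of the other. *)
Lemma inertia_finite (de : algC) (La : seq algC) (i : int) :
  de \in Aint -> de ^+ 2 \in Crat -> U (de ^+ 2 * q%:R ^ i) -> odd `|i|%N ->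
  {in La, forall x, x \in Aint} ->
  exists nu : autC, nu de = - de /\ forall x, x \in La -> M (nu x - x).
Proof.
move=> deA de2Q Ude odd_i LaA.
have de0 : de != 0 by apply: contraTneq (vunit_neq0 Ude) => ->; rewrite expr0n mul0r eqxx.
have nude (nu : autC) : nu de = de \/ nu de = - de.
  have : nu (de ^+ 2) = de ^+ 2 by rewrite aut_Crat.
  rewrite rmorphXn /= => /eqP; rewrite eqf_sqr => /orP[]/eqP; by [left|right].
have deN : de != - de.
  by rewrite -addr_eq0 -mulr2n mulrn_eq0 negb_or.
have [z _ [ps Dps]] := algC_PET (de :: La).
have [Z [uZ ZP]] := autC_orbit z.
have zZ : z \in Z by apply/ZP; exists idfun.
have nuZ (nu : autC) y : y \in Z -> nu y \in Z.
  by case/ZP => mu <-; apply/ZP; exists (nu \o mu).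
pose s := de :: La.
pose ev (y : algC) k := (map_poly ratr ps`_k).[y] : algC.
have szps : size ps = size s by rewrite /s Dps size_map.
have evz k : ev z k = s`_k.
  have [lt|le] := ltnP k (size s); first by rewrite /s Dps (nth_map 0) // szps.
  by rewrite /ev !nth_default ?szps // map_poly0 horner0.
have evnu (nu : autC) y k : nu (ev y k) = ev (nu y) k.
  by rewrite /ev -horner_map /= map_ratr_gal.
have evA y k : y \in Z -> ev y k \in Aint.
  case/ZP => nu <-; rewrite -evnu Aint_aut evz.
  have [lt|le] := ltnP k (size s); last by rewrite nth_default // Aint0.
  by have := mem_nth 0 lt; rewrite {2}/s inE => /orP[/eqP ->|/LaA].
pose D y := ev y 0.
have Dz : D z = de by rewrite /D evz.
have Dy y : y \in Z -> D y = de \/ D y = - de.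
  by case/ZP => nu <-; rewrite /D -evnu evz; apply: nude.
(* The images of the whole list under the embedding attached to y, packed as coefficients, so that
   one congruence of polynomials controls all of them. *)
pose om y : {poly algC} := \poly_(k < size s) ev y k.
have omE y k : y \in Z -> (om y)`_k = ev y k.
  rewrite coef_poly; case: ltnP => // le; case/ZP => nu <-.
  by rewrite -evnu evz nth_default // rmorph0.
have omA y k : y \in Z -> (om y)`_k \in Aint.
  by rewrite coef_poly; case: ltnP => [_ /evA ->|_ _] //; rewrite Aint0.
pose Phi b : {poly {poly algC}} := \prod_(y <- Z | (D y == de) == b) ('X - (om y)%:P).
have PhiA b j k : (Phi b)`_j`_k \in Aint.
  have : forall j k, (Phi b)`_j`_k \in Aint; last exact.
  rewrite /Phi big_seq_cond; elim/big_rec: _ => [j' k'|y p /andP[yZ _] IH j' k'].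
    by rewrite coef1; case: eqP => _; rewrite ?mulr0n ?coef0 ?Aint0 // mulr1n coef1 rpred_nat.
  rewrite mulrBl coefB coefXM coefCM coefB rpredB //; first by case: eqP => //; rewrite coef0 Aint0.
  by rewrite coefM rpred_sum // => i' _; rewrite rpredM ?omA.
have nuPhi (nu : autC) b : map_poly (map_poly nu) (Phi b) = Phi (if nu de == de then b else ~~ b).
  rewrite /Phi rmorph_prod /= (eq_bigr (fun y => 'X - (om (nu y))%:P)); last first.
    move=> y _; rewrite rmorphB /= map_polyX map_polyC /=; congr (_ - _%:P).
    by apply/polyP => k; rewrite coef_map /= !coef_poly; case: ifP => _; rewrite ?rmorph0.
  rewrite [RHS](perm_big (map nu Z)) /=; last by rewrite perm_sym autC_perm // => x; apply: nuZ.
  rewrite big_map big_seq_cond [RHS]big_seq_cond.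
  apply: eq_bigl => y; case yZ: (y \in Z) => //=.
  have -> : D (nu y) = nu (D y) by rewrite /D evnu.
  case: (nude nu) => nd; rewrite nd ?eqxx.
    by case: (Dy y yZ) => ->; rewrite ?rmorphN /= nd.
  rewrite [- de == de]eq_sym (negbTE deN).
  case: (Dy y yZ) => ->; rewrite ?rmorphN /= nd ?opprK ?eqxx ?[- de == de]eq_sym (negbTE deN).
    by case: b.
  by case: b.
(* A coefficient u of the difference changes sign with [de], so u [de] is rational. If u were a
   unit, the square of u [de] would have odd valuation. *)
have Mu j k : M (Phi true - Phi false)`_j`_k.
  set u := _`_k.
  have uA : u \in Aint by rewrite /u !coefB rpredB.
  have [->|u0] := eqVneq u 0; first exact: vmax0.
  have nuu (nu : autC) : nu u = if nu de == de then u else - u.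
    have E b : nu ((Phi b)`_j)`_k = (Phi (if nu de == de then b else ~~ b))`_j`_k.
      by rewrite -nuPhi !coef_map.
    rewrite /u !coefB rmorphB /= !E; case: ifP => //= _.
    by rewrite opprB.
  have udQ : u * de \in Crat.
    apply: autC_sep => nu; rewrite rmorphM /= nuu.
    by case: eqP (nude nu) => [-> //|_ [//|->]]; rewrite mulrNN.
  have ud0 : u * de != 0 by rewrite mulf_neq0.
  have [a Ua] := vunit_rat V q_pr udQ ud0.
  case: (vring_case (vring_Aint V uA)) => // Uu; exfalso.
  have q0 := vchar_neq0 q_pr.
  have : U (q%:R ^ (a + a - i)).
    have := vunitM (vunitM (vunitX 2 Ua) (vunitV Ude)) (vunitV (vunitX 2 Uu)).
    rewrite !expfzDr // -invr_expz; congr U; field.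
    by rewrite u0 de0 expfz_neq0.
  by move/vunit_expz; move: odd_i; clear; lia.
have xiO j : O (om z)`_j by apply: vring_Aint; rewrite omA.
(* [om z] is a root of [Phi true], hence a root of [Phi false] modulo M; [vmax_poly_prod] then picks
   a factor that vanishes modulo M. *)
have Mprod k : M (\prod_(y <- Z | (D y == de) == false) (om z - om y))`_k.
  have -> : \prod_(y <- Z | (D y == de) == false) (om z - om y) = - (Phi true - Phi false).[om z].
    rewrite hornerD hornerN opprB /Phi !horner_prod.
    rewrite [X in _ - X](big_rem z) //= Dz !eqxx hornerXsubC subrr mul0r subr0.
    by apply: eq_bigr => y _; rewrite hornerXsubC.
  rewrite coefN; apply: vmaxN; rewrite horner_coef coef_sum; apply: vmax_sum => j _.
  rewrite coefM; apply: vmax_sum => l _; apply: vmaxMr => //.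
  move: (k - l)%N; elim: (nat_of_ord j) => [|n IH] m.
    by rewrite expr0 coef1; exact: vring_nat.
  by rewrite exprS coefM; apply: vring_sum => ? _; apply: vringM.
have Odif y : y \in Z -> forall k, O (om z - om y)`_k.
  by move=> yZ k; rewrite coefB vringB // vring_Aint ?omA.
have [y yZ [/eqP Dyn My]] := vmax_poly_prod Odif Mprod.
have /ZP[nu nuz] := yZ; exists nu; split.
  have DyE : D y = nu de by rewrite /D -nuz -evnu evz.
  by case: (nude nu) => // nd; move: Dyn; rewrite DyE nd eqxx.
move=> x xL; have [k ltk <-] := nthP 0 xL.
have := My k.+1; rewrite coefB !omE // evz -nuz -evnu evz /= => /vmaxN.
by rewrite opprB.
Qed.

(** Scaling [de] by its denominator shifts the valuation by an even integer, and compactness passes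
    from finite sets of algebraic integers to all of them. *)
Lemma inertia (de : algC) (i : int) : de ^+ 2 \in Crat -> U (de ^+ 2 * q%:R ^ i) ->
  odd `|i|%N -> exists nu : autC, nu de = - de /\ forall x, x \in Aint -> M (nu x - x).
Proof.
move=> de2Q Ude odd_i.
have [b b0 bde] : exists2 b : int, b != 0 & (b%:~R * de) \in Aint.
  have /CratP[a aE] := de2Q; exists (denq a); first exact: denq_neq0.
  apply: (@root_monic_Aint_Aint ('X^2 - ((numq a * denq a)%:~R)%:P)).
  - exact: monicXnsubC.
  - rewrite rootE hornerD hornerN hornerC hornerXn exprMn aE {1}/ratr subr_eq0 intrM.
    have d0 : (denq a)%:~R != 0 :> algC by rewrite intr_eq0 denq_eq0.
    by apply/eqP; field.
  by move=> k; rewrite coefB coefXn coefC rpredB ?rpred_nat //; case: eqP => _; rewrite ?Aint_int ?Aint0.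
have b0' : b%:~R != 0 :> algC by rewrite intr_eq0.
have bQ : (b%:~R : algC) \in Crat by rewrite rpred_int.
have [e Ue] := vunit_rat V q_pr bQ b0'.
have q0 := vchar_neq0 q_pr.
have Ub : U ((b%:~R * de) ^+ 2 * q%:R ^ (i + e + e)).
  have := vunitM Ude (vunitX 2 Ue); rewrite !expfzDr //; congr U; ring.
have bdeQ : (b%:~R * de) ^+ 2 \in Crat by rewrite exprMn rpredM // rpredX.
have odd' : odd (absz (i + e + e)) by move: odd_i; clear; lia.
have [|nu nuP] := @autC_compact (fun x y => (x = b%:~R * de -> y = - (b%:~R * de)) /\
    (x \in Aint -> M (y - x))).
  move=> s; pose La := [seq x <- s | x \in Aint].
  have [|nu [nud nuL]] := inertia_finite (La := La) bde bdeQ Ub odd'.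
    by move=> x; rewrite mem_filter => /andP[].
  exists nu => x xs; split=> [-> //|xA]; apply: nuL.
  by rewrite mem_filter xA.
exists nu; split; last by move=> x; case: (nuP x).
have [/(_ erefl) + _] := nuP (b%:~R * de).
by rewrite rmorphM /= rmorph_int -mulrN => /(mulfI b0').
Qed.

Definition inertial (nu : autC) := forall x, x \in Aint -> M (nu x - x).

Lemma inertialP (nu : autC) : inertial nu -> forall x, O x -> O (nu x) /\ M (nu x - x).
Proof.
move=> In x /vring_frac[a [s [aA sA nMs ->]]]; rewrite fmorph_div.
have Us : U s by rewrite /vunit vring_Aint.
have Uns : U (nu s) by apply: vunit_eqmax Us _; rewrite vmax_sym In.
have Ona : O (nu a) by apply: vring_Aint; rewrite Aint_aut.
split; first by apply: vringM => //; exact: vunitVr.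
have -> : nu a / nu s - a / s = ((nu a - a) * s - a * (nu s - s)) / (nu s * s).
  by field; rewrite (vunit_neq0 Us) (vunit_neq0 Uns).
apply: vmaxMr; last by apply: vunitVr; exact: vunitM.
apply: vmaxB; first by apply: vmaxMr; [exact: In | exact: vunit_ring].
by apply: vmaxMl; [exact: vring_Aint | exact: In].
Qed.

Lemma inertial_iter (nu : autC) n x : inertial nu -> O x ->
  O (iter n nu x) /\ M (iter n nu x - x).
Proof.
move=> In Ox; elim: n => [|n [On Mn]] /=; first by rewrite subrr vmax0.
have [On' Mn'] := inertialP In On; split=> //; exact: vmax_trans Mn' Mn.
Qed.

End Inertia.

(** * Generating sibling permutations *)

Definition swap (T : eqType) (a b x : T) := if x == a then b else if x == b then a else x.
Definition cyc3 (T : eqType) (i j k x : T) :=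
  if x == i then j else if x == j then k else if x == k then i else x.

Section Swaps.
Variable T : eqType.
Implicit Types a b c x : T.

Lemma swapK a b : involutive (swap a b).
Proof.
move=> x; rewrite /swap; have [->|xa] := eqVneq x a.
  by have [->|] := eqVneq b a; rewrite ?eqxx.
by have [->|xb] := eqVneq x b; rewrite ?eqxx // (negbTE xa) (negbTE xb).
Qed.
Lemma swapC a b x : swap a b x = swap b a x.
Proof. by rewrite /swap; repeat (case: eqP => ? //=); congruence. Qed.
Lemma swapL a b : swap a b a = b. Proof. by rewrite /swap eqxx. Qed.
Lemma swapR a b : swap a b b = a.
Proof. by rewrite /swap eqxx; case: eqP => // ->. Qed.
Lemma swapD a b x : x != a -> x != b -> swap a b x = x.
Proof. by rewrite /swap => /negbTE -> /negbTE ->. Qed.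
Lemma swap_id a x : swap a a x = x.
Proof. by rewrite /swap; case: eqP => // ->. Qed.

Lemma swap_swap_cyc3 a b c x : uniq [:: a; b; c] -> swap a c (swap a b x) = cyc3 a b c x.
Proof.
rewrite /= !inE !negb_or => /and3P[/andP[/eqP ab /eqP ac] /eqP bc _]; rewrite /swap /cyc3.
case: (x =P a) => ?; case: (x =P b) => ? /=;
  repeat (case: eqP => ? /=); congruence.
Qed.

Lemma swap_swap_cyc3' a b c x : uniq [:: a; b; c] -> swap a b (swap b c x) = cyc3 a b c x.
Proof.
rewrite /= !inE !negb_or => /and3P[/andP[/eqP ab /eqP ac] /eqP bc _]; rewrite /swap /cyc3.
case: (x =P b) => ?; case: (x =P c) => ? /=;
  repeat (case: eqP => ? /=); congruence.
Qed.

Lemma cyc3K i j k x : uniq [:: i; j; k] -> cyc3 i j k (cyc3 k j i x) = x.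
Proof.
rewrite /= !inE !negb_or => /and3P[/andP[/eqP ab /eqP ac] /eqP bc _]; rewrite /cyc3.
case: (x =P k) => ?; case: (x =P j) => ?; case: (x =P i) => ? /=;
  repeat (case: eqP => ? /=); congruence.
Qed.

(** The commutator of two 3-cycles sharing exactly one point is a 3-cycle. It takes five points,
    which is where [5 <= d] enters. *)
Lemma cyc3_comm i j k l m x : uniq [:: i; j; k; l; m] ->
  cyc3 i j l (cyc3 i k m (cyc3 l j i (cyc3 m k i x))) = cyc3 i j k x.
Proof.
rewrite /= !inE !negb_or.
case/and5P=> /and4P[/eqP ij /eqP ik /eqP il /eqP im] /and3P[/eqP jk /eqP jl /eqP jm].
move=> /andP[/eqP kl /eqP km] /eqP lm _.
have F (a b : T) (h : a <> b) : ((a == b) = false) * ((b == a) = false).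
  by rewrite [b == a]eq_sym; move/eqP/negbTE: h => ->.
pose rw := (F _ _ ij, F _ _ ik, F _ _ il, F _ _ im, F _ _ jk, F _ _ jl, F _ _ jm, F _ _ kl,
  F _ _ km, F _ _ lm, eqxx).
rewrite /cyc3; case: (x =P i) => [->|xi]; first by rewrite !rw.
case: (x =P j) => [->|xj]; first by rewrite !rw.
case: (x =P k) => [->|xk]; first by rewrite !rw.
case: (x =P l) => [->|xl]; first by rewrite !rw.
case: (x =P m) => [->|xm]; first by rewrite !rw.
by rewrite !(F _ _ xi, F _ _ xj, F _ _ xk, F _ _ xl, F _ _ xm).
Qed.

(** Induction on the number of points moved: composing t with the swap of x and [t x] makes x fixed.
    The relation R is there to keep the swaps inside sibling sets. *)
Lemma perm_by_swaps (S : seq T) (R : rel T) (G : (T -> T) -> Prop) : uniq S ->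
  (forall t t', {in S, t =1 t'} -> G t -> G t') -> G id ->
  (forall t1 t2, G t1 -> G t2 -> {homo t2 : x / x \in S} -> G (t1 \o t2)) ->
  (forall a b, a \in S -> b \in S -> R a b -> G (swap a b)) ->
  (forall a, R a a) -> (forall a b c, R a b -> R b c -> R a c) ->
  forall t, {homo t : x / x \in S} -> {in S &, injective t} ->
    (forall x, x \in S -> R x (t x)) -> G t.
Proof.
move=> uS Gext G1 GM Gsw Rrefl Rtr t.
move: {2}(count _ _).+1 (ltnSn (count (fun x => t x != x) S)) => n.
elim: n => // n IH in t * => ltn tS tinj tR.
have [/hasP[x xS nx]|nh] := boolP (has (fun x => t x != x) S); last first.
  apply: Gext G1 => x xS; apply/esym/eqP; apply: contraR nh => nx.
  by apply/hasP; exists x.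
pose y := t x; pose t' := swap x y \o t.
have yS : y \in S by apply: tS.
have t'x : t' x = x by rewrite /t' /= swapR.
have swS z : z \in S -> swap x y z \in S.
  by rewrite /swap; case: eqP => // _; case: eqP.
have t'S : {homo t' : z / z \in S} by move=> z zS; apply/swS/tS.
apply: (Gext (swap x y \o t')); first by move=> z _ /=; rewrite swapK.
apply: GM => //; first by apply: Gsw => //; apply: tR.
apply: IH => //.
- rewrite -ltnS; apply: leq_trans ltn; rewrite ltnS -!size_filter.
  have xF : x \in [seq z <- S | t z != z] by rewrite mem_filter nx.
  have szF := size_rem xF.
  have pos : (0 < size [seq z <- S | t z != z])%N by case: [seq _ <- _ | _] xF.
  rewrite -(prednK pos) ltnS -szF; apply: uniq_leq_size; first exact: filter_uniq.
  move=> z; rewrite mem_filter mem_rem_uniq ?filter_uniq // inE mem_filter => /andP[nz zS].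
  rewrite zS andbT; have [E|zx] /= := eqVneq z x; first by rewrite E t'x eqxx in nz.
  apply: contra nz => /eqP tz; rewrite /t' /= tz swapD //.
  by apply: contra zx => /eqP E; apply/eqP/tinj; rewrite // tz E.
- move=> z1 z2 z1S z2S /= E; apply: tinj => //.
  by apply: (can_inj (swapK x y)).
move=> z zS; rewrite /t' /=; have [E|tzx] := eqVneq (t z) x.
  by rewrite E swapL; apply: Rtr (tR x xS); rewrite -E; exact: tR.
have [E|tzy] := eqVneq (t z) y; last by rewrite swapD //; exact: tR.
have -> : z = x by apply: tinj.
by rewrite -/y swapR.
Qed.

End Swaps.

Section TreeGroup.

Variables (g : algC -> algC) (d : nat) (fib : algC -> seq algC).
Hypothesis g_aut : forall (nu : autC) x, nu (g x) = g (nu x).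
Hypothesis mem_fib : forall a y, (y \in fib a) = (g y == a).
Hypothesis size_fib : forall a, size (fib a) = d.

(** A list with multiplicities, of length d^n by construction; a Galois orbit of that size then
    gives distinctness and transitivity at once. *)
Fixpoint Lev n := if n is n'.+1 then flatten (map fib (Lev n')) else [:: 0 : algC].

Lemma mem_LevS n x : (x \in Lev n.+1) = (g x \in Lev n).
Proof.
apply/flatten_mapP/idP => [[a aL]|gL]; first by rewrite mem_fib => /eqP ->.
by exists (g x); rewrite ?mem_fib.
Qed.

Lemma mem_Lev n x : (x \in Lev n) = (iter n g x == 0).
Proof. by elim: n x => [|n IH] x; [rewrite inE | rewrite mem_LevS IH iterSr]. Qed.

Lemma iter_aut (nu : autC) n x : nu (iter n g x) = iter n g (nu x).
Proof. by elim: n => //= n <-; rewrite g_aut. Qed.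

Lemma Lev_aut (nu : autC) n x : (nu x \in Lev n) = (x \in Lev n).
Proof. by rewrite !mem_Lev -iter_aut fmorph_eq0. Qed.

Lemma fib_Lev n a x : a \in Lev n -> x \in fib a -> x \in Lev n.+1.
Proof. by rewrite mem_LevS mem_fib => aL /eqP ->. Qed.

Lemma fib_aut (nu : autC) a x : (nu x \in fib (nu a)) = (x \in fib a).
Proof. by rewrite !mem_fib -g_aut (inj_eq (fmorph_inj nu)). Qed.

Hypothesis uniq_Lev : forall n, uniq (Lev n).
Hypothesis trans_Lev : forall n x y, x \in Lev n -> y \in Lev n -> exists nu : autC, nu x = y.
Hypothesis d_ge5 : (5 <= d)%N.
Hypothesis d_even : ~~ odd d.

Lemma size_Lev n : size (Lev n) = (d ^ n)%N.
Proof.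
elim: n => // n IH; rewrite /= size_flatten /shape -map_comp.
rewrite (eq_map (g := fun=> d)) => [|a /=]; last exact: size_fib.
by rewrite expnS mulnC -IH; elim: (Lev n) => //= _ l ->; rewrite mulSn.
Qed.

Lemma uniq_fib n a : a \in Lev n -> uniq (fib a).
Proof.
move=> aL; have := uniq_Lev n.+1; rewrite /=; elim: (Lev n) aL => // b l IH.
rewrite inE /= cat_uniq => /orP[/eqP ->|/IH H] /and3P[]; first by [].
by move=> _ _ /H.
Qed.

Lemma autC_invE (nu : autC) x y : nu x = y -> autC_inv nu y = x.
Proof. by move=> <-; rewrite autC_invK. Qed.

Lemma autC_invg (nu : autC) x : autC_inv nu (g x) = g (autC_inv nu x).
Proof. exact: g_aut. Qed.

Definition realized n (t : algC -> algC) := exists nu : autC, {in Lev n, nu =1 t}.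

Definition all_swaps n := forall a b, a \in Lev n -> b \in Lev n -> g a = g b ->
  realized n (swap a b).

Lemma realized_fiber_perm n (t : algC -> algC) : all_swaps n.+1 ->
  {in Lev n.+1, forall x, g (t x) = g x} -> {in Lev n.+1 &, injective t} -> realized n.+1 t.
Proof.
move=> sw tg tinj; apply: (@perm_by_swaps _ (Lev n.+1) (fun x y => g x == g y)) => //.
- by move=> t1 t2 E [nu nuE]; exists nu => x xL; rewrite nuE // E.
- by exists idfun.
- by move=> t1 t2 [n1 E1] [n2 E2] t2L; exists (n1 \o n2) => x xL /=; rewrite E2 // E1 // t2L.
- by move=> a b aL bL /eqP; apply: sw.
- by move=> a b c /eqP -> /eqP ->.
- by move=> x xL; rewrite mem_LevS tg // -mem_LevS.
by move=> x xL; rewrite tg.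
Qed.

(** * From an odd product of sibling transpositions on one level to every sibling transposition *)

Section Level.

Variable n : nat.
Variables (si : autC) (Z : pred algC) (A B : algC -> algC).
Hypothesis Z_odd : odd (count Z (Lev n)).
Hypothesis AB_Z : forall z, z \in Lev n -> Z z -> [/\ A z != B z, g (A z) = z & g (B z) = z].
Hypothesis siE : forall x, x \in Lev n.+1 ->
  si x = if Z (g x) then swap (A (g x)) (B (g x)) x else x.
Hypothesis Z_fam : forall c, c \in Lev n -> exists2 z, g z = g c & ~~ Z z.
Hypothesis block : forall cl : rel algC,
  (forall (nu : autC) x y, cl (nu x) (nu y) = cl x y) ->
  (forall x, x \in Lev n.+1 -> cl x x) ->
  (forall x y, x \in Lev n.+1 -> cl x y -> cl y x /\ g y = g x) ->
  (forall x y z, x \in Lev n.+1 -> cl x y -> cl y z -> cl x z) ->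
  (exists x y, [/\ x \in Lev n.+1, x != y & cl x y]) ->
  forall x y, x \in Lev n.+1 -> g x = g y -> cl x y.
Hypothesis IHswaps : forall m, (m < n)%N -> all_swaps m.+1.

Definition fixes (nu : autC) := {in Lev n, nu =1 id}.

Lemma fixes_comp (nu mu : autC) : fixes nu -> fixes mu -> fixes (nu \o mu).
Proof. by move=> fn fm x xL /=; rewrite fm // fn. Qed.

Lemma fixes_inv nu : fixes nu -> fixes (autC_inv nu).
Proof. by move=> fn x xL; apply: autC_invE; rewrite fn. Qed.

Lemma fixes_g nu x : fixes nu -> x \in Lev n.+1 -> g (nu x) = g x.
Proof. by move=> fn; rewrite mem_LevS => gL; rewrite -g_aut fn. Qed.

Lemma fixes_fib nu a x : fixes nu -> a \in Lev n -> (nu x \in fib a) = (x \in fib a).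
Proof. by move=> fn aL; rewrite -{1}(fn a aL) fib_aut. Qed.

Lemma fixes_conj (mu nu : autC) : fixes nu -> fixes (mu \o nu \o autC_inv mu).
Proof. by move=> fn x xL /=; rewrite fn ?autC_invKV // Lev_aut. Qed.

Lemma nonempty_fib a : exists x, x \in fib a.
Proof. by have := size_fib a; case: (fib a) => [|x l _]; [case: d d_ge5 | exists x; rewrite mem_head]. Qed.

Lemma fixes_of_g (nu : autC) : {in Lev n.+1, forall x, g (nu x) = g x} -> fixes nu.
Proof.
move=> H a aL; have [x xa] := nonempty_fib a.
have /eqP <- : g x == a by rewrite -mem_fib.
by rewrite g_aut H // (fib_Lev aL).
Qed.

Lemma si_fixes : fixes si.
Proof.
apply: fixes_of_g => x xL; have gL : g x \in Lev n by rewrite -mem_LevS.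
rewrite siE //; case: ifP => // Zg; have [_ gA gB] := AB_Z gL Zg.
by rewrite /swap; case: eqP => // _; case: eqP.
Qed.

Let cl x y := `[< g x = g y /\ exists nu : autC, fixes nu /\ {in fib (g x), nu =1 swap x y} >].

Lemma swap_aut (nu : autC) a b x : nu (swap a b x) = swap (nu a) (nu b) (nu x).
Proof. by rewrite /swap !(inj_eq (fmorph_inj nu)); case: eqP => // _; case: eqP. Qed.

Lemma cyc3_aut (nu : autC) i j k x : nu (cyc3 i j k x) = cyc3 (nu i) (nu j) (nu k) (nu x).
Proof. by rewrite /cyc3 !(inj_eq (fmorph_inj nu)); case: eqP => // _; case: eqP => // _; case: eqP. Qed.

(** Conjugation shows that [cl] is a Galois-invariant equivalence relation on siblings, and [si]
    makes it nontrivial, so the absence of blocks makes it total. The action on the other fibers is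
    not controlled yet. *)
Lemma fiber_swaps x y : x \in Lev n.+1 -> g x = g y ->
  exists nu : autC, fixes nu /\ {in fib (g x), nu =1 swap x y}.
Proof.
move=> xL gxy; suff /asboolP[_ //] : cl x y.
apply: block xL gxy.
- move=> mu x' y'.
  have H (nu : autC) x1 y1 : cl x1 y1 -> cl (nu x1) (nu y1).
    case/asboolP => E [h [fh hE]]; apply/asboolP; split; first by rewrite -!g_aut E.
    exists (nu \o h \o autC_inv nu); split; first exact: fixes_conj.
    move=> z; rewrite -g_aut => zf; rewrite /= hE ?swap_aut ?autC_invKV //.
    by rewrite -(fib_aut nu) autC_invKV.
  apply/idP/idP; last exact: H.
  by move/(H (autC_inv mu)); rewrite !autC_invK.
- move=> x' xL'; apply/asboolP; split=> //; exists idfun; split=> // z _.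
  by rewrite swap_id.
- move=> x' y' xL' /asboolP[E [h [fh hE]]]; split=> //; apply/asboolP; split=> //.
  by exists h; split=> // z; rewrite -E => /hE ->; rewrite swapC.
- move=> x1 x2 x3 x1L /asboolP[E1 [h1 [fh1 hE1]]] /asboolP[E2 [h2 [fh2 hE2]]].
  apply/asboolP; split; first by rewrite E1.
  have gL : g x1 \in Lev n by rewrite -mem_LevS.
  have [E23|n23] := eqVneq x2 x3; first by exists h1; split=> // z zf; rewrite hE1 // E23.
  have [E13|n13] := eqVneq x1 x3.
    by exists idfun; split=> // z _; rewrite E13 swap_id.
  have f1 : x1 \in fib (g x1) by rewrite mem_fib.
  have f2 : x2 \in fib (g x1) by rewrite mem_fib E1.
  have f3 : x3 \in fib (g x1) by rewrite mem_fib E1 E2.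
  (* Conjugating the swap of x2 and x3 by the swap of x1 and x2 gives the swap of x1 and x3. *)
  exists (h1 \o h2 \o autC_inv h1); split; first by apply: fixes_conj.
  move=> z zf; have [w wE] : exists w, z = h1 w by exists (autC_inv h1 z); rewrite autC_invKV.
  have wf : w \in fib (g x1) by rewrite -(fixes_fib _ fh1 gL) -wE.
  rewrite wE /= autC_invK hE2 -?E1 // swap_aut !hE1 //.
  have [E12|n12] := eqVneq x1 x2.
    by rewrite E12 !swap_id.
  by rewrite swapR [swap x1 x2 x3]swapD // eq_sym.
have [z zL Zz] : exists2 z, z \in Lev n & Z z.
  by apply/hasP; rewrite has_count; case: (count Z _) Z_odd.
have [AB gA gB] := AB_Z zL Zz.
exists (A z), (B z); rewrite mem_LevS gA; split=> //; apply/asboolP; split; first by rewrite gB.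
exists si; split; first exact: si_fixes.
move=> w; rewrite mem_fib gA => /eqP gw.
by rewrite siE ?mem_LevS gw // Zz.
Qed.

Lemma fiber_2trans z a b i j : z \in Lev n -> a \in fib z -> b \in fib z -> i \in fib z ->
  j \in fib z -> a != b -> i != j -> exists nu : autC, [/\ fixes nu, nu a = i & nu b = j].
Proof.
move=> zL af bf xif jf ab ij.
have inL x : x \in fib z -> x \in Lev n.+1 by apply: fib_Lev.
have gE x : x \in fib z -> g x = z by rewrite mem_fib => /eqP.
have [|h1 [f1 h1E]] := @fiber_swaps a i (inL _ af); first by rewrite !gE.
rewrite gE // in h1E.
have b'f : h1 b \in fib z by rewrite fixes_fib.
have [|h2 [f2 h2E]] := @fiber_swaps (h1 b) j (inL _ b'f); first by rewrite !gE.
rewrite gE // in h2E.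
have h1a : h1 a = i by rewrite h1E // swapL.
exists (h2 \o h1); split; first exact: fixes_comp.
  rewrite /= h1a h2E // swapD //.
  by rewrite -h1a (inj_eq (fmorph_inj h1)).
by rewrite /= h2E // swapL.
Qed.

(** W bounds the other fibers on which the realizing automorphism may act; the aim is to reach an
    empty W. *)
Definition cyc3_supp (z0 : algC) (W : seq algC) := forall i j k, i \in fib z0 -> j \in fib z0 ->
  k \in fib z0 -> uniq [:: i; j; k] -> exists nu : autC, [/\ fixes nu,
    {in fib z0, nu =1 cyc3 i j k} &
    forall x, x \in Lev n.+1 -> g x != z0 -> g x \notin W -> nu x = x].

(** Conjugates of [si] by automorphisms fixing level n realize every swap on the fiber of z0 and
    still act only above Z; two of them compose to a 3-cycle. *)
Lemma cyc3_supp_base z0 : z0 \in Lev n -> Z z0 ->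
  cyc3_supp z0 [seq z <- Lev n | Z z & z != z0].
Proof.
move=> z0L Z0 i j k xif jf kf uijk; have [AB gA gB] := AB_Z z0L Z0.
have sw a b : a \in fib z0 -> b \in fib z0 -> a != b -> exists nu : autC, [/\ fixes nu,
    {in fib z0, nu =1 swap a b} & forall x, x \in Lev n.+1 -> ~~ Z (g x) -> nu x = x].
  move=> af bf ab.
  have [||h [fh hA hB]] := @fiber_2trans z0 (A z0) (B z0) a b z0L _ _ af bf AB ab.
  - by rewrite mem_fib gA.
  - by rewrite mem_fib gB.
  exists (h \o si \o autC_inv h); split; first exact/fixes_conj/si_fixes.
    move=> x xf; have xf' : autC_inv h x \in fib z0 by rewrite (fixes_fib _ (fixes_inv fh)).
    have gx : g (autC_inv h x) = z0 by apply/eqP; rewrite -mem_fib.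
    by rewrite /= siE ?(fib_Lev z0L) // gx Z0 swap_aut hA hB autC_invKV.
  move=> x xL nZ /=; have xL' : autC_inv h x \in Lev n.+1 by rewrite Lev_aut.
  rewrite siE // (fixes_g (fixes_inv fh) xL) (negbTE nZ).
  by rewrite autC_invKV.
have /and3P[] := uijk; rewrite !inE negb_or => /andP[ij ik] jk _.
have [h1 [f1 E1 S1]] := sw i j xif jf ij; have [h2 [f2 E2 S2]] := sw j k jf kf jk.
exists (h1 \o h2); split; first exact: fixes_comp.
  move=> x xf /=; rewrite E1; last by rewrite fixes_fib.
  by rewrite E2 // swap_swap_cyc3'.
move=> x xL gx; rewrite mem_filter gx andbT -mem_LevS xL andbT => nZ.
by rewrite /= S2 // S1.
Qed.

(* A commutator of two 3-cycles on the fiber of z0, one of which is conjugated by the swap of w with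
   an unused sibling, no longer acts above w. *)
Lemma cyc3_supp_shrink z0 w W : z0 \in Lev n -> w \in Lev n -> w != z0 ->
  (exists2 w', g w' = g w & (w' != z0) && (w' \notin w :: W)) -> w \notin W ->
  {subset W <= Lev n} -> (0 < n)%N -> cyc3_supp z0 (w :: W) -> cyc3_supp z0 W.
Proof.
move=> z0L wL wz [w' gw' /andP[w'z w'W]] wW WL n0 Hc i j k xif jf kf uijk.
have inL x : x \in fib z0 -> x \in Lev n.+1 by apply: fib_Lev.
have [l [m [lf mf u5]]] : exists l m, [/\ l \in fib z0, m \in fib z0 & uniq [:: i; j; k; l; m]].
  have uf := uniq_fib z0L.
  pose r := [seq x <- fib z0 | x \notin [:: i; j; k]].
  have ur : uniq r by apply: filter_uniq.
  have szr : (2 <= size r)%N.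
    have : (size (fib z0) <= size ([:: i; j; k] ++ r))%N.
      apply: uniq_leq_size => // x xf; rewrite mem_cat mem_filter xf andbT.
      by case: (x \in _).
    by rewrite size_cat size_fib /= => le; move: (leq_trans d_ge5 le).
  case E: r szr ur => [|l [|m r']] // _ ur; exists l, m.
  have rP x : x \in r -> x \in fib z0 /\ x \notin [:: i; j; k].
    by rewrite mem_filter => /andP[].
  have [lf lP] : l \in fib z0 /\ l \notin [:: i; j; k] by apply: rP; rewrite E mem_head.
  have [mf mP] : m \in fib z0 /\ m \notin [:: i; j; k] by apply: rP; rewrite E !inE eqxx orbT.
  split=> //; move: ur; rewrite -[[:: i; j; k; l; m]]/([:: i; j; k] ++ [:: l; m]) cat_uniq uijk.
  by rewrite /= (negbTE lP) (negbTE mP) /= !inE negb_or => /andP[/andP[-> _] _].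
have w'L : w' \in Lev n.
  by case: n wL gw' n0 => // n1 wL gw' _; rewrite mem_LevS gw' -mem_LevS.
(* [rho] fixes z0 and W, so conjugation by it turns the support w :: W into w' :: W. A commutator is
   trivial on every fiber where one of its two entries is, hence above w and above w'. *)
have [rho rhoE] : realized n (swap w w').
  by case: (n) n0 IHswaps wL w'L => // n1 _ IH wL w'L; apply: IH.
have rz : rho z0 = z0 by rewrite rhoE // swapD // eq_sym.
have rf x : (autC_inv rho x \in fib z0) = (x \in fib z0).
  by rewrite -(fib_aut rho) rz autC_invKV.
pose ri := autC_inv rho.
have u3 : uniq [:: i; j; l] /\ uniq [:: i; k; m].
  move: u5; rewrite /= !inE !negb_or.
  by case/and5P => /and4P[-> -> -> ->] /and3P[_ -> _] /andP[_ ->] _ _.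
have [u [fu uE uS]] := Hc i j l xif jf lf u3.1.
have [||||v [fv vE vS]] := Hc (ri i) (ri k) (ri m); rewrite ?rf //.
  by rewrite -(map_inj_uniq (fmorph_inj rho)) /= !autC_invKV; exact: u3.2.
pose v2 : autC := rho \o v \o autC_inv rho.
have fv2 : fixes v2 by exact: fixes_conj.
have v2E : {in fib z0, v2 =1 cyc3 i k m}.
  move=> x xf; rewrite /v2 /= vE ?rf // cyc3_aut /ri !autC_invKV //.
have inv3 (nu : autC) a b c : fixes nu -> uniq [:: a; b; c] -> a \in fib z0 -> b \in fib z0 -> c \in fib z0 ->
    {in fib z0, nu =1 cyc3 a b c} -> {in fib z0, autC_inv nu =1 cyc3 c b a}.
  move=> fn un af bf cf nE x xf; apply: autC_invE.
  have yf : cyc3 c b a x \in fib z0 by rewrite /cyc3; do 3!(case: eqP => // _).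
  by rewrite nE // cyc3K.
exists (u \o v2 \o autC_inv u \o autC_inv v2); split.
- apply: fixes_comp (fixes_inv fv2); apply: fixes_comp (fixes_inv fu); exact: fixes_comp.
- move=> x xf; change (u (v2 (autC_inv u (autC_inv v2 x))) = cyc3 i j k x).
  have x1f : autC_inv v2 x \in fib z0 by rewrite (fixes_fib _ (fixes_inv fv2)).
  have x2f : autC_inv u (autC_inv v2 x) \in fib z0 by rewrite (fixes_fib _ (fixes_inv fu)).
  have x3f : v2 (autC_inv u (autC_inv v2 x)) \in fib z0 by rewrite fixes_fib.
  rewrite uE // v2E // (inv3 u i j l) //; last exact: u3.1.
  rewrite (inv3 v2 i k m) //; last exact: u3.2.
  exact: cyc3_comm.
move=> x xL gxz gxW.
have gL : g x \in Lev n by rewrite -mem_LevS.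
have v2S y : y \in Lev n.+1 -> g y != z0 -> g y \notin w' :: W -> v2 y = y.
  move=> yL gyz gyW; rewrite /v2 /= vS ?autC_invKV ?Lev_aut //.
    by apply: contra gyz => /eqP E; rewrite -rz -E -g_aut autC_invKV.
  have gyL : g y \in Lev n by rewrite -mem_LevS.
  apply: contra gyW; rewrite -g_aut => H.
  have : g y \in map rho (w :: W) by apply/mapP; eexists; [exact: H | rewrite autC_invKV].
  case/mapP => t; rewrite inE => /orP[/eqP -> ->|tW ->].
    by rewrite rhoE // swapL mem_head.
  have tnW : t != w by apply: contraNneq wW => <-.
  have tnW' : t != w' by apply: contraNneq w'W => <-; rewrite inE tW orbT.
  by rewrite rhoE ?WL // swapD // inE tW orbT.
have S1 : g x \notin w :: W \/ g x \notin w' :: W.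
  have [E|ne] := eqVneq (g x) w; last by left; rewrite inE negb_or ne.
  right; rewrite inE negb_or gxW andbT E; apply: contra w'W => /eqP ->.
  by rewrite mem_head.
case: S1 => S1.
  have ux : u x = x by apply: uS.
  have y2L : autC_inv v2 x \in Lev n.+1 by rewrite Lev_aut.
  have gy : g (autC_inv v2 x) = g x by apply: fixes_g => //; exact: fixes_inv.
  have uy : autC_inv u (autC_inv v2 x) = autC_inv v2 x by apply/autC_invE/uS; rewrite ?gy.
  change (u (v2 (autC_inv u (autC_inv v2 x))) = x).
  by rewrite uy (autC_invKV v2).
have vx : v2 x = x by apply: v2S.
have vix : autC_inv v2 x = x by apply: autC_invE.
have y2L : autC_inv u x \in Lev n.+1 by rewrite Lev_aut.
have gy : g (autC_inv u x) = g x by apply: fixes_g => //; exact: fixes_inv.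
change (u (v2 (autC_inv u (autC_inv v2 x))) = x).
by rewrite vix v2S ?gy // autC_invKV.
Qed.

(** The fibers over the rest of Z are removed one at a time, each w having a sibling outside Z to be
    exchanged with; transitivity on level n then carries the 3-cycle from z0 to any z. *)
Lemma single_cyc3 z i j k : z \in Lev n -> i \in fib z -> j \in fib z -> k \in fib z ->
  uniq [:: i; j; k] -> realized n.+1 (cyc3 i j k).
Proof.
move=> zL xif jf kf u3.
have [z0 z0L Z0] : exists2 z, z \in Lev n & Z z.
  by apply/hasP; rewrite has_count; case: (count Z _) Z_odd.
have shrink W : uniq W -> (forall w, w \in W -> [/\ w \in Lev n, Z w & w != z0]) ->
    cyc3_supp z0 W -> cyc3_supp z0 [::].
  elim: W => // w W IH /= /andP[wW uW] WP cW.
  have [wL Zw wz] := WP w (mem_head _ _).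
  have WP' w1 : w1 \in W -> [/\ w1 \in Lev n, Z w1 & w1 != z0].
    by move=> w1W; apply: WP; rewrite inE w1W orbT.
  apply: IH => //; apply: cyc3_supp_shrink cW => //.
  - have [w' gw' nZ] := Z_fam wL; exists w' => //.
    apply/andP; split; first by apply: contraNneq nZ => ->.
    by apply: contra nZ => /WP[].
  - by move=> w1 /WP'[].
  (* Level 0 has a single vertex, so two distinct vertices force n to be positive. *)
  case: (n) wL z0L => // ; rewrite !inE => /eqP w0 /eqP z00.
  by move: wz; rewrite w0 z00 eqxx.
have E0 : cyc3_supp z0 [::].
  apply: shrink (cyc3_supp_base z0L Z0); first by rewrite filter_uniq.
  by move=> w; rewrite mem_filter => /andP[/andP[]].
have [mu muz] := trans_Lev z0L zL.
have inv x : (autC_inv mu x \in fib z0) = (x \in fib z) by rewrite -(fib_aut mu) autC_invKV muz.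
have [||||nu [fnu nuE nuS]] := E0 (autC_inv mu i) (autC_inv mu j) (autC_inv mu k); rewrite ?inv //.
  by rewrite -(map_inj_uniq (fmorph_inj mu)) /= !autC_invKV.
exists (mu \o nu \o autC_inv mu) => x xL /=.
have [xf|xf] := boolP (x \in fib z).
  by rewrite nuE ?inv // cyc3_aut !autC_invKV.
rewrite nuS ?autC_invKV ?Lev_aut //; last by rewrite -mem_fib inv.
have nx y : y \in fib z -> (x == y) = false by move=> yf; apply: contraNF xf => /eqP ->.
by rewrite /cyc3 !nx.
Qed.

Lemma realized_ext m t t' : {in Lev m, t =1 t'} -> realized m t -> realized m t'.
Proof. by move=> E [nu nuE]; exists nu => x xL; rewrite nuE // E. Qed.

Lemma realized_comp m t1 t2 : realized m t1 -> realized m t2 -> realized m (t1 \o t2).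
Proof.
move=> [n1 E1] [n2 E2]; exists (n1 \o n2) => x xL /=; rewrite E2 // E1 // -E2 //.
by rewrite Lev_aut.
Qed.

Lemma realized_id m : realized m id. Proof. by exists idfun. Qed.

Lemma double_swap z a b a' b' : z \in Lev n -> a \in fib z -> b \in fib z ->
  a' \in fib z -> b' \in fib z -> a != b -> a' != b' ->
  realized n.+1 (swap a' b' \o swap a b).
Proof.
move=> zL af bf.
have st b1 c1 a1 : a1 \in fib z -> b1 \in fib z -> c1 \in fib z -> a1 != b1 -> a1 != c1 ->
    realized n.+1 (swap a1 c1 \o swap a1 b1).
  move=> a1f b1f c1f ab ac; have [->|bc] := eqVneq b1 c1.
    by apply: realized_ext (realized_id _) => x _ /=; rewrite swapK.
  have u : uniq [:: a1; b1; c1] by rewrite /= !inE !negb_or ab ac bc.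
  by apply: realized_ext (single_cyc3 zL a1f b1f c1f u) => x _ /=; rewrite swap_swap_cyc3.
move=> a'f b'f ab ab'; have [E|nab] := eqVneq a b'.
  have := st b a' a af bf a'f ab; rewrite eq_sym E => /(_ ab').
  by apply: realized_ext => x _ /=; rewrite swapC.
have H1 := st b b' a af bf b'f ab nab.
have H2 : realized n.+1 (swap b' a' \o swap b' a) by apply: st; rewrite // eq_sym.
apply: realized_ext (realized_comp H2 H1) => x _ /=.
by rewrite [swap b' a _]swapC swapK swapC.
Qed.

Definition pairs_on (S : pred algC) (A1 B1 : algC -> algC) :=
  forall z, z \in Lev n -> S z -> [/\ A1 z != B1 z, g (A1 z) = z & g (B1 z) = z].

Definition flip (S : pred algC) (A1 B1 : algC -> algC) x :=
  if S (g x) then swap (A1 (g x)) (B1 (g x)) x else x.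

Lemma flip_g S A1 B1 x : pairs_on S A1 B1 -> x \in Lev n.+1 -> g (flip S A1 B1 x) = g x.
Proof.
move=> pr; rewrite mem_LevS /flip => gL; case: ifP => // Sg.
have [_ gA gB] := pr _ gL Sg.
by rewrite /swap; case: eqP => // _; case: eqP.
Qed.

(** Modulo the alternating groups of the fibers only the set S matters, not the pair chosen in each
    fiber; the pairs are exchanged one fiber at a time by [double_swap]. *)
Lemma flip_change S A1 B1 A2 B2 : pairs_on S A1 B1 -> pairs_on S A2 B2 ->
  realized n.+1 (flip S A1 B1) -> realized n.+1 (flip S A2 B2).
Proof.
move=> p1 p2 r1.
suff H (l : seq algC) : {subset l <= Lev n} -> realized n.+1 (flip S (fun z => if z \in l then A2 z else A1 z)
    (fun z => if z \in l then B2 z else B1 z)).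
  apply: realized_ext (H (Lev n) _) => // x; rewrite mem_LevS /flip => gL.
  by rewrite gL.
elim: l => [|z l IH] sub; first by apply: realized_ext r1 => x _; rewrite /flip.
have subl : {subset l <= Lev n} by move=> y yl; apply: sub; rewrite inE yl orbT.
have {}IH := IH subl.
set A3 := fun z => _ in IH; set B3 := fun z => _ in IH.
have zL := sub z (mem_head _ _).
have p3 : pairs_on S A3 B3 by move=> y yL Sy; rewrite /A3 /B3; case: ifP => _; [exact: p2 | exact: p1].
have [Sz|nS] := boolP (S z); last first.
  apply: realized_ext IH => x xL; rewrite /flip /A3 /B3 inE.
  by have [->|] := eqVneq (g x) z; rewrite ?(negbTE nS).
have [zl|zl] := boolP (z \in l).
  apply: realized_ext IH => x xL; rewrite /flip /A3 /B3 inE.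
  by have [->|] := eqVneq (g x) z; rewrite ?zl.
have [AB1 gA1 gB1] := p1 z zL Sz; have [AB2 gA2 gB2] := p2 z zL Sz.
have := @double_swap z (A1 z) (B1 z) (A2 z) (B2 z) zL; rewrite !mem_fib gA1 gB1 gA2 gB2 eqxx.
move=> /(_ isT isT isT isT AB1 AB2) r2.
apply: realized_ext (realized_comp r2 IH) => x xL /=.
have gL : g x \in Lev n by rewrite -mem_LevS.
rewrite {2}/flip inE; have [gx|gx] := eqVneq (g x) z.
  by rewrite /flip gx Sz /A3 /B3 (negbTE zl) swapK.
rewrite -/(A3 _) -/(B3 _) -/(flip S A3 B3 x).
have gy := flip_g p3 xL; set y := flip S A3 B3 x in gy *.
have ny a : g a = z -> (y == a) = false.
  by move=> ga; apply: contraNF gx => /eqP E; rewrite -gy E ga.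
by rewrite [swap _ _ y]swapD ?ny // swapD ?ny.
Qed.

Let A0 z := nth 0 (fib z) 0.
Let B0 z := nth 0 (fib z) 1.
Let p0 S : pairs_on S A0 B0.
Proof.
move=> z zL _; have := size_fib z; have := uniq_fib zL.
have := mem_fib z; rewrite /A0 /B0; case: (fib z) => [|a [|b l]] mf /= u sz.
- by move: d_ge5; rewrite -sz.
- by move: d_ge5; rewrite -sz.
split; first by move: u => /andP[]; rewrite inE negb_or => /andP[].
  by apply/eqP; rewrite -mf mem_head.
by apply/eqP; rewrite -mf !inE eqxx orbT.
Qed.

(** Subsets of level n regarded as vectors over F_2: the flippable ones form a Galois submodule
    ([flippable_add], [flippable_aut]), and the goal is to show that it contains the singletons. *)
Definition flippable S := realized n.+1 (flip S A0 B0).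

Lemma flippable_ext S S' : {in Lev n, S =1 S'} -> flippable S -> flippable S'.
Proof. by move=> E; apply: realized_ext => x; rewrite mem_LevS /flip => /E ->. Qed.

Lemma flippable_add S S' : flippable S -> flippable S' -> flippable (fun z => S z (+) S' z).
Proof.
move=> r r'; apply: realized_ext (realized_comp r r') => x xL /=.
have gy := flip_g (@p0 S') xL; rewrite {1}/flip gy /flip.
by case: (S _); case: (S' _); rewrite //= swapK.
Qed.

Lemma flippable_aut (nu : autC) S : flippable S -> flippable (S \o autC_inv nu).
Proof.
move=> [mu muE].
apply: (@flip_change _ (nu \o A0 \o autC_inv nu) (nu \o B0 \o autC_inv nu)) => //.
  move=> z zL /= Sz; have [|//|AB gA gB] := @p0 S (autC_inv nu z); first by rewrite Lev_aut.
  by rewrite (inj_eq (fmorph_inj nu)) -!g_aut gA gB autC_invKV.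
exists (nu \o mu \o autC_inv nu) => x xL /=.
rewrite muE ?Lev_aut // /flip /= autC_invg; case: ifP => _; last by rewrite autC_invKV.
by rewrite swap_aut autC_invKV.
Qed.

Definition par m (S : pred algC) c := odd (count S [seq x <- Lev n | iter (n - m) g x == c]).

Lemma odd_sum (I : Type) (r : seq I) (F : I -> nat) :
  odd (\sum_(i <- r) F i) = odd (count (fun i => odd (F i)) r).
Proof. by elim: r => [|i r IH]; rewrite ?big_nil // big_cons /= !oddD IH; case: odd. Qed.

Lemma parS m S c : (m < n)%N -> c \in Lev m -> par m S c = odd (count (par m.+1 S) (fib c)).
Proof.
move=> ltm cL; rewrite /par -odd_sum; congr odd.
pose f x := iter (n - m.+1) g x.
have fE x : iter (n - m) g x = g (f x) by rewrite -(subnSK ltm) iterS.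
rewrite count_filter -sum1_count big_mkcond /=.
rewrite [RHS](eq_bigr (fun y => \sum_(x <- Lev n) nat_of_bool (S x && (f x == y)))%N); last first.
  by move=> y _; rewrite count_filter -sum1_count big_mkcond.
rewrite exchange_big /=; apply: eq_bigr => x _; rewrite fE -mem_fib.
case: (S x) => /=; last by rewrite big1.
have -> : (\sum_(y <- fib c) nat_of_bool (f x == y))%N = count_mem (f x) (fib c).
  by elim: (fib c) => [|y l IH]; rewrite ?big_nil // big_cons IH /= eq_sym.
by rewrite count_uniq_mem ?(uniq_fib cL).
Qed.

Lemma par_add m S S' c : par m (fun z => S z (+) S' z) c = par m S c (+) par m S' c.
Proof.
rewrite /par; elim: [seq _ <- _ | _] => //= x l IH; rewrite !oddD !oddb IH.
by case: (S x); case: (S' x); case: (odd _); case: (odd _).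
Qed.

Lemma par_aut m (nu : autC) S c : (m <= n)%N -> par m (S \o autC_inv nu) c = par m S (autC_inv nu c).
Proof.
move=> lem; rewrite /par.
have pm : perm_eq (map nu (Lev n)) (Lev n) by apply: autC_perm => // x; rewrite Lev_aut.
have pm' : perm_eq [seq x <- map nu (Lev n) | iter (n - m) g x == c]
    [seq x <- Lev n | iter (n - m) g x == c] by apply: perm_filter.
rewrite -(permP pm') filter_map count_map; congr odd.
rewrite (@eq_filter _ _ (fun x => iter (n - m) g x == autC_inv nu c)); last first.
  move=> x /=; rewrite -iter_aut; apply/eqP/eqP => [<-|->]; by rewrite ?autC_invK ?autC_invKV.
by apply: eq_count => x /=; rewrite autC_invK.
Qed.

(** Induction down the tree: Z has odd size, which is the case m = 0. When the odd parities are
    confined to what lies over c in level m, an odd number of children of c are odd; as d is even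
    some child is even, and swapping an odd child with an even one isolates a pair. Pairs then
    correct any parity pattern with the right sums over sibling sets. *)
Lemma par_flip m c : (m <= n)%N -> c \in Lev m ->
  exists S, flippable S /\ {in Lev m, forall x, par m S x = (x == c)}.
Proof.
elim: m c => [|m IH] a lem aL.
  exists Z; split.
    apply: (@flip_change _ A B) => //.
    by exists si => x xL; rewrite siE.
  move=> x xL; move: aL xL; rewrite !inE => /eqP -> /eqP ->; rewrite eqxx /par.
  rewrite (@eq_in_filter _ _ predT) ?filter_predT // => y yL /=.
  by rewrite subn0 -mem_Lev yL.
have cL : g a \in Lev m by rewrite -mem_LevS.
have [S [FS parE]] := IH (g a) (ltnW lem) cL.
have swm : all_swaps m.+1 by apply: IHswaps.
have pair x y : x \in Lev m.+1 -> y \in Lev m.+1 -> g x = g y -> x != y ->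
  exists S', flippable S' /\ {in Lev m.+1, forall w, par m.+1 S' w = (w == x) (+) (w == y)}.
  have oddc : odd (count (par m.+1 S) (fib (g a))) by rewrite -parS // parE ?eqxx.
  have [x1 x1f P1] : exists2 x1, x1 \in fib (g a) & par m.+1 S x1.
    by apply/hasP; rewrite has_count; case: count oddc.
  have [y1 y1f P2] : exists2 y1, y1 \in fib (g a) & ~~ par m.+1 S y1.
    apply/allPn; apply: contraL oddc; rewrite all_count size_fib => /eqP ->.
    exact: d_even.
  have x1L := fib_Lev cL x1f; have y1L := fib_Lev cL y1f.
  have gx1 : g x1 = g a by apply/eqP; rewrite -mem_fib.
  have gy1 : g y1 = g a by apply/eqP; rewrite -mem_fib.
  have n1 : x1 != y1 by apply: contraNneq P2 => <-.
  move=> xL yL gxy nxy.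
  have [|rho rhoE] := swm x1 y1 x1L y1L; first by rewrite gx1 gy1.
  have S2 : exists S2, flippable S2 /\
      {in Lev m.+1, forall w, par m.+1 S2 w = (w == x1) (+) (w == y1)}.
    (* [rho] exchanges an odd vertex with an even sibling, so adding the conjugate cancels all
       parities except at these two. *)
    exists (fun z => S z (+) (S \o autC_inv rho) z); split.
      by apply: flippable_add => //; exact: flippable_aut.
    move=> w wL; rewrite par_add par_aut //.
    have -> : autC_inv rho w = swap x1 y1 w.
      apply: autC_invE; rewrite rhoE ?swapK //.
      by rewrite /swap; case: eqP => // _; case: eqP.
    have [->|wx] := eqVneq w x1; first by rewrite swapL P1 (negbTE P2) (negbTE n1).
    have [->|wy] := eqVneq w y1; first by rewrite swapR P1 (negbTE P2).
    by rewrite swapD // addbb.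
  have [S2' [FS2 S2E]] := S2.
  have [mu1 mu1x] := trans_Lev x1L xL.
  have my : mu1 y1 \in Lev m.+1 by rewrite Lev_aut.
  have gmy : g (mu1 y1) = g y by rewrite -gxy -mu1x -!g_aut gx1 gy1.
  have [rho2 rho2E] := swm (mu1 y1) y my yL gmy.
  pose mu : autC := rho2 \o mu1.
  have mux : mu x1 = x.
    rewrite /mu /= mu1x rho2E // swapD //.
    by rewrite -mu1x (inj_eq (fmorph_inj mu1)).
  have muy : mu y1 = y by rewrite /mu /= rho2E // swapL.
  exists (S2' \o autC_inv mu); split; first exact: flippable_aut.
  move=> w wL; rewrite par_aut // S2E ?Lev_aut //.
  by congr (_ (+) _); rewrite -(inj_eq (fmorph_inj mu)) autC_invKV ?mux ?muy.
have famc P P' : count (fun x => P x (+) P' x) (Lev m.+1) = 0%N ->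
    {in Lev m.+1, P =1 P'}.
  move=> /eqP; rewrite -leqn0 leqNgt -has_count => /hasPn H x xL.
  by have := H x xL; case: (P x); case: (P' x).
(* Each step adds a pair inside a sibling set where the parities disagree with P'; disagreements in
   a sibling set are even in number, so a second one is always available. *)
have main N : forall S1 (P' : pred algC), flippable S1 ->
   (count (fun x => par m.+1 S1 x (+) P' x) (Lev m.+1) < N)%N ->
   (forall c, c \in Lev m -> odd (count (par m.+1 S1) (fib c)) = odd (count P' (fib c))) ->
   exists S', flippable S' /\ {in Lev m.+1, par m.+1 S' =1 P'}.
  elim: N => // N IHN S1 P' F1 ltN fam.
  have [/eqP c0|cn0] := boolP (count (fun x => par m.+1 S1 x (+) P' x) (Lev m.+1) == 0%N).
    by exists S1; split=> //; exact: famc.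
  have [x xL xd] : exists2 x, x \in Lev m.+1 & par m.+1 S1 x (+) P' x.
    by apply/hasP; rewrite has_count lt0n.
  have gxL : g x \in Lev m by rewrite -mem_LevS.
  have odd0 : odd (count (fun w => par m.+1 S1 w (+) P' w) (fib (g x))) = false.
    rewrite -[RHS](addbb (odd (count P' (fib (g x))))) -{1}fam //.
    elim: (fib (g x)) => //= w l IHl; rewrite !oddD !oddb IHl.
    by case: (par _ _ w); case: (P' w); case: (odd _); case: (odd _).
  have xf : x \in fib (g x) by rewrite mem_fib.
  have [y yf /andP[yd yx]] : exists2 y, y \in fib (g x) & (par m.+1 S1 y (+) P' y) && (y != x).
    apply/hasP; apply: contraFT odd0 => /hasPn H.
    have -> : count (fun w => par m.+1 S1 w (+) P' w) (fib (g x)) = count_mem x (fib (g x)).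
      apply: eq_in_count => w wf; rewrite /=; have [->|wx] := eqVneq w x; first exact: xd.
      by have := H w wf; rewrite wx andbT => /negbTE.
    by rewrite count_uniq_mem ?(uniq_fib gxL) // xf.
  have yL := fib_Lev gxL yf.
  have gyx : g x = g y by apply/esym/eqP; rewrite -mem_fib.
  have nxy : x != y by rewrite eq_sym.
  have [S' [F' E']] := pair x y xL yL gyx nxy.
  have E2 w : w \in Lev m.+1 -> par m.+1 (fun z => S1 z (+) S' z) w = par m.+1 S1 w (+) ((w == x) (+) (w == y)).
    by move=> wL; rewrite par_add E'.
  apply: (IHN (fun z => S1 z (+) S' z)) => //; first exact: flippable_add.
    rewrite -ltnS; apply: leq_trans ltN; rewrite ltnS -!size_filter.
    set l1 := [seq _ <- _ | _]; set l2 := [seq _ <- _ | _].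
    have xl2 : x \in l2 by rewrite mem_filter xd.
    have szl := size_rem xl2; have pos : (0 < size l2)%N by case: (l2) xl2.
    rewrite -(prednK pos) ltnS -szl; apply: uniq_leq_size; first exact: filter_uniq.
    move=> w; rewrite mem_rem_uniq ?filter_uniq // inE !mem_filter => /andP[wd wL].
    move: wd; rewrite wL andbT E2 //.
    have [->|wx] := eqVneq w x; first by move: xd; rewrite (negbTE nxy); case: (par _ _ _); case: (P' x).
    have [->|wy] /= := eqVneq w y; first by rewrite yd.
    by rewrite addbF.
  move=> c cL'; rewrite -fam // .
  have -> : count (par m.+1 (fun z => S1 z (+) S' z)) (fib c) =
     count (fun w => par m.+1 S1 w (+) ((w == x) (+) (w == y))) (fib c).
    by apply: eq_in_count => w wf; rewrite E2 ?(fib_Lev cL').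
  have : odd (count (fun w => (w == x) (+) (w == y)) (fib c)) = false.
    have -> : odd (count (fun w => (w == x) (+) (w == y)) (fib c)) =
       odd (count_mem x (fib c)) (+) odd (count_mem y (fib c)).
      elim: (fib c) => //= w l IHl; rewrite !oddD !oddb IHl.
      by case: (w == x); case: (w == y); case: (odd _); case: (odd _).
    by rewrite !count_uniq_mem ?(uniq_fib cL') // !mem_fib gyx addbb.
  move=> H; rewrite -[RHS]addbF -[X in _ = _ (+) X]H.
  elim: (fib c) => //= w l IHl; rewrite !oddD !oddb IHl.
  by case: (par _ _ w); case: (w == x); case: (w == y); case: (odd _); case: (odd _).
apply: (main _ S (fun x => x == a) FS (ltnSn _)) => c1 c1L.
rewrite -parS // parE // count_uniq_mem ?(uniq_fib c1L) // mem_fib eq_sym.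
by case: eqP.
Qed.

Lemma level_all_swaps : all_swaps n.+1.
Proof.
move=> a b aL bL gab; have [->|ab] := eqVneq a b.
  by apply: realized_ext (realized_id _) => x _; rewrite swap_id.
have zL : g a \in Lev n by rewrite -mem_LevS.
(* At m = n the parity of S above x is membership of x, so S is the singleton of the parent of a and
   b. *)
have [S [FS SE]] := par_flip (leqnn n) zL.
have SE' : {in Lev n, S =1 pred1 (g a)}.
  move=> x xL; rewrite /= -SE // /par subnn.
  have -> : [seq y <- Lev n | iter 0 g y == x] = [:: x].
    have := filter_pred1_uniq (uniq_Lev n) xL; by [].
  by rewrite /= addn0; case: (S x).
have F1 := flippable_ext SE' FS.
have p1 : pairs_on (pred1 (g a)) (fun=> a) (fun=> b).
  by move=> z zL' /eqP ->; rewrite -gab.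
have := flip_change (@p0 _) p1 F1; apply: realized_ext => x xL; rewrite /flip /=.
case: eqP => // gx; rewrite swapD //.
  by apply: contra_not_neq gx => ->.
by apply: contra_not_neq gx => ->.
Qed.

End Level.
End TreeGroup.

(** * The inertia element at a good prime *)

Local Notation hE := (hornerD, hornerN, hornerM, hornerZ, hornerX, hornerC, hornerXn, horner_exp).

(** The Vandermonde product, a square root of the discriminant up to sign; it changes sign under odd
    permutations of the list. *)
Fixpoint vd (s : seq algC) : algC :=
  if s is x :: s' then (\prod_(y <- s') (x - y)) * vd s' else 1.

Definition diffs (s : seq algC) : algC := \prod_(x <- s) \prod_(y <- s | y != x) (x - y).

Lemma vd_sqr s : uniq s -> vd s ^+ 2 = (-1) ^+ (\sum_(i < size s) i) * diffs s.
Proof.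
elim: s => [|x s IH] /=; first by rewrite /diffs big_nil big_ord0 expr1n mulr1.
case/andP => xs us; rewrite exprMn {}IH // big_ord_recr /= exprD mulrCA -!mulrA; congr (_ * _).
have -> : diffs (x :: s) = (\prod_(y <- s) (x - y)) * (\prod_(y <- s) (y - x)) * diffs s.
  rewrite {1}/diffs big_cons big_cons eqxx /= -mulrA; congr (_ * _).
    rewrite big_seq_cond [RHS]big_seq_cond; apply: eq_bigl => y.
    by case ys: (y \in s) => //=; apply: contraNneq xs => <-.
  rewrite /diffs -big_split /= !big_seq; apply: eq_bigr => y ys.
  by rewrite big_cons ifT //; apply: contraNneq xs => ->.
have -> : \prod_(y <- s) (y - x) = (-1) ^+ size s * \prod_(y <- s) (x - y).
  rewrite (eq_bigr (fun y => -1 * (x - y))) => [|y _]; last by rewrite mulN1r opprB.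
  rewrite big_split /=; congr (_ * _).
  by elim: (s) => [|y l IHl]; rewrite ?big_nil // big_cons IHl -exprS.
set e := (-1) ^+ _; set P := \prod_(_ <- _) _.
have ee : e * e = 1 by rewrite /e -exprD addnn -mul2n exprM sqrrN !expr1n.
have -> : e * (P * (e * P) * diffs s) = (e * e) * (P * P * diffs s) by ring.
by rewrite ee mul1r mulrA.
Qed.

Lemma vd_neq0 s : uniq s -> vd s != 0.
Proof.
elim: s => [|x s IH] /=; first by rewrite oner_neq0.
case/andP => xs us; rewrite mulf_neq0 ?IH // prodf_seq_neq0; apply/allP => y ys.
by rewrite subr_eq0; apply: contraNneq xs => ->.
Qed.

Lemma vd_perm s s' : uniq s -> perm_eq s s' -> vd s = vd s' \/ vd s = - vd s'.
Proof.
move=> us ss'; have us' : uniq s' by rewrite -(perm_uniq ss').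
have : vd s ^+ 2 = vd s' ^+ 2.
  rewrite !vd_sqr // (perm_size ss') /diffs; congr (_ * _).
  by rewrite (perm_big _ ss'); apply: eq_bigr => x _; apply: perm_big.
by move/eqP; rewrite eqf_sqr => /orP[]/eqP; [left|right].
Qed.

Lemma vd_map (nu : autC) s : nu (vd s) = vd (map nu s).
Proof.
elim: s => [|x s IH] /=; first by rewrite rmorph1.
rewrite rmorphM IH rmorph_prod big_map; congr (_ * _).
by apply: eq_bigr => y _; rewrite rmorphB.
Qed.

Lemma vd_swap (nu : autC) s a b : uniq s -> a \in s -> b \in s -> a != b ->
  {in s, nu =1 swap a b} -> nu (vd s) = - vd s.
Proof.
move=> us sa sb ab nuE.
pose t := [seq x <- s | (x != a) && (x != b)].
have pt : perm_eq s [:: a, b & t].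
  apply: uniq_perm => //; first by rewrite /= !inE !mem_filter !eqxx (negbTE ab) /= andbF filter_uniq.
  move=> x; rewrite !inE mem_filter.
  by case: (x =P a) => [->|_] //=; case: (x =P b) => [->|_].
have tE : map nu t = t.
  rewrite -[RHS]map_id; apply/eq_in_map => x; rewrite mem_filter => /andP[/andP[xa xb] xs].
  by rewrite nuE // swapD.
have vt : nu (vd [:: a, b & t]) = - vd [:: a, b & t].
  rewrite vd_map /= tE !nuE // swapL swapR !big_cons -!mulrA -mulNr opprB; congr (_ * _).
  by rewrite mulrCA.
by case: (vd_perm us pt) => ->; rewrite ?rmorphN vt.
Qed.

Lemma iter_order (nu : autC) (L : seq algC) : (forall x, x \in L -> nu x \in L) ->
  exists2 N, (0 < N)%N & forall x, x \in L -> iter N nu x = x.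
Proof.
move=> nuL.
have itL x i : x \in L -> iter i nu x \in L by move=> xL; elim: i => //= i; apply: nuL.
have inj i : injective (iter i nu) by elim: i => // i IH x y /= /fmorph_inj/IH.
have one x : x \in L -> exists2 N, (0 < N)%N & iter N nu x = x.
  move=> xL; pose s := mkseq (fun i => iter i nu x) (size L).+1.
  have nus : ~~ uniq s.
    apply/negP => us; have := @uniq_leq_size _ s L us.
    rewrite size_mkseq ltnn; move=> H; suff : false by []; apply: H => y /mapP[i _ ->].
    exact: itL.
  have /(uniqPn 0)[i [j [ltij]]] := nus; rewrite size_mkseq => ltj.
  rewrite !nth_mkseq //; last exact: ltn_trans ltij ltj.
  rewrite -(subnKC (ltnW ltij)) iterD => /inj E.
  by exists (j - i)%N; rewrite ?subn_gt0.
elim: (L) one => [|x l IH] one; first by exists 1%N.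
have [|N N0 NE] := IH; first by move=> y yl; apply: one; rewrite inE yl orbT.
have [N' N'0 N'E] := one x (mem_head _ _).
have itM m k y : iter m nu y = y -> iter (k * m) nu y = y.
  by move=> E; elim: k => // k IHk; rewrite mulSn iterD IHk.
exists (N * N')%N => [|y]; first by rewrite muln_gt0 N0.
rewrite inE => /orP[/eqP ->|yl]; first exact: itM.
by rewrite mulnC; apply/itM/NE.
Qed.

Lemma autC_iter (nu : autC) m : exists mu : autC, forall x, mu x = iter m nu x.
Proof.
elim: m => [|m [mu muE]]; first by exists idfun.
by exists (nu \o mu) => x /=; rewrite muE.
Qed.

Lemma coef_comp_XaddC (P : {poly algC}) (x : algC) i : (P \Po ('X + x%:P))`_i = P^`N(i).[x].
Proof.
elim/poly_ind: P i => [|P c IH] i; first by rewrite comp_poly0 coef0 linear0 horner0.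
rewrite comp_polyD comp_polyM comp_polyX comp_polyC mulrDr !coefD coefMX coefMC coefC !IH.
case: i => [|i] /=; first by rewrite !nderivn0 !hE add0r.
by rewrite nderivnMXaddC !hE ?addr0.
Qed.

Section Local.

Variables (q : nat) (V : place q).
Hypothesis q_pr : prime q.
Local Notation O := (vring V).
Local Notation M := (vmax V).
Local Notation U := (vunit V).

Lemma vring_nderivn (P : {poly algC}) m x : (forall i, O P`_i) -> O x -> O P^`N(m).[x].
Proof. by move=> OP Ox; apply: vring_horner => // i; rewrite coef_nderivn vringMn. Qed.

Lemma taylor_vring (P : {poly algC}) x m : (forall i, O P`_i) -> O x ->
  exists W : {poly algC}, [/\ forall i, O W`_i, W`_0 = P^`N(m).[x] &
    forall s, P.[x + s] = \sum_(i < m) P^`N(i).[x] * s ^+ i + s ^+ m * W.[s]].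
Proof.
move=> OP Ox; exists (\poly_(i < (size P).+1) P^`N(m + i).[x]); split.
- by move=> i; rewrite coef_poly; case: ifP => // _; [exact: vring_nderivn | exact: vring0].
- by rewrite coef_poly addn0.
move=> s; rewrite (@nderiv_taylor_wide _ (m + (size P).+1)); first last.
- by rewrite addnS ltnW // ltnS leq_addl.
- exact: mulrC.
rewrite big_split_ord /=; congr (_ + _); rewrite horner_poly big_distrr /=.
by apply: eq_bigr => i _; rewrite exprD mulrCA.
Qed.

(* The i-th Taylor coefficient of a polynomial is not a unit if more than i of its roots are
   congruent to the center. *)
Lemma near_count (P : {poly algC}) (T a x : algC) (s : seq algC) (i : nat) :
  P - a%:P = T *: \prod_(y <- s) ('X - y%:P) -> {in s, forall y, O y} -> O x ->
  (0 < i)%N -> O T -> U P^`N(i).[x] -> (count (fun y : algC => M (y - x)%R) s <= i)%N.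
Proof.
move=> PE sO Ox i0 OT Ui; rewrite leqNgt; apply/negP => lti.
pose w := map (fun y => y - x) s.
have wO : {in w, forall z, O z} by move=> _ /mapP[y ys ->]; apply: vringB => //; exact: sO.
have cw : count M w = count (fun y => M (y - x)) s by rewrite count_map.
have Mi : M (\prod_(z <- w) ('X - z%:P))`_i by apply: low_coef_prod_XsubC; rewrite ?cw.
have PC : (P - a%:P) \Po ('X + x%:P) = T *: \prod_(z <- w) ('X - z%:P).
  rewrite PE linearZ /= rmorph_prod big_map; congr (_ *: _); apply: eq_bigr => y _.
  by rewrite /= comp_polyB comp_polyX comp_polyC polyCB; ring.
have : M (T *: \prod_(z <- w) ('X - z%:P))`_i by rewrite coefZ; apply: vmaxMl.
rewrite -PC comp_polyB comp_polyC coefB coefC gtn_eqF // subr0 coef_comp_XaddC.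
by rewrite (vunit_nmax Ui).
Qed.

(** * Inertia acting on one level at a prime where the critical orbit has odd valuation *)

Section Ramified.

Variables (G h : {poly algC}) (T ka : algC) (d n : nat) (fib : algC -> seq algC).
Local Notation g := (horner G).
Local Notation Lev := (Lev fib).
Hypothesis g_aut : forall (nu : autC) x, nu G.[x] = G.[nu x].
Hypothesis h_aut : forall (nu : autC) x, nu h.[x] = h.[nu x].
Hypothesis T_rat : T \in Crat.
Hypothesis ka_rat : ka \in Crat.
Hypothesis fibE : forall a, G - a%:P = T *: \prod_(y <- fib a) ('X - y%:P).
Hypothesis size_fib : forall a, size (fib a) = d.
Hypothesis mem_fib : forall a y, (y \in fib a) = (G.[y] == a).
Hypothesis uniq_Lev : forall m, uniq (Lev m).
Hypothesis d_ge5 : (5 <= d)%N.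
Hypothesis d_even : ~~ odd d.
Hypothesis GO : forall i, O G`_i.
Hypothesis hO : forall i, O h`_i.
Hypothesis UT : U T.
Hypothesis Ud : U d%:R.
Hypothesis U2 : U 2%:R.
Hypothesis U3 : U 3%:R.
Hypothesis kaO : O ka.
Hypothesis Uhka : U h.[ka].
Hypothesis Ulh : U (lead_coef h).
Hypothesis derG : G^`() = (d%:R * T) *: (('X - ka%:P) * h ^+ 2).
Hypothesis bez : exists a b : {poly algC}, [/\ forall i, O a`_i, forall i, O b`_i &
  a * h + b * h^`() = 1].
Hypothesis G0 : G.[0] = 1.
Hypothesis G1 : G.[1] = 1.
Variable v : int.
Hypothesis v_odd : odd (absz v).
Hypothesis val_y : U (iter n.+1 g ka * q%:R ^ v).

Lemma fib_vring a : O a -> {in fib a, forall y, O y}.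
Proof.
move=> Oa y ya; apply: (@vring_root _ _ (G - a%:P)).
- by move=> i; rewrite coefB coefC vringB //; case: ifP => // _; exact: vring0.
- by rewrite fibE lead_coefZ (monicP (monic_prod_XsubC _ _ _)) mulr1.
by rewrite /root !hE subr_eq0 -mem_fib.
Qed.

Lemma Lev_vring m x : x \in Lev m -> O x.
Proof.
elim: m x => [|m IH] x; first by rewrite inE => /eqP ->; exact: vring0.
rewrite (mem_LevS mem_fib) => /IH Og; apply: (fib_vring Og).
by rewrite mem_fib.
Qed.

Lemma derG_horner x : G^`().[x] = d%:R * T * ((x - ka) * h.[x] ^+ 2).
Proof. by rewrite derG !hE. Qed.

Lemma UdT : U (d%:R * T). Proof. exact: vunitM. Qed.

(** [ka] stays a simple critical point modulo M; by [near_count] at most two points of a fiber are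
    congruent to it. *)
Lemma nderiv2_ka : U G^`N(2).[ka].
Proof.
have : G^`(2).[ka] = d%:R * T * h.[ka] ^+ 2.
  rewrite /= derG expr2 derivZ !derivM derivXsubC !hE subrr.
  by ring.
rewrite nderivn_def hornerMn -mulr_natr => E.
rewrite -(vunitMr _ U2) mulrC E; apply: vunitM; [exact: UdT | exact: vunitX].
Qed.

Lemma root_h_unit z : root h z -> O z -> U h^`().[z].
Proof.
move=> /eqP hz Oz; have [a [b [aO bO E]]] := bez.
have : (a * h + b * h^`()).[z] = 1 by rewrite E hornerC.
rewrite !hE hz mulr0 add0r => E1.
have bz : O b.[z] by apply: vring_horner.
have dz : O h^`().[z] by apply: vring_horner => // i; rewrite coef_deriv vringMn.
apply/andP; split=> //; apply/negP => Md; have := vmaxMl bz Md.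
by rewrite E1 vmax1.
Qed.

Lemma root_h_vring z : root h z -> O z.
Proof. exact: vring_root. Qed.

Lemma ka_root_h z : root h z -> U (z - ka).
Proof.
move=> hz; have Oz := root_h_vring hz.
apply/andP; split; first exact: vringB.
apply/negP => Mz; have := vmax_horner hO kaO Oz; rewrite vmax_sym => /(_ Mz).
by rewrite (eqP hz) subr0 (vunit_nmax Uhka).
Qed.

(** The square of h in the derivative makes z a point of ramification index 3; the third coefficient
    is a unit because h is separable modulo M and [ka] is not a root of it there. *)
Lemma nderiv_root_h z : root h z -> [/\ G^`N(1).[z] = 0, G^`N(2).[z] = 0 & U G^`N(3).[z]].
Proof.
move=> hz; have hz0 := eqP hz; have Oz := root_h_vring hz; split.
- by rewrite nderivn1 derG_horner hz0; ring.
- have : G^`(2).[z] = 0 by rewrite /= derG !derivE !hE hz0; ring.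
  rewrite nderivn_def hornerMn => /eqP; rewrite mulrn_eq0 => /orP[//|/eqP //].
have : G^`(3).[z] = d%:R * T * (2%:R * (z - ka) * h^`().[z] ^+ 2).
  rewrite /= derG expr2 !derivZ !(derivM, derivD, derivXsubC, derivC) !hE hz0.
  by ring.
rewrite nderivn_def hornerMn -mulr_natr -[3`!]/(3 * 2)%N natrM => E.
have : U (G^`N(3).[z] * (3%:R * 2%:R)).
  rewrite E; apply: vunitM; first exact: UdT.
  apply: vunitM; last exact/vunitX/root_h_unit.
  by apply: vunitM => //; exact: ka_root_h.
by rewrite mulrC vunitMr //; exact: vunitM.
Qed.

Lemma near_cases x : O x -> [\/ U G^`().[x], M (x - ka) |
  exists2 z, root h z & M (x - z)].
Proof.
move=> Ox.
have Ohx : O h.[x] by apply: vring_horner.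
have [Ux|Mx] := vring_case (vringB Ox kaO); last by constructor 2.
have [Uh|] := vring_case Ohx.
  constructor 1; rewrite derG_horner; apply: vunitM; first exact: UdT.
  by apply: vunitM => //; exact: vunitX.
have [s hs] := closed_field_poly_normal h; rewrite {1}hs hornerZ vmaxM_unit // horner_prod => Mp.
have [z zs] : exists2 z, z \in s & M ('X - z%:P).[x].
  have [|z zs /=] := @vmax_prod _ V _ s predT (fun z => ('X - z%:P).[x]) _ Mp; last by exists z.
  move=> z zs _; rewrite !hE vringB //; apply: root_h_vring.
  by rewrite hs rootZ ?root_prod_XsubC // (vunit_neq0 Ulh).
rewrite !hE => Mz; constructor 3; exists z => //.
by rewrite hs rootZ ?root_prod_XsubC // (vunit_neq0 Ulh).
Qed.

Lemma near_count_eq (s : seq algC) x y : M (x - y) ->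
  count (fun z : algC => M (z - x)%R) s = count (fun z : algC => M (z - y)%R) s.
Proof.
move=> Mxy; apply: eq_count => z; apply/idP/idP => H; first exact: vmax_trans H Mxy.
by apply: vmax_trans H _; rewrite vmax_sym.
Qed.

Lemma fib_count a x i : O a -> O x -> (0 < i)%N -> U G^`N(i).[x] ->
  (count (fun y : algC => M (y - x)%R) (fib a) <= i)%N.
Proof.
move=> Oa Ox i0 Ui; apply: (near_count (fibE a)) => //; first exact: fib_vring.
exact: vunit_ring.
Qed.

Lemma fib_count_ka a x : O a -> M (x - ka) ->
  (count (fun y : algC => M (y - x)%R) (fib a) <= 2)%N.
Proof. by move=> Oa /near_count_eq ->; apply: fib_count => //; exact: nderiv2_ka. Qed.

Lemma fib_count_le3 a x : O a -> O x -> (count (fun y : algC => M (y - x)%R) (fib a) <= 3)%N.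
Proof.
move=> Oa Ox; case: (near_cases Ox) => [Ux|Mx|[z hz Mz]].
- by apply: leq_trans (@fib_count a x 1 _ _ _ _) _ => //; rewrite nderivn1.
- exact: leq_trans (fib_count_ka Oa Mx) _.
rewrite (near_count_eq _ Mz); apply: fib_count => //; first exact: root_h_vring.
by have [] := nderiv_root_h hz.
Qed.

Lemma two_near (s : seq algC) x y : x \in s -> y \in s -> x != y -> M (y - x) ->
  (1 < count (fun z : algC => M (z - x)%R) s)%N.
Proof.
move=> xs ys xy Mxy; rewrite -size_filter.
have := @uniq_leq_size _ [:: x; y] [seq z <- s | M (z - x)].
rewrite /= inE xy; apply => // z; rewrite !inE mem_filter => /orP[]/eqP ->.
  by rewrite subrr vmax0 xs.
by rewrite Mxy ys.
Qed.

Section Inertial.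

Variables (si : autC) (e : nat).
Hypothesis siI : inertial V si.

(* Near a root z of h, G - G(z) is a unit times (x - z)^3: an inertia element moving b would multiply
   b - z by a primitive cube root of unity modulo M, which a 2-power order forbids. *)
Lemma moved_near_ka a b : O a -> b \in fib a -> si b != b -> si a = a ->
  iter (2 ^ e) si b = b -> M (b - ka).
Proof.
move=> Oa ba sb sa orb; have Ob := fib_vring Oa ba.
have [Osb Msb] := inertialP siI Ob.
have Gb : G.[b] = a by apply/eqP; rewrite -mem_fib.
have sba : si b \in fib a by rewrite mem_fib -g_aut Gb sa.
have c2 : (1 < count (fun z : algC => M (z - b)%R) (fib a))%N.
  by apply: two_near Msb => //; rewrite eq_sym.
case: (near_cases Ob) => [Ux|//|[z hz Mz]].
  by have := @fib_count a b 1 Oa Ob isT; rewrite nderivn1 => /(_ Ux); rewrite leqNgt c2.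
exfalso.
have Oz := root_h_vring hz; have [Osz Msz] := inertialP siI Oz.
(* [si z] is a root of h congruent to z, and h has simple roots modulo M. *)
have sz : si z = z.
  have hsz : h.[si z] = 0 by rewrite -h_aut (eqP hz) rmorph0.
  have [W [WO W0 WE]] := @taylor_vring h z 1 hO Oz.
  have := WE (si z - z); rewrite addrC subrK hsz big_ord1 nderivn0 (eqP hz) mul0r add0r expr1.
  move/esym/eqP; rewrite mulf_eq0 subr_eq0 => /orP[/eqP //|/eqP W1].
  have := @vmax_horner _ V W (si z - z) 0 WO (vmaxW Msz) (vring0 V); rewrite subr0 => /(_ Msz).
  rewrite W1 horner_coef0 W0 nderivn1 sub0r => /vmaxN; rewrite opprK.
  by rewrite (vunit_nmax (root_h_unit hz Oz)).
have [n1 n2 U3z] := nderiv_root_h hz.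
have [W [WO W0 WE]] := @taylor_vring G z 3 GO Oz.
pose s := b - z; pose s' := si b - z.
have ss' : si s = s' by rewrite rmorphB sz.
have Os : O s by exact: vringB.
have Os' : O s' by exact: vringB.
have Ms' : M s' by apply: vmax_trans Msb Mz.
have s0 : s != 0.
  by apply: contraNneq sb => s0; move: ss'; rewrite s0 rmorph0 /s' => /esym/eqP;
     rewrite subr_eq0 => /eqP ->; move/eqP: s0; rewrite /s subr_eq0 eq_sym.
have E3 : s ^+ 3 * W.[s] = s' ^+ 3 * W.[s'].
  have := WE s; have := WE s'; rewrite /s /s' [z + (b - z)]addrC [z + (si b - z)]addrC !subrK.
  rewrite -g_aut Gb sa !big_ord_recr !big_ord0 /= n1 n2 !mul0r !addr0 => -> /eqP.
  by rewrite !expr0 (inj_eq (addrI _)) => /eqP ->.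
have Ws' : U W.[s'].
  apply: (@vunit_eqmax _ V W.[0]); first by rewrite horner_coef0 W0.
  by apply: vmax_horner => //; [exact: vring0 | rewrite sub0r vmaxN].
have [W2 [W2O _ W2E]] := @taylor_vring W s 1 WO Os.
(* Modulo M, [si] multiplies s = b - z by [rho] and fixes [rho] itself, so [rho] to the power 2^e is
   1; comparing the cubic Taylor terms gives [rho] ^+ 2 + [rho] + 1 = 0. Hence [rho] = 1 modulo M,
   and 3 would not be a unit. *)
pose rho := s' / s.
have s'E : s' = rho * s by rewrite /rho divfK.
have rho1 : rho != 1.
  apply: contraNneq sb => r1; move/eqP: s'E; rewrite r1 mul1r /s /s'.
  by rewrite (inj_eq (addIr _)).
have E4 : (rho ^+ 2 + rho + 1) * W.[s'] = - (s * W2.[s' - s]).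
  have D : W.[s'] - W.[s] = (s' - s) * W2.[s' - s].
    by have := W2E (s' - s); rewrite addrC subrK big_ord1 nderivn0 mulr1 expr1 => ->;
      rewrite addrC addKr.
  have H : (rho - 1) * s ^+ 3 != 0 by rewrite mulf_neq0 ?subr_eq0 ?expf_neq0.
  apply: (mulfI H); transitivity ((s' ^+ 3 - s ^+ 3) * W.[s']); first by rewrite s'E; ring.
  transitivity (- (s ^+ 3 * (W.[s'] - W.[s]))); last by rewrite D {1}s'E; ring.
  by rewrite mulrBl -E3; ring.
have Mq : M (rho ^+ 2 + rho + 1).
  rewrite -(vmaxM_unit _ Ws') mulrC E4; apply: vmaxN; apply: vmaxMr => //.
  by apply: vring_horner => //; apply: vringB.
have Or : O rho.
  apply: (@vring_root _ V ('X^2 + 'X + (1 - (rho ^+ 2 + rho + 1))%:P)).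
  - by case=> [|[|[|i]]]; rewrite !coefE /= ?add0r ?addr0 ?vring1 ?vring0 //;
      apply: vringB; [exact: vring1 | exact: vmaxW].
  - have -> : lead_coef ('X^2 + 'X + (1 - (rho ^+ 2 + rho + 1))%:P) = 1; last exact: vunit1.
    by rewrite -addrA lead_coefDl ?lead_coefXn // size_polyXn size_XaddC.
  rewrite /root !hE; apply/eqP.
  by ring.
have M3 : M (rho ^+ 3 - 1).
  have -> : rho ^+ 3 - 1 = (rho - 1) * (rho ^+ 2 + rho + 1) by ring.
  by apply: vmaxMl => //; apply: vringB => //; exact: vring1.
have Mn m : M (rho ^+ (3 * m) - 1).
  by rewrite exprM -[X in _ - X](expr1n _ m); apply: vmax_subX => //; [exact: vringX | exact: vring1].
have itE m : O (iter m si s / s) /\ M (iter m si s / s - rho ^+ m).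
  elim: m => [|m [IO IM]]; first by rewrite /= divff // expr0 subrr; split; [exact: vring1|exact: vmax0].
  have [O1 M1] := inertialP siI IO.
  have E : iter m.+1 si s / s = si (iter m si s / s) * rho.
    by rewrite /= fmorph_div ss' /rho mulrA divfK // -ss' fmorph_eq0.
  rewrite E exprSr; split; first exact: vringM.
  by rewrite -mulrBl; apply: vmaxMr => //; exact: vmax_trans M1 IM.
have its : iter (2 ^ e) si s = s.
  have H m : iter m si s = iter m si b - z by elim: m => //= m ->; rewrite rmorphB sz.
  by rewrite H orb.
have [_] := itE (2 ^ e)%N; rewrite its divff // => Me.
have Mr1 : M (rho - 1).
  have : ((2 ^ e) %% 3 == 1)%N || ((2 ^ e) %% 3 == 2)%N.
    elim: (e) => // e'; rewrite expnS; set t := (2 ^ e')%N; clearbody t; clear; lia.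
  rewrite [in M _](divn_eq (2 ^ e) 3) exprD mulnC in Me.
  set m := (2 ^ e %/ 3)%N in Me; case/orP => /eqP E; rewrite E in Me.
    apply: vmax_trans (_ : M (rho - rho ^+ (3 * m) * rho ^+ 1)) _; last by rewrite vmax_sym.
    rewrite expr1 -{1}[rho]mul1r -mulrBl; apply: vmaxMr => //.
    by rewrite vmax_sym.
  have M2 : M (rho ^+ 2 - 1).
    apply: vmax_trans (_ : M (rho ^+ 2 - rho ^+ (3 * m) * rho ^+ 2)) _; last by rewrite vmax_sym.
    rewrite -{1}[rho ^+ 2]mul1r -mulrBl; apply: vmaxMr => //; last exact: vringX.
    by rewrite vmax_sym.
  have -> : rho - 1 = (rho ^+ 3 - 1) - rho * (rho ^+ 2 - 1) by ring.
  by apply: vmaxB => //; apply: vmaxMl.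
suff : M 3%:R by rewrite (vunit_nmax U3).
have -> : 3%:R = (rho ^+ 2 + rho + 1) - (rho - 1) * (rho + 2%:R) by ring.
apply: vmaxB => //; apply: vmaxMr => //; apply: vringD => //; exact: vring_nat.
Qed.

End Inertial.

Lemma iter_G_rat m x : x \in Crat -> iter m g x \in Crat.
Proof.
move=> xr; apply: autC_sep => nu; rewrite (iter_aut (g := g) g_aut) //.
by case/CratP: xr => a ->; rewrite fmorph_rat.
Qed.

Lemma iter_G_prod m : exists k, forall w, iter m g w = T ^+ k * \prod_(a <- Lev m) (w - a).
Proof.
elim: m => [|m [k IH]]; first by exists 0%N => w; rewrite /= big_seq1 subr0 mul1r.
exists (k + size (Lev m))%N => w; rewrite iterSr IH exprD -mulrA; congr (_ * _).
rewrite /= big_flatten big_map /=; elim: (Lev m) => [|a l IHl].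
  by rewrite !big_nil mulr1.
rewrite !big_cons IHl /= exprS.
have -> : G.[w] - a = T * \prod_(x <- fib a) (w - x).
  have := congr1 (horner^~ w) (fibE a); rewrite /= !hE horner_prod => ->; congr (_ * _).
  by apply: eq_bigr => x _; rewrite !hE.
by ring.
Qed.

Lemma deriv_fib a x : uniq (fib a) -> x \in fib a ->
  G^`().[x] = T * \prod_(y <- fib a | y != x) (x - y).
Proof.
move=> ua xa.
have -> : G^`() = (G - a%:P)^`() by rewrite derivB derivC subr0.
rewrite fibE derivZ (bigD1_seq x) //= derivM hornerZ; congr (_ * _).
rewrite !hE subrr mul0r addr0 derivXsubC hornerC mul1r horner_prod.
by apply: eq_bigr => y _; rewrite !hE.
Qed.

Let cc := (-1) ^+ (\sum_(i < d) i) * d%:R ^+ d / T : algC.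

(** The discriminant of a fiber is the product of the values of the derivative on it: the factor h
    ^+ 2 contributes a square, and 'X - ka contributes the value of G - a at [ka]. Evenness of d
    removes the sign. *)
Lemma vd_fib a : uniq (fib a) -> vd (fib a) ^+ 2 =
  cc * (G.[ka] - a) * (\prod_(x <- fib a) h.[x]) ^+ 2.
Proof.
move=> ua; rewrite vd_sqr // size_fib /cc -!mulrA; congr (_ * _).
have T0 : T != 0 := vunit_neq0 UT.
have -> : diffs (fib a) = \prod_(x <- fib a) (d%:R * (ka - x) * (-1) * (h.[x] ^+ 2)).
  apply: eq_big_seq => x xa; apply: (mulfI T0); rewrite -deriv_fib // derG_horner; ring.
rewrite !big_split /= -expr2 -!mulrA.
have pc (c : algC) : \prod_(x <- fib a) c = c ^+ d.
  by rewrite -(size_fib a); elim: (fib a) => [|x l IH]; rewrite ?big_nil // big_cons IH exprS.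
rewrite !pc; congr (_ * _).
have -> : (-1) ^+ d = 1 :> algC by rewrite -signr_odd (negbTE d_even).
rewrite mul1r; have := congr1 (horner^~ ka) (fibE a); rewrite /= !hE horner_prod => ->.
rewrite -mulrA mulKf //; congr (_ * _).
by apply: eq_bigr => x _; rewrite !hE.
Qed.

(** The inertia element negates a square root of the product of all discriminants of level n, so it
    is odd overall. A moved vertex must be congruent to [ka], which allows at most one transposition
    per fiber and none at all on lower levels. *)
Theorem ramified_level : exists (si : autC) (Z : pred algC) (A B : algC -> algC),
  [/\ odd (count Z (Lev n)),
      forall z, z \in Lev n -> Z z -> [/\ A z != B z, g (A z) = z & g (B z) = z],
      forall x, x \in Lev n.+1 -> si x = if Z (g x) then swap (A (g x)) (B (g x)) x else x &
      forall c, c \in Lev n -> exists2 z, g z = g c & ~~ Z z].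
Proof.
have uf a m : a \in Lev m -> uniq (fib a) by exact: (uniq_fib uniq_Lev).
pose de := \prod_(a <- Lev n) vd (fib a).
pose H := \prod_(x <- Lev n.+1) h.[x].
(* The product of G(ka) - a over level n is g^(n+1)(ka) up to a power of T, so [de] ^+ 2 has the odd
   valuation assumed in [val_y] up to an even one. *)
have [k kE] := iter_G_prod n.
have de2 : de ^+ 2 = cc ^+ size (Lev n) * (iter n.+1 g ka / T ^+ k) * H ^+ 2.
  rewrite iterSr kE -mulrA [T ^+ k * _]mulrC mulfK ?expf_neq0 ?(vunit_neq0 UT) // .
  rewrite /de /H /= big_flatten big_map -!prodrXl.
  rewrite (eq_big_seq (fun a => cc * (G.[ka] - a) * (\prod_(x <- fib a) h.[x]) ^+ 2)).
    rewrite 2!big_split /= -mulrA; congr (_ * _).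
    by elim: (Lev n) => [|x l IH]; rewrite ?big_nil // big_cons IH exprS.
  by move=> a aL; apply: vd_fib; exact: (uf _ n).
have de0 : de != 0.
  rewrite /de prodf_seq_neq0; apply/allP => a aL /=; apply: vd_neq0; exact: (uf _ n).
have Hrat : H \in Crat.
  apply: autC_prod_Crat => // nu x xL; by rewrite (Lev_aut (g := g) g_aut mem_fib).
have H0 : H != 0.
  by apply: contraNneq de0 => H0; move/eqP: de2; rewrite H0 expr0n mulr0 sqrf_eq0.
have cU : U cc.
  apply: vunitM; last exact: vunitV.
  by apply: vunitM; [apply/vunitX/vunitN/vunit1 | exact: vunitX].
have crat : cc \in Crat by rewrite rpredM ?rpredV // rpredM ?rpredX ?rpredN ?rpred1 // rpred_nat.
have [j Hj] := vunit_rat V q_pr Hrat H0.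
have q0 : q%:R != 0 :> algC by apply: vchar_neq0.
have [|||s0 [s0de s0I]] := @inertia _ V q_pr de (v + j * 2).
- rewrite de2; apply: rpredM; last exact: rpredX.
  apply: rpredM; first exact: rpredX.
  by apply: rpredM; [exact: iter_G_rat | rewrite rpredV rpredX].
- rewrite de2 expfzDr // -exprz_exp.
  have -> : cc ^+ size (Lev n) * (iter n.+1 g ka / T ^+ k) * H ^+ 2 * (q%:R ^ v * (q%:R ^ j) ^+ 2) =
      cc ^+ size (Lev n) * ((iter n.+1 g ka * q%:R ^ v) / T ^+ k) * (H * q%:R ^ j) ^+ 2 by ring.
  apply: vunitM; last exact: vunitX.
  apply: vunitM; first exact: vunitX.
  by apply: vunitM => //; apply/vunitV/vunitX.
- by move: v_odd; clear; lia.
have s0L x : x \in Lev n.+1 -> s0 x \in Lev n.+1 by rewrite (Lev_aut (g := g) g_aut mem_fib).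
have [N N0 NE] := iter_order s0L.
(* The m-th power for the odd part m of the order: the action gets 2-power order, which rules out
   3-cycles, and [de] is still negated since m is odd. *)
have [e [m [oddm NEq]]] : exists e m, odd m /\ N = (m * 2 ^ e)%N.
  have [m cm E] := pfactor_coprime (isT : prime 2) N0.
  by exists (logn 2 N), m; split=> //; rewrite -coprime2n.
have [si siE] := autC_iter s0 m.
have siI : inertial V si.
  by move=> x xA; rewrite siE; have [] := inertial_iter m s0I (vring_Aint V xA).
have side : si de = - de.
  have E i : iter i s0 de = (-1) ^+ i * de.
    by elim: i => [|i IH]; rewrite ?mul1r //= IH rmorphM rmorphXn rmorphN1 s0de exprS; ring.
  by rewrite siE E -signr_odd oddm expr1 mulN1r.
have siord x : x \in Lev n.+1 -> iter (2 ^ e) si x = x.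
  move=> xL; have E i y : iter i si y = iter (m * i) s0 y.
    by elim: i => [|i IH]; rewrite ?muln0 //= IH siE mulnS iterD.
  by rewrite E -NEq NE.
have My : M (iter n.+1 g ka).
  have Oit i x : O x -> O (iter i g x).
    by move=> Ox; elim: i => //= i; apply: vring_horner.
  case: (vring_case (Oit n.+1 ka kaO)) => // Uy; move: val_y; rewrite vunitMr // => /vunit_expz.
  by move=> v0; move: v_odd; rewrite v0.
have itcong i x y : O x -> O y -> M (x - y) -> M (iter i g x - iter i g y).
  move=> Ox Oy Mxy; elim: i => //= i IH; apply: vmax_horner => //.
    by elim: (i) => //= i'; apply: vring_horner.
  by elim: (i) => //= i'; apply: vring_horner.
have gL x i : x \in Lev i.+1 -> g x \in Lev i by rewrite (mem_LevS mem_fib).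
have ordL i x : (i <= n.+1)%N -> x \in Lev i -> iter (2 ^ e) si x = x.
  move=> lei; rewrite -(subKn lei); move: (n.+1 - i)%N => j' {lei i}.
  elim: j' x => [|j' IH] x; first by rewrite subn0; exact: siord.
  rewrite subnS; case E: (n.+1 - j')%N => [|i] /= xL.
    by apply: IH; rewrite E.
  have [y yx] : exists y, y \in fib x.
    have := size_fib x; case: (fib x) => [|y l] d0; last by exists y; rewrite mem_head.
    by move: d_ge5; rewrite -d0.
  have gy : g y = x by apply/eqP; rewrite -mem_fib.
  have /IH yE : y \in Lev (n.+1 - j') by rewrite E (mem_LevS mem_fib) gy.
  have itg i' : iter i' si (g y) = g (iter i' si y) by elim: i' => //= i' ->; rewrite g_aut.
  by rewrite -gy itg yE.
(* If x on level i + 1 moved, it would be congruent to [ka], so g^(i+1)(ka) would be congruent to 0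
   and g^(n+1)(ka) to g^(n-i)(0) = 1; but g^(n+1)(ka) is in M. *)
have fixL i : (i <= n)%N -> {in Lev i, si =1 id}.
  elim: i => [|i IH] lti x xL; first by move: xL; rewrite inE => /eqP ->; rewrite rmorph0.
  apply/eqP; apply: contraT => sx.
  have Mx : M (x - ka).
    apply: (@moved_near_ka si e siI (g x)) => //; rewrite ?mem_fib //.
    - exact: (Lev_vring (gL _ _ xL)).
    - by rewrite IH ?gL // ltnW.
    by apply: ordL xL; rewrite ltnW.
  have Ox := Lev_vring xL.
  have := itcong i.+1 _ _ Ox kaO Mx.
  have -> : iter i.+1 g x = 0 by apply/eqP; rewrite -(mem_Lev (g := g) mem_fib).
  move=> /(itcong (n - i)%N _ _ (vring0 V)) H1.
  have {H1} : M (iter (n - i) g 0 - iter n.+1 g ka).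
    rewrite -[in iter n.+1 _ _](subnK (leq_trans lti (leqnSn n))) iterD subSS; apply: H1.
    by apply: vring_horner => //; elim: (i) => //= i'; apply: vring_horner.
  move/vmaxD => /(_ _ My); rewrite subrK.
  have -> : iter (n - i) g 0 = 1.
    rewrite -(subnSK lti) iterSr G0; elim: (n - i.+1)%N => //= j' ->; exact: G1.
  by rewrite vmax1.
have moved x : x \in Lev n.+1 -> si x != x -> M (x - ka).
  move=> xL sx; apply: (@moved_near_ka si e siI (g x)) => //; rewrite ?mem_fib //.
  - exact: (Lev_vring (gL _ _ xL)).
  - by rewrite (fixL n) ?gL.
  exact: siord.
pose Z z := (z \in Lev n) && has (fun x => si x != x) (fib z).
pose A z := nth 0 (fib z) (find (fun x => si x != x) (fib z)).
pose B z := si (A z).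
have AP z : Z z -> A z \in fib z /\ si (A z) != A z.
  by move=> /andP[_ Zz]; split; [rewrite mem_nth // -has_find | exact: (nth_find 0 Zz)].
have ABf z : z \in Lev n -> Z z -> B z \in fib z.
  by move=> zL /AP[Af _]; move: Af; rewrite !mem_fib /B -g_aut => /eqP ->; rewrite (fixL n).
(* All moved points of a fiber are congruent to [ka], and at most two points are; so [si] exchanges
   exactly these two. *)
have swE z : z \in Lev n -> Z z -> {in fib z, si =1 swap (A z) (B z)}.
  move=> zL Zz x xf; have [Af sA] := AP z Zz; have Bf := ABf z zL Zz.
  have fL y : y \in fib z -> y \in Lev n.+1 by rewrite (mem_LevS mem_fib) mem_fib => /eqP ->.
  have MA := moved _ (fL _ Af) sA.
  have sB : si (B z) != B z by rewrite (inj_eq (fmorph_inj si)).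
  have MB := moved _ (fL _ Bf) sB.
  have only y : y \in fib z -> M (y - ka) -> y = A z \/ y = B z.
    move=> yf My'; have [->|yA] := eqVneq y (A z); first by left.
    have [->|yB] := eqVneq y (B z); first by right.
    have := @fib_count_ka z ka (Lev_vring zL); rewrite subrr => /(_ (vmax0 V)).
    rewrite leqNgt -size_filter; move/negP; case.
    have := @uniq_leq_size _ [:: y; A z; B z] [seq z0 <- fib z | M (z0 - ka)].
    rewrite /= !inE !negb_or yA yB eq_sym sA /=; apply=> // t.
    by rewrite !inE mem_filter => /or3P[]/eqP ->; rewrite ?My' ?MA ?MB.
  rewrite /swap; case: (x =P A z) => [->//|/eqP xA]; case: (x =P B z) => [->|/eqP xB].
    have sBf : si (B z) \in fib z by rewrite mem_fib -g_aut; move: Bf; rewrite mem_fib => /eqP ->; rewrite (fixL n).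
    case: (only _ sBf) => //; last by move/eqP; rewrite (negbTE sB).
    by apply: moved; [exact: fL | rewrite (inj_eq (fmorph_inj si))].
  apply/eqP; apply: contraT => sx; have := moved _ (fL _ xf) sx.
  by case/(only _ xf) => E; rewrite E eqxx in xA xB.
exists si, Z, A, B; split.
- have sgn a : a \in Lev n -> si (vd (fib a)) = (-1) ^+ Z a * vd (fib a).
    move=> aL; case Za: (Z a).
      have [Af sA] := AP a Za.
      by rewrite (@vd_swap si (fib a) (A a) (B a)) ?mulN1r ?(uf _ n) ?ABf // 1?eq_sym //; apply: swE.
    rewrite mul1r vd_map; congr vd; rewrite -[RHS]map_id; apply/eq_in_map => x xa.
    by move: Za; rewrite /Z aL => /negbT/hasPn/(_ x xa); rewrite negbK => /eqP.
  have : si de = (-1) ^+ count Z (Lev n) * de.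
    rewrite /de rmorph_prod; elim: (Lev n) sgn => [|a l IH] sgn.
      by rewrite !big_nil mul1r.
    rewrite !big_cons /= exprD sgn ?mem_head // IH; first by ring.
    by move=> b bl; apply: sgn; rewrite inE bl orbT.
  rewrite side -[- de]mulN1r => E; have := mulIf de0 E; rewrite -signr_odd; case: odd => // /eqP.
  by rewrite expr0 eq_sym -subr_eq0 opprK -[1 + 1]/(2%:R) pnatr_eq0.
- move=> z zL Zz; have [Af sA] := AP z Zz; split; first by rewrite eq_sym.
    by apply/eqP; rewrite -mem_fib.
  by apply/eqP; rewrite -mem_fib ABf.
- move=> x xL; have gxL := gL _ _ xL; have xf : x \in fib (g x) by rewrite mem_fib.
  case Zg: (Z (g x)); first exact: swE.
  by move: Zg; rewrite /Z gxL => /negbT/hasPn/(_ x xf); rewrite negbK => /eqP.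
(* If all d siblings of c were in Z, each would be the image of a point near [ka], hence congruent
   to g(ka); a fiber has at most three points in one residue class. *)
move=> c cL; apply: contrapT => no.
have allZ z : z \in fib (g c) -> Z z.
  move=> zf; apply: contraT => nZ; case: no; exists z => //.
  by apply/eqP; rewrite -mem_fib.
have Oc := Lev_vring cL.
have Ogc : O (g c) by apply: vring_horner.
have := fib_count_le3 Ogc (vring_horner GO kaO).
rewrite (eq_in_count (a2 := predT)) => [|z zf].
  by rewrite count_predT size_fib => d3; have := leq_trans d_ge5 d3.
have [Af sA] := AP z (allZ z zf).
have gz : g z = g c by apply/eqP; rewrite -mem_fib.
have zL : z \in Lev n by have /andP[] := allZ z zf.
have AL : A z \in Lev n.+1 by rewrite (mem_LevS mem_fib); move: Af; rewrite mem_fib => /eqP ->.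
have MA := moved _ AL sA.
have <- : g (A z) = z by apply/eqP; rewrite -mem_fib.
by rewrite /=; apply: vmax_horner => //; exact: (Lev_vring AL).
Qed.

End Ramified.

End Local.

(** * Fibers at the two special primes *)

Section Fint.

Variable R : numFieldType.
Implicit Types (k u : nat) (A B c : R).

Definition hsq k u A B : seq (R * nat) :=
  [:: (1, (2 * k)%N); (2%:R * A, (k + u)%N); (A ^+ 2, (2 * u)%N); (2%:R * B, k);
      (2%:R * A * B, u); (B ^+ 2, 0%N)].

Definition Fterm k c (t : R * nat) : {poly R} := ((2 * k + 2)%:R * t.1) *:
  (t.2.+2%:R^-1 *: 'X^(t.2.+2) - (c / t.2.+1%:R) *: 'X^(t.2.+1)).

Definition Fint k u A B c := \sum_(t <- hsq k u A B) Fterm k c t.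
(** The integrals from 0 to 1 of x h(x)^2 and, for [I0], of h(x)^2, with h = x^k + A x^u + B; their
    quotient is the c for which [Fint] vanishes at 1. *)
Definition I1 k u A B := \sum_(t <- hsq k u A B) t.1 / t.2.+2%:R.
Definition I0 k u A B := \sum_(t <- hsq k u A B) t.1 / t.2.+1%:R.

Lemma hsqE k u A B : \sum_(t <- hsq k u A B) t.1 *: 'X^(t.2) = ('X^k + A *: 'X^u + B%:P) ^+ 2.
Proof.
rewrite /hsq !big_cons big_nil /= -!mul_polyC [(2 * k)%N]mulnC [(2 * u)%N]mulnC !exprM.
rewrite (exprD _ k u) expr0 !polyCM polyC1 (polyC_natr R 2); ring.
Qed.

Lemma deriv_Fint k u A B c : (Fint k u A B c)^`() =
  (2 * k + 2)%:R *: (('X - c%:P) * ('X^k + A *: 'X^u + B%:P) ^+ 2).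
Proof.
rewrite -hsqE /Fint raddf_sum /= mulr_sumr scaler_sumr; apply: eq_bigr => -[m e] _ /=.
rewrite /Fterm /= derivZ derivB !derivZ !derivXn /=.
rewrite -[X in _^-1 *: X]scaler_nat -[X in (c / _) *: X]scaler_nat !scalerA.
rewrite mulVf ?pnatr_eq0 // divfK ?pnatr_eq0 // scale1r exprS.
by rewrite -!mul_polyC !polyCM; ring.
Qed.

Lemma Fint_at0 k u A B c : (Fint k u A B c).[0] = 0.
Proof.
rewrite /Fint horner_sum big1_seq // => -[m e] _.
by rewrite /Fterm !hornerE_comm !hornerXn !expr0n /= !mulr0 subrr mulr0.
Qed.

Lemma Fint_at1 k u A B : I0 k u A B != 0 -> (Fint k u A B (I1 k u A B / I0 k u A B)).[1] = 0.
Proof.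
move=> nz; set c := I1 _ _ _ _ / _; rewrite /Fint horner_sum.
transitivity ((2 * k + 2)%:R * (I1 k u A B - c * I0 k u A B)); last first.
  by rewrite /c divfK // subrr mulr0.
rewrite /I1 /I0 mulr_sumr -sumrB mulr_sumr; apply: eq_bigr => -[m e] _.
by rewrite /Fterm hornerZ hornerD hornerN !hornerZ !hornerXn !expr1n /=; ring.
Qed.

Lemma lead_Fint k u A B c : (u < k)%N -> (0 < u)%N ->
  size (Fint k u A B c) = (2 * k + 3)%N /\ lead_coef (Fint k u A B c) = 1.
Proof.
move=> uk u0.
have [Q [QE szQ]] : exists Q : {poly R}, Fint k u A B c = 'X^(2 * k + 2) + Q /\ (size Q < 2 * k + 3)%N.
  rewrite /Fint /hsq big_cons {1}/Fterm /= mulr1 scalerBr !scalerA addn2 divff ?pnatr_eq0 // scale1r -addrA.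
  eexists; split; first reflexivity.
  have szX (x : R) n m : (n < m)%N -> (size (x *: 'X^n) <= m)%N.
    by move=> nm; apply: leq_trans (size_scale_leq _ _) _; rewrite size_polyXn.
  have szD (P P' : {poly R}) m : (size P <= m)%N -> (size P' <= m)%N -> (size (P + P')%R <= m)%N.
    by move=> h1 h2; apply: leq_trans (size_polyD _ _) _; rewrite geq_max h1.
  have szT m (t : R * nat) : (t.2.+2 < m)%N -> (size (Fterm k c t) <= m)%N.
    move=> lt; apply: leq_trans (size_scale_leq _ _) _; apply: (szD); first exact: szX.
    by rewrite size_polyN; apply: szX; apply: ltn_trans lt.
  rewrite -addn2 addn3 ltnS.
  apply: (szD); first by rewrite size_polyN; apply: szX; lia.
  rewrite !big_cons big_nil; do 5!(apply: (szD); first by apply: (szT); rewrite /=; lia).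
  by rewrite size_poly0.
have lt : (size Q < size ('X^(2 * k + 2) : {poly R}))%N by rewrite size_polyXn -addnS.
by rewrite QE size_polyDl // lead_coefDl // size_polyXn lead_coefXn -addnS.
Qed.

End Fint.

Lemma map_Fint (R S : numFieldType) (f : {rmorphism R -> S}) k u A B c :
  map_poly f (Fint k u A B c) = Fint k u (f A) (f B) (f c).
Proof.
rewrite /Fint /hsq !big_cons !big_nil !rmorphD rmorph0 /=.
have E m e : map_poly f (Fterm k c (m, e)) = Fterm k (f c) (f m, e).
  rewrite /Fterm map_polyZ rmorphB /= !map_polyZ !map_polyXn rmorphM rmorph_nat.
  by rewrite fmorph_div fmorphV !rmorph_nat.
by rewrite !E !rmorphM /= rmorph_nat rmorph1.
Qed.

Lemma count_sub_eq (T : eqType) (P P' : pred T) (s : seq T) : (forall x, P x -> P' x) ->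
  count P s = count P' s -> forall x, x \in s -> P' x -> P x.
Proof.
move=> sub; elim: s => //= y s IH; have le := sub_count sub s.
case Py: (P y); first rewrite (sub _ Py) => /addnI/IH {}IH x.
  by rewrite inE => /orP[/eqP -> //|]; exact: IH.
case P'y: (P' y) => /= E x; first by move: le; rewrite -[count P s]add0n E add1n ltnn.
by rewrite inE => /orP[/eqP ->|]; [rewrite P'y | apply: IH; rewrite add0n in E].
Qed.

(** * Newton polygons of the fibers of F at p and r *)

Section LocalFiber.

Variables (q : nat) (V : place q).
Hypothesis q_pr : prime q.
Local Notation O := (vring V).
Local Notation M := (vmax V).
Local Notation U := (vunit V).

Definition pcong (P Q : {poly algC}) := forall i, M (P - Q)`_i.

Lemma pcong_refl P : pcong P P.
Proof. by move=> i; rewrite subrr coef0 vmax0. Qed.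

Lemma pcongD P Q P' Q' : pcong P Q -> pcong P' Q' -> pcong (P + P') (Q + Q').
Proof.
move=> h h' i; have -> : P + P' - (Q + Q') = (P - Q) + (P' - Q') by ring.
by rewrite coefD vmaxD.
Qed.

Lemma pcong_Xn (x y : algC) n : M (x - y) -> pcong (x *: 'X^n) (y *: 'X^n).
Proof.
move=> Mx i; rewrite -scalerBl coefZ coefXn; case: eqP => _; rewrite ?mulr1 ?mulr0 //.
exact: vmax0.
Qed.

Lemma pcong_Xn0 (x : algC) n : M x -> pcong (x *: 'X^n) 0.
Proof. by move=> Mx; rewrite -(scale0r 'X^n); apply: pcong_Xn; rewrite subr0. Qed.

Lemma pcong_horner P Q x : pcong P Q -> O x -> M (P.[x] - Q.[x]).
Proof. by move=> h Ox; rewrite -hornerN -hornerD; apply: vmax_horner0. Qed.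

Lemma root_count_cong (G H : {poly algC}) (w : seq algC) (c0 : algC) (a e : nat) :
  G = c0 *: \prod_(z <- w) ('X - z%:P) -> pcong G H -> (forall i, O H`_i) ->
  (forall i, (i < a)%N -> H`_i = 0) -> U H`_a -> U H`_e -> (forall i, (e < i)%N -> H`_i = 0) ->
  count M w = a /\ count O w = e.
Proof.
move=> GE cong OH Ha Ua Ue He.
have GH i : G`_i = (G - H)`_i + H`_i by rewrite coefB subrK.
have UG i : U H`_i -> U G`_i by move=> UH; rewrite GH addrC; apply: vunitD.
have MG i : H`_i = 0 -> M G`_i by move=> H0; rewrite GH H0 addr0.
apply: (root_count GE); [|by move=> i /Ha/MG|exact: UG|exact: UG|by move=> i /He/MG].
by move=> i; rewrite GH; apply: vringD => //; exact/vmaxW/cong.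
Qed.

Lemma root_count2 (G : {poly algC}) (w : seq algC) (c0 x1 x3 : algC) (a e : nat) :
  G = c0 *: \prod_(z <- w) ('X - z%:P) -> pcong G (x1 *: 'X^a + x3 *: 'X^e) -> (a < e)%N ->
  U x1 -> U x3 -> count M w = a /\ count O w = e.
Proof.
move=> GE cong ae U1 U3.
have Hi i : (x1 *: 'X^a + x3 *: 'X^e)`_i = x1 *+ (i == a) + x3 *+ (i == e).
  by rewrite !coefD !coefZ !coefXn !mulr_natr.
apply: (root_count_cong GE cong).
- by move=> i; rewrite Hi; apply: vringD; apply: vringMn => //; exact: vunit_ring.
- by move=> i ia; rewrite Hi !ltn_eqF ?addr0 //; exact: ltn_trans ae.
- by rewrite Hi eqxx ltn_eqF // addr0.
- by rewrite Hi eqxx gtn_eqF // add0r.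
by move=> i ei; rewrite Hi !gtn_eqF ?addr0 //; exact: ltn_trans ei.
Qed.

Lemma root_count3 (G : {poly algC}) (w : seq algC) (c0 x1 x2 x3 : algC) (a m e : nat) :
  G = c0 *: \prod_(z <- w) ('X - z%:P) ->
  pcong G (x1 *: 'X^a + x2 *: 'X^m + x3 *: 'X^e) -> (a < m)%N -> (m < e)%N ->
  U x1 -> O x2 -> U x3 -> count M w = a /\ count O w = e.
Proof.
move=> GE cong am me U1 O2 U3; have ae := ltn_trans am me.
have Hi i : (x1 *: 'X^a + x2 *: 'X^m + x3 *: 'X^e)`_i =
    x1 *+ (i == a) + x2 *+ (i == m) + x3 *+ (i == e).
  by rewrite !coefD !coefZ !coefXn !mulr_natr.
apply: (root_count_cong GE cong).
- by move=> i; rewrite Hi; do 2?apply: vringD; apply: vringMn => //; exact: vunit_ring.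
- move=> i ia; rewrite Hi !ltn_eqF ?addr0 //; [exact: ltn_trans ae | exact: ltn_trans am].
- by rewrite Hi eqxx !ltn_eqF // !addr0.
- by rewrite Hi eqxx !gtn_eqF // !add0r.
move=> i ei; rewrite Hi !gtn_eqF ?addr0 //; [exact: ltn_trans ei | exact: ltn_trans ei].
Qed.

Lemma scale_prod (w : algC) (s : seq algC) : w != 0 ->
  (\prod_(z <- s) ('X - z%:P)) \Po (w^-1 *: 'X) =
  w ^- size s *: \prod_(z <- map ( *%R w) s) ('X - z%:P).
Proof.
move=> w0; rewrite big_map; elim: s => [|z s IH]; first by rewrite !big_nil comp_polyC invr1 scale1r.
rewrite !big_cons comp_polyM IH comp_polyB comp_polyX comp_polyC -scalerAr scalerAl /=.
rewrite [RHS]scalerAl; congr (_ * _); rewrite exprS invfM [w^-1 * _]mulrC -!scalerA; congr (_ *: _).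
by rewrite scalerBr -[_ *: (_ * _)%:P]mul_polyC -polyCM mulKf.
Qed.

Variables (k u : nat) (A B c be : algC).
Local Notation d := (2 * k + 2)%N.
Hypothesis u_gt0 : (0 < u)%N.
Hypothesis uk : (u < k)%N.
Hypothesis Bbe : B = be / q%:R.
Hypothesis Ube : U be.
Hypothesis UA2 : U (2%:R * A).
Hypothesis Ud : U d%:R.
Hypothesis U2 : U 2%:R.
Hypothesis U3 : U 3%:R.
Hypothesis Uk1 : U (2 * k).+1%:R.
Hypothesis Uku1 : U (k + u).+1%:R.
(** Weaker than the neighbouring unit conditions, because at q = p the integer k + u + 2 is p
    itself. *)
Hypothesis Oku2 : O (q%:R / (k + u).+2%:R).
Hypothesis Uu1 : U (2 * u).+1%:R.
Hypothesis Uu2 : U (2 * u).+2%:R.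
Hypothesis Uk1' : U k.+1%:R.
Hypothesis Uk2' : U k.+2%:R.
Hypothesis Uu1' : U u.+1%:R.
Hypothesis Uu2' : U u.+2%:R.
Hypothesis cE : c = I1 k u A B / I0 k u A B.
Local Notation F := (Fint k u A B c).
Local Notation h1 := ('X^k + A *: 'X^u + B%:P).

Lemma q_neq0 : q%:R != 0 :> algC. Proof. exact: vchar_neq0. Qed.
Lemma Mq : M q%:R. Proof. exact: vmax_char. Qed.
Lemma be_neq0 : be != 0. Proof. exact: vunit_neq0 Ube. Qed.
Lemma B_neq0 : B != 0. Proof. by rewrite Bbe mulf_neq0 ?be_neq0 ?invr_eq0 ?q_neq0. Qed.
Lemma OA : O A.
Proof. by rewrite -(vringM_unit _ U2) vunit_ring. Qed.

Lemma Fint_scale (s w : algC) : w != 0 -> s *: (F \Po (w^-1 *: 'X)) =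
  \sum_(t <- hsq k u A B) (((d%:R * (s * t.1 / t.2.+2%:R)) * w ^- t.2.+2) *: 'X^(t.2.+2) +
     (- (d%:R * c * (s * t.1 / t.2.+1%:R)) * w ^- t.2.+1) *: 'X^(t.2.+1)).
Proof.
move=> w0; rewrite /Fint linear_sum /= scaler_sumr; apply: eq_bigr => -[m e] _.
rewrite /Fterm /= comp_polyZ comp_polyB !comp_polyZ !comp_Xn_poly !exprZn !exprVn.
rewrite scalerA scalerBr !scalerA -scaleNr; congr (_ *: _ + _ *: _); ring.
Qed.

Lemma Fint_scale1 (s : algC) : s *: F =
  \sum_(t <- hsq k u A B) ((d%:R * (s * t.1 / t.2.+2%:R)) *: 'X^(t.2.+2) +
     (- (d%:R * c * (s * t.1 / t.2.+1%:R))) *: 'X^(t.2.+1)).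
Proof.
have := @Fint_scale s 1 (oner_neq0 _); rewrite invr1 scale1r comp_polyXr => ->.
by apply: eq_bigr => t _; rewrite !expr1n !invr1 !mulr1.
Qed.

(** This is B^-2, written so that its valuation 2 is visible. Multiplication by Q leaves only the
    constant term B^2 of the squared trinomial modulo M; valuation 2 also absorbs the denominator k
    + u + 2 when it equals q. *)
Let Q := be ^- 2 * q%:R ^+ 2.
Let OiA (x y : algC) : O x -> U y -> O (x / y).
Proof. by move=> Ox Uy; apply: vringM => //; exact: vunitVr. Qed.

Lemma QB : Q = B ^- 2.
Proof. by rewrite /Q Bbe expr_div_n invf_div mulrC. Qed.

Lemma small_terms : [/\ M (Q * 1 / (2 * k).+2%:R), M (Q * (2%:R * A) / (k + u).+2%:R),
  M (Q * A ^+ 2 / (2 * u).+2%:R), M (Q * (2%:R * B) / k.+2%:R) & M (Q * (2%:R * A * B) / u.+2%:R)] /\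
  [/\ M (Q * 1 / (2 * k).+1%:R), M (Q * (2%:R * A) / (k + u).+1%:R),
  M (Q * A ^+ 2 / (2 * u).+1%:R), M (Q * (2%:R * B) / k.+1%:R) & M (Q * (2%:R * A * B) / u.+1%:R)].
Proof.
have q0 := q_neq0; have b0 := be_neq0; have Mq := Mq; have OA := OA.
have Obe : O be^-1 by apply: vunitVr.
have OQ' : O (be ^- 2 * q%:R) by rewrite -exprVn; apply: vringM; [exact: vringX | exact: vring_nat].
have QE : Q = (be ^- 2 * q%:R) * q%:R by rewrite /Q expr2 mulrA.
have QB' : Q * B = be^-1 * q%:R by rewrite /Q Bbe; field; rewrite b0 q0.
have MQ : M Q by rewrite QE; apply: vmaxMl.
have MQB : M (Q * B) by rewrite QB'; apply: vmaxMl.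
have dv x y : M x -> U y -> M (x / y) by move=> Mx Uy; apply: vmaxMr => //; exact: vunitVr.
have Ud' : U (2 * k).+2%:R by move: Ud; rewrite addn2.
have O2 : O 2%:R by apply: vring_nat.
have O2A : O (2%:R * A) by apply: vringM.
split; split.
- by apply: dv => //; rewrite mulr1.
- have -> : Q * (2%:R * A) / (k + u).+2%:R = (2%:R * A) * (be ^- 2 * q%:R) * (q%:R / (k + u).+2%:R).
    by rewrite QE; ring.
  rewrite -mulrA; apply: vmaxMl => //; rewrite -exprVn.
  rewrite mulrAC; apply: vmaxMl => //; apply: vringM => //; exact: vringX.
- by apply: dv => //; apply: vmaxMr => //; exact: vringX.
- by apply: dv => //; rewrite mulrCA; apply: vmaxMl.
- by apply: dv => //; rewrite mulrCA; apply: vmaxMl.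
- by apply: dv => //; rewrite mulr1.
- by apply: dv => //; apply: vmaxMr.
- by apply: dv => //; apply: vmaxMr => //; exact: vringX.
- by apply: dv => //; rewrite mulrCA; apply: vmaxMl.
- by apply: dv => //; rewrite mulrCA; apply: vmaxMl.
Qed.

Lemma QBB : Q * B ^+ 2 = 1.
Proof. by rewrite QB mulVf // expf_neq0 // B_neq0. Qed.

Lemma I0_unit : I0 k u A B != 0 /\ M (Q * I0 k u A B - 1).
Proof.
have [_ [m1 m2 m3 m4 m5]] := small_terms.
have H : M (Q * I0 k u A B - 1).
  have -> : Q * I0 k u A B - 1 = Q * 1 / (2 * k).+1%:R + Q * (2%:R * A) / (k + u).+1%:R +
     Q * A ^+ 2 / (2 * u).+1%:R + Q * (2%:R * B) / k.+1%:R + Q * (2%:R * A * B) / u.+1%:R.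
    by rewrite /I0 /hsq !big_cons big_nil /= invr1 -[X in _ - X]QBB; ring.
  by do 4!(apply: vmaxD => //).
split=> //; apply: contraTneq H => ->; rewrite mulr0 sub0r.
by apply/negP => /vmaxN; rewrite opprK vmax1.
Qed.

(** The constant B^2 dominates the weight in both integrals, so c is congruent to the quotient of
    the integrals of x and of 1 over [0, 1]. *)
Lemma c_half : M (2%:R * c - 1) /\ O c.
Proof.
have [I00 MI0] := I0_unit; have [[m1 m2 m3 m4 m5] _] := small_terms.
have MI1 : M (Q * I1 k u A B - 2%:R^-1).
  have -> : Q * I1 k u A B - 2%:R^-1 = Q * 1 / (2 * k).+2%:R + Q * (2%:R * A) / (k + u).+2%:R +
     Q * A ^+ 2 / (2 * u).+2%:R + Q * (2%:R * B) / k.+2%:R + Q * (2%:R * A * B) / u.+2%:R.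
    by rewrite /I1 /hsq !big_cons big_nil /= -[X in _ - X]mul1r -[X in _ - X / _]QBB; ring.
  by do 4!(apply: vmaxD => //).
have UI0 : U (Q * I0 k u A B).
  by rewrite -[_ * _](subrK 1) addrC; apply: vunitD => //; exact: vunit1.
have Q0 : Q != 0 by rewrite QB invr_eq0 expf_neq0 // B_neq0.
have cE' : c = (Q * I1 k u A B) / (Q * I0 k u A B) by rewrite cE -mulf_div divff // mul1r.
have OQI1 : O (Q * I1 k u A B).
  by rewrite -[_ * _](subrK 2%:R^-1); apply: vringD; [exact: vmaxW | exact: vunitVr].
have Oc : O c by rewrite cE'; apply: OiA.
split=> //.
have E : (2%:R * c - 1) * (Q * I0 k u A B) = 2%:R * (Q * I1 k u A B - 2%:R^-1) - (Q * I0 k u A B - 1).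
  have n2 : 2%:R != 0 :> algC by rewrite pnatr_eq0.
  have E2 : c * (Q * I0 k u A B) = Q * I1 k u A B by rewrite cE' divfK // (vunit_neq0 UI0).
  by rewrite mulrBl -mulrA E2 mulrBr mulfV //; ring.
have : M ((2%:R * c - 1) * (Q * I0 k u A B)).
  by rewrite E; apply: vmaxB => //; apply: vmaxMl => //; exact: vring_nat.
by rewrite mulrC vmaxM_unit.
Qed.

Lemma pcong_QF : pcong (Q *: F) ((- (d%:R * c)) *: 'X^1 + (d%:R / 2%:R) *: 'X^2).
Proof.
have [[m1 m2 m3 m4 m5] [n1 n2 n3 n4 n5]] := small_terms; have [_ Oc] := c_half.
have Od : O d%:R by apply: vring_nat.
rewrite Fint_scale1 /hsq !big_cons big_nil /=.
have z (t : algC * nat) : M (Q * t.1 / t.2.+2%:R) -> M (Q * t.1 / t.2.+1%:R) ->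
  pcong ((d%:R * (Q * t.1 / t.2.+2%:R)) *: 'X^(t.2.+2) +
     (- (d%:R * c * (Q * t.1 / t.2.+1%:R))) *: 'X^(t.2.+1)) 0.
  move=> M1 M2; rewrite -[X in pcong _ X]addr0; apply: pcongD; apply: pcong_Xn0; first exact: vmaxMl.
  by apply: vmaxN; apply: vmaxMl => //; apply: vringM.
set H := (X in pcong _ X).
rewrite -[H]add0r; apply: pcongD; first exact: (z (1, (2 * k)%N)).
rewrite -[H]add0r; apply: pcongD; first exact: (z (2%:R * A, (k + u)%N)).
rewrite -[H]add0r; apply: pcongD; first exact: (z (A ^+ 2, (2 * u)%N)).
rewrite -[H]add0r; apply: pcongD; first exact: (z (2%:R * B, k)).
rewrite -[H]add0r; apply: pcongD; first exact: (z (2%:R * A * B, u)).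
rewrite addr0 QBB addrC divr1 mulr1 mul1r; exact: pcong_refl.
Qed.

Lemma c_unit : U c.
Proof.
have [Mc Oc] := c_half; rewrite -(vunitMr _ U2) -[_ * c](subrK 1) addrC.
by apply: vunitD => //; exact: vunit1.
Qed.

Lemma QF_vring i : O (Q *: F)`_i.
Proof.
have [_ Oc] := c_half.
rewrite -[(Q *: F)`_i](subrK ((- (d%:R * c)) *: 'X^1 + (d%:R / 2%:R) *: 'X^2)`_i) -coefB.
apply: vringD; first exact/vmaxW/pcong_QF.
have Od : O d%:R by exact: vring_nat.
rewrite coefD !coefZ !coefXn; apply: vringD; apply: vringM; try exact: vring_nat.
  by apply: vringN; apply: vringM.
exact: OiA.
Qed.

(** F vanishes at 1 and its derivative there has valuation exactly -2. Consequently g - 1 is, near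
    1, multiplication of x - 1 by a factor of constant size. *)
Lemma near1 x : M (x - 1) -> exists2 e, U e & x - 1 = e * (F.[x] * q%:R ^+ 2).
Proof.
move=> Mx; have [Mc Oc] := c_half.
have [W [WO W0 WE]] := @taylor_vring _ V (Q *: F) 1 1 QF_vring (vring1 V).
have F1 : F.[1] = 0 by rewrite cE Fint_at1 //; have [] := I0_unit.
have := WE (x - 1); rewrite addrC subrK big_ord1 nderivn0 !hornerZ F1 mulr0 mul0r add0r expr1 => E.
have UW0 : U W`_0.
  rewrite W0 nderivn1 derivZ hornerZ.
  have dc := @pcong_horner (Q *: F)^`() ((- (d%:R * c)) *: 'X^1 + (d%:R / 2%:R) *: 'X^2)^`() 1 _ (vring1 V).
  have : M ((Q *: F)^`().[1] - ((- (d%:R * c)) *: 'X^1 + (d%:R / 2%:R) *: 'X^2)^`().[1]).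
    apply: dc => i; rewrite -derivB coef_deriv -[_ *+ i.+1]mulr_natr.
    by apply: vmaxMr; [exact: (pcong_QF _) | exact: vring_nat].
  rewrite derivZ hornerZ vmax_sym => H; apply: vunit_eqmax H.
  rewrite derivD !derivZ !derivXn hornerD !hornerZ !hornerMn !hornerXn !expr1n mulr1n.
  have n2 : 2%:R != 0 :> algC by rewrite pnatr_eq0.
  have -> : - (d%:R * c) * 1 + d%:R / 2%:R * 2%:R = d%:R * (1 - c) by rewrite divfK //; ring.
  apply: vunitM => //; rewrite -(vunitMr _ U2).
  have -> : 2%:R * (1 - c) = 1 + (- (2%:R * c - 1)) by ring.
  by apply: vunitD; [exact: vunit1 | exact: vmaxN].
have UW : U W.[x - 1].
  apply: (@vunit_eqmax _ V W.[0]); first by rewrite horner_coef0.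
  by apply: vmax_horner => //; [exact: vring0 | exact: vmaxW | rewrite sub0r vmaxN].
exists (be ^- 2 / W.[x - 1]).
  by apply: vunitM; [rewrite -exprVn; apply/vunitX/vunitV | exact: vunitV].
apply: (mulIf (vunit_neq0 UW)); rewrite -E /Q.
have := vunit_neq0 UW; have := be_neq0 => b0 W1; field; by rewrite b0 W1.
Qed.

Lemma F_coef_vring i : O (q%:R ^+ 2 * F`_i).
Proof.
have := QF_vring i; rewrite coefZ => H.
have -> : q%:R ^+ 2 * F`_i = be ^+ 2 * (Q * F`_i).
  by rewrite /Q !mulrA mulfV ?mul1r // expf_neq0 // be_neq0.
by apply: vringM => //; apply/vringX/vunit_ring.
Qed.

(** F is close to d B^2 (y^2 / 2 - c y), whose value at y = c is -d B^2 c^2 / 2, with c congruent to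
    1/2. *)
Lemma F_at_c : M (F.[c] / B ^+ 2 + d%:R / 8%:R).
Proof.
have [Mc Oc] := c_half; have := pcong_horner pcong_QF Oc.
rewrite hornerD !hornerZ !hornerXn QB [_ ^- 2 * _]mulrC => H.
have n2 : 2%:R != 0 :> algC by rewrite pnatr_eq0.
have n8 : 8%:R != 0 :> algC by rewrite pnatr_eq0.
have -> : F.[c] / B ^+ 2 + d%:R / 8%:R = (F.[c] / B ^+ 2 - (- (d%:R * c) * c ^+ 1 + d%:R / 2%:R * c ^+ 2)) -
   d%:R / 8%:R * (2%:R * c + 1) * (2%:R * c - 1).
  by rewrite expr1; move: (F.[c] / B ^+ 2) => t; field.
apply: vmaxB => //; apply: vmaxMl => //.
have O2 : O 2%:R by exact: vring_nat.
apply: vringM; last by apply: vringD; [exact: vringM | exact: vring1].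
apply: OiA; first exact: vring_nat.
by rewrite (_ : 8%:R = 2%:R * 2%:R * 2%:R); [do 2!apply: vunitM => // | ring].
Qed.

Section Fiber.

Variables (ep : algC) (s : seq algC).
Hypothesis Mep : M ep.
Hypothesis Fs : F - ep%:P = \prod_(z <- s) ('X - z%:P).

Lemma Q_ring : O Q.
Proof. by rewrite /Q -exprVn; apply: vringM; [apply/vringX/vunitVr | apply/vringX/vring_nat]. Qed.

Lemma root_fiber z : (z \in s) = (F.[z] == ep).
Proof. by rewrite -root_prod_XsubC -Fs /root !hornerE subr_eq0. Qed.

(** Up to a unit, Q (F - ep) reduces to y (y - 1): one root near 0, one near 1, and all the others
    nonintegral. *)
Lemma fiber_count0 : count M s = 1%N /\ count O s = 2%N.
Proof.
have [_ Oc] := c_half.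
apply: (@root_count2 (Q *: (F - ep%:P)) s Q (- (d%:R * c)) (d%:R / 2%:R)) => //.
- by rewrite Fs.
- rewrite scalerBr -[X in pcong _ X]addr0; apply: pcongD; first exact: pcong_QF.
  have -> : - (Q *: ep%:P) = (- (Q * ep)) *: 'X^0 by rewrite -mul_polyC -polyCM -polyCN alg_polyC.
  by apply: pcong_Xn0; apply: vmaxN; apply: vmaxMl => //; exact: Q_ring.
- by apply: vunitN; apply: vunitM => //; exact: c_unit.
by apply: vunitM => //; exact: vunitV.
Qed.

Lemma fiber_cases z : z \in s -> [\/ M z, M (z - 1) | ~~ O z].
Proof.
move=> zs; case Oz: (O z); last by constructor 3.
have [Uz|Mz] := vring_case Oz; last by constructor 1.
constructor 2.
have [Mc Oc] := c_half.
have := pcong_horner pcong_QF Oz; move: zs; rewrite root_fiber hornerZ => /eqP ->.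
rewrite hornerD !hornerZ !hornerXn => H.
have n2 : 2%:R != 0 :> algC by rewrite pnatr_eq0.
have H2 : M (d%:R * z * (z - 2%:R * c)).
  have -> : d%:R * z * (z - 2%:R * c) = 2%:R * (Q * ep) -
      2%:R * (Q * ep - (- (d%:R * c) * z ^+ 1 + d%:R / 2%:R * z ^+ 2)) by field.
  apply: vmaxB; apply: vmaxMl => //; try exact: vring_nat.
  by apply: vmaxMl => //; exact: Q_ring.
have {}H2 : M (z - 2%:R * c) by rewrite -(vmaxM_unit _ (vunitM Ud Uz)).
exact: vmax_trans H2 Mc.
Qed.

Lemma fiber_ex1 : exists2 z, z \in s & M (z - 1).
Proof.
have [cM cO] := fiber_count0.
have /hasP[z zs /andP[Oz nM]] : has (fun z => O z && ~~ M z) s.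
  rewrite has_count; have : (count O s = count M s + count (fun z => O z && ~~ M z) s)%N.
    elim: (s) => //= z l ->; case Mz: (M z); first by rewrite (vmaxW Mz) /= add0n addnA.
    by rewrite andbT add0n addnCA.
  by rewrite cM cO; case: (count _ _).
by case: (fiber_cases zs) => [Mz|Mz|nO]; [rewrite Mz in nM | exists z | rewrite Oz in nO].
Qed.

Lemma near1_unit z : M (z - 1) -> U z.
Proof.
by move=> Mz; apply: (@vunit_eqmax _ V 1); [exact: vunit1 | rewrite vmax_sym].
Qed.

Lemma fiber_uniq1 z z' : uniq s -> z \in s -> z' \in s -> M (z - 1) -> M (z' - 1) -> z = z'.
Proof.
move=> us zs z's Mz Mz'; have [cM cO] := fiber_count0.
apply/eqP; apply: contraT => zz'.
have /hasP[y ys My] : has M s by rewrite has_count cM.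
have : (size [:: y; z; z'] <= size [seq x <- s | O x])%N.
  apply: uniq_leq_size.
    have yn x : M (x - 1) -> y != x.
      by move=> /near1_unit/vunit_nmax nM; apply: contraTneq My => ->; rewrite nM.
    by rewrite /= !inE !negb_or !yn // zz'.
  move=> x; rewrite !inE mem_filter => /or3P[]/eqP ->; rewrite ?ys ?zs ?z's andbT.
  - exact: vmaxW.
  - exact/vunit_ring/near1_unit.
  exact/vunit_ring/near1_unit.
by rewrite size_filter cO.
Qed.

Lemma fiber_scaled (w sc : algC) : w != 0 -> sc *: ((F - ep%:P) \Po (w^-1 *: 'X)) =
  (sc * w ^- size s) *: \prod_(z <- map ( *%R w) s) ('X - z%:P).
Proof. by move=> w0; rewrite Fs scale_prod // scalerA. Qed.

End Fiber.

Section Scaled.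

Variables (ep w sc : algC) (s : seq algC).
Hypothesis Fs : F - ep%:P = \prod_(z <- s) ('X - z%:P).
Hypothesis w0 : w != 0.
Hypothesis Mw : M w.
Hypothesis Mep : M (sc * ep).
Local Notation Gs := (sc *: ((F - ep%:P) \Po (w^-1 *: 'X))).

(** What the entry (m, e) of [hsq] contributes to sc F(X / w). If sc m is an integral factor times
    w^N, the contribution disappears modulo M for N > e + 2 and reduces to its upper monomial for N
    = e + 2. *)
Let tm (m : algC) (e : nat) := ((d%:R * (sc * m / e.+2%:R)) * w ^- e.+2) *: 'X^(e.+2) +
     (- (d%:R * c * (sc * m / e.+1%:R)) * w ^- e.+1) *: 'X^(e.+1).

Let tm_co x mu n N : x = mu * w ^+ N -> (n <= N)%N -> x * w ^- n = mu * w ^+ (N - n).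
Proof. by move=> -> le; rewrite -{1}(subnK le) exprD -!mulrA mulfV ?expf_neq0 // mulr1. Qed.

Lemma tm_gen m e mu2 mu1 N2 N1 : sc * m / e.+2%:R = mu2 * w ^+ N2 ->
  sc * m / e.+1%:R = mu1 * w ^+ N1 -> O mu1 -> (e.+2 <= N2)%N -> (e.+1 < N1)%N ->
  pcong (tm m e) ((d%:R * (mu2 * w ^+ (N2 - e.+2))) *: 'X^(e.+2)).
Proof.
move=> E2 E1 O1 le2 lt1; have [_ Oc] := c_half; rewrite /tm.
rewrite -[X in X *: 'X^(e.+2)]mulrA (tm_co E2 le2) -[X in pcong _ X]addr0.
apply: pcongD; first exact: pcong_refl.
apply: pcong_Xn0; rewrite mulNr -[d%:R * c * _ * _]mulrA (tm_co E1 (ltnW lt1)); apply: vmaxN.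
apply: vmaxMl; first by apply: vringM => //; exact: vring_nat.
by apply: vmaxMl => //; apply: vmaxX => //; rewrite subn_gt0.
Qed.

Lemma tm_lead2 m e mu2 mu1 N1 : sc * m / e.+2%:R = mu2 * w ^+ e.+2 ->
  sc * m / e.+1%:R = mu1 * w ^+ N1 -> O mu1 -> (e.+1 < N1)%N ->
  pcong (tm m e) ((d%:R * mu2) *: 'X^(e.+2)).
Proof. by move=> E2 E1 O1 lt1; have := tm_gen E2 E1 O1 (leqnn _) lt1; rewrite subnn mulr1. Qed.

Lemma tm_lead m e mu : sc * m = mu * w ^+ e.+2 -> O (mu / e.+1%:R) ->
  pcong (tm m e) ((d%:R * (mu / e.+2%:R)) *: 'X^(e.+2)).
Proof. by move=> E O1; apply: (tm_lead2 (mu1 := mu / e.+1%:R) (N1 := e.+2)) => //; rewrite E mulrAC. Qed.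

Lemma tm_small m e mu N : sc * m = mu * w ^+ N -> O (mu / e.+2%:R) -> O (mu / e.+1%:R) ->
  (e.+2 < N)%N -> pcong (tm m e) 0.
Proof.
move=> E O2 O1 lt.
have E2 : sc * m / e.+2%:R = mu / e.+2%:R * w ^+ N by rewrite E mulrAC.
have E1 : sc * m / e.+1%:R = mu / e.+1%:R * w ^+ N by rewrite E mulrAC.
have := tm_gen E2 E1 O1 (ltnW lt) (ltn_trans (ltnSn _) lt) => H i.
rewrite -[tm m e - 0](subrK ((d%:R * (mu / e.+2%:R * w ^+ (N - e.+2))) *: 'X^(e.+2))) subr0 coefD.
apply: vmaxD => //; rewrite -[_ *: _]subr0; apply: pcong_Xn0.
apply: vmaxMl; first exact: vring_nat.
by apply: vmaxMl => //; apply: vmaxX => //; rewrite subn_gt0.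
Qed.

Lemma Gs_cong H1 H2 H3 H4 H5 H6 : pcong (tm 1 (2 * k)) H1 -> pcong (tm (2%:R * A) (k + u)) H2 ->
  pcong (tm (A ^+ 2) (2 * u)) H3 -> pcong (tm (2%:R * B) k) H4 -> pcong (tm (2%:R * A * B) u) H5 ->
  pcong (tm (B ^+ 2) 0) H6 -> pcong Gs (H1 + (H2 + (H3 + (H4 + (H5 + H6))))).
Proof.
move=> c1 c2 c3 c4 c5 c6; rewrite comp_polyB comp_polyC scalerBr Fint_scale // /hsq !big_cons big_nil /= addr0.
rewrite -[X in pcong _ X]addr0; apply: pcongD; last first.
  have -> : - (sc *: ep%:P) = (- (sc * ep)) *: 'X^0 by rewrite -mul_polyC -polyCM -polyCN alg_polyC.
  by apply: pcong_Xn0; apply: vmaxN.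
by do 5!(apply: pcongD => //).
Qed.

End Scaled.


Let Ud' : U (2 * k).+2%:R. Proof. by move: Ud; rewrite addn2. Qed.
Let Odu (x : algC) : U x -> U (d%:R * x). Proof. exact: vunitM. Qed.

(** The polygon at r beyond the integral roots: the points (2, -2), (k + 2, -1), (2k + 2, 0) are
    collinear and nothing lies below them, so 2k roots have valuation -1/k. *)
Lemma fiber_scale_k ep (s : seq algC) (w z : algC) : F - ep%:P = \prod_(z <- s) ('X - z%:P) -> M ep ->
  U (k + u).+2%:R -> w ^+ k = q%:R -> z \in s -> ~~ O z -> U (z ^+ k * q%:R).
Proof.
move=> Fs Mep Uku2 wk zs nO.
have k0 : (0 < k)%N by apply: leq_ltn_trans uk.
have Mw : M w by apply: (@vmaxX_inv _ V w k); rewrite wk Mq.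
have w0 : w != 0 by apply: contraNneq q_neq0 => w0; rewrite -wk w0 expr0n gtn_eqF.
have Ow := vmaxW Mw; have Obe := vunit_ring Ube; have OA := OA; have O2 : O 2%:R by apply: vring_nat.
have O2A := vunit_ring UA2.
have wk0 : w ^+ k != 0 by rewrite expf_neq0.
have wd : w ^+ d = w ^+ k * w ^+ k * w ^+ 2 by rewrite -!exprD; congr (w ^+ _); clear; lia.
have wk2 : w ^+ k.+2 = w ^+ k * w ^+ 2 by rewrite -exprD addn2.
have Msc : M (w ^+ d * ep) by apply: vmaxMl => //; exact: vringX.
have cong : pcong (w ^+ d *: ((F - ep%:P) \Po (w^-1 *: 'X)))
   ((d%:R * (be ^+ 2 / 2%:R)) *: 'X^2 + (d%:R * (2%:R * be / k.+2%:R)) *: 'X^(k.+2) +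
    (d%:R * (1 / (2 * k).+2%:R)) *: 'X^((2 * k).+2)).
  set H := (X in pcong _ X).
  have -> : H = (d%:R * (1 / (2 * k).+2%:R)) *: 'X^((2 * k).+2) + (0 + (0 +
    ((d%:R * (2%:R * be / k.+2%:R)) *: 'X^(k.+2) + (0 + (d%:R * (be ^+ 2 / 2%:R)) *: 'X^2)))).
    by rewrite /H; ring.
  apply: Gs_cong => //.
  - apply: tm_lead => //; first by rewrite mulr1 mul1r addn2.
    by apply: OiA => //; exact: vring1.
  - apply: (@tm_small _ _ w0 Mw _ _ (2%:R * A) d).
    + by rewrite mulrC.
    + exact: OiA.
    + exact: OiA.
    by clear - uk; lia.
  - apply: (@tm_small _ _ w0 Mw _ _ (A ^+ 2) d).
    + by rewrite mulrC.
    + by apply: OiA => //; exact: vringX.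
    + by apply: OiA => //; exact: vringX.
    by clear - uk; lia.
  - apply: tm_lead => //; last by apply: OiA => //; exact: vringM.
    by rewrite wd wk2 Bbe -wk; field.
  - apply: (@tm_small _ _ w0 Mw _ _ (2%:R * A * be) k.+2).
    + by rewrite wd wk2 Bbe -wk; field.
    + by apply: OiA => //; exact: vringM.
    + by apply: OiA => //; exact: vringM.
    by clear - uk; lia.
  apply: tm_lead => //; last by rewrite divr1; exact: vringX.
  by rewrite wd Bbe -wk; field.
rewrite (fiber_scaled Fs) // in cong.
have [|||||cM cO] := root_count3 (erefl _) cong.
- by [].
- by clear - uk; lia.
- by apply: Odu; apply: vunitM; [exact: vunitX | exact: vunitV].
- by apply: vringM; [exact: vring_nat | apply: OiA => //; exact: vringM].
- by apply: Odu; apply: vunitM; [exact: vunit1 | exact: vunitV].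
have [_ cO0] := fiber_count0 Mep Fs.
have szs : size s = (2 * k).+2.
  have [szF _] := lead_Fint A B c uk u_gt0.
  have := congr1 (fun P : {poly algC} => size P) Fs; rewrite /= size_prod_XsubC size_polyDl szF.
    by rewrite addn3 => -[].
  by rewrite size_polyN addn3; apply: leq_ltn_trans (size_polyC_leq1 _) _.
rewrite count_map in cM.
have Owz : O (w * z).
  have /allP : all O (map ( *%R w) s) by rewrite all_count cO size_map szs.
  by apply; apply/mapP; exists z.
have nM : ~~ M (w * z).
  apply: contra nO => Mz; apply: (@count_sub_eq _ O (preim ( *%R w) M) s) => //; last by rewrite cO0 cM.
  by move=> x Ox; apply: vmaxMr.
by rewrite -wk mulrC -exprMn; apply: vunitX; rewrite /vunit Owz.
Qed.

Section FiberP.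

Hypothesis qE : q = (k + u).+2.
Hypothesis dA : d%:R * (2%:R * A) = 1.

(** At p the coefficient of degree k + u + 2 = p has valuation -1, and its point lies strictly below
    the line from (2, -2) to (2k + 2, 0). The first edge, of width k + u and height 1, gives the k +
    u intermediate roots. *)
Lemma fiber_mid ep (s : seq algC) (w : algC) : F - ep%:P = \prod_(z <- s) ('X - z%:P) -> M ep ->
  w ^+ (k + u) = q%:R ->
  count (fun z => M (w * z)) s = 2%N /\ count (fun z => O (w * z)) s = (k + u).+2.
Proof.
move=> Fs Mep wk.
have ku0 : (0 < k + u)%N by rewrite addn_gt0 u_gt0 orbT.
have Mw : M w by apply: (@vmaxX_inv _ V w (k + u)); rewrite wk Mq.
have w0 : w != 0 by apply: contraNneq q_neq0 => w0; rewrite -wk w0 expr0n gtn_eqF.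
have Ow := vmaxW Mw; have Obe := vunit_ring Ube; have OA := OA; have O2 : O 2%:R by apply: vring_nat.
have O2A := vunit_ring UA2; have b0 := be_neq0.
have Obi : O be^-1 by apply: vunitVr.
have Obi2 : O (be ^- 2) by rewrite -exprVn; exact: vringX.
have wk0 : w ^+ (k + u) != 0 by rewrite expf_neq0.
pose W := w ^+ (k + u).
have W0 : W != 0 by [].
have w2d : w ^+ ((k + u) + (k + u) + 2) = W * W * w ^+ 2 by rewrite [LHS]exprD [X in X * _]exprD.
have w1d : w ^+ ((k + u) + 2) = W * w ^+ 2 by rewrite [LHS]exprD.
(* Chosen so that sc B^2 = w^2, which makes the monomial of degree 2 survive with coefficient
   d/2. *)
pose sc := be ^- 2 * W ^+ 2 * w ^+ 2.
have Msc : M (sc * ep).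
  by apply: vmaxMl => //; apply: vringM; [apply: vringM => //|]; do ?apply: vringX.
have BW : B = be / W by rewrite Bbe -wk.
have qW : (k + u).+2%:R = W by rewrite -qE -wk.
have cong : pcong (sc *: ((F - ep%:P) \Po (w^-1 *: 'X)))
   ((d%:R * (1 / 2%:R)) *: 'X^2 + (d%:R * (2%:R * A * be ^- 2)) *: 'X^((k + u).+2)).
  set H := (X in pcong _ X).
  have -> : H = 0 + ((d%:R * (2%:R * A * be ^- 2)) *: 'X^((k + u).+2) + (0 + (0 + (0 +
     (d%:R * (1 / 2%:R)) *: 'X^2)))) by rewrite /H; ring.
  apply: Gs_cong => //.
  - apply: (@tm_small _ _ w0 Mw _ _ (be ^- 2) (k + u + (k + u) + 2)).
    + by rewrite w2d /sc; ring.
    + exact: OiA.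
    + exact: OiA.
    by clear - uk u_gt0; lia.
  - apply: (@tm_lead2 _ _ w0 Mw _ _ _ (2%:R * A * be ^- 2 / (k + u).+1%:R) (k + u + (k + u) + 2)).
    + by rewrite qW -[(k + u).+2]addn2 w1d /sc; field; rewrite ?b0 ?W0.
    + by rewrite w2d /sc; ring.
    + by apply: OiA => //; apply: vringM.
    by clear - u_gt0; lia.
  - apply: (@tm_small _ _ w0 Mw _ _ (A ^+ 2 * be ^- 2) (k + u + (k + u) + 2)).
    + by rewrite w2d /sc; ring.
    + by apply: OiA => //; apply: vringM => //; exact: vringX.
    + by apply: OiA => //; apply: vringM => //; exact: vringX.
    by clear - uk u_gt0; lia.
  - apply: (@tm_small _ _ w0 Mw _ _ (2%:R * be^-1) (k + u + 2)).
    + by rewrite w1d /sc BW; field; rewrite b0.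
    + by apply: OiA => //; apply: vringM.
    + by apply: OiA => //; apply: vringM.
    by clear - uk u_gt0; lia.
  - apply: (@tm_small _ _ w0 Mw _ _ (2%:R * A * be^-1) (k + u + 2)).
    + by rewrite w1d /sc BW; field; rewrite b0.
    + by apply: OiA => //; apply: vringM.
    + by apply: OiA => //; apply: vringM.
    by clear - uk u_gt0; lia.
  apply: tm_lead => //; last by rewrite !divr1; exact: vring1.
  by rewrite /sc BW; field; rewrite ?b0 ?W0.
rewrite (fiber_scaled Fs) // in cong.
have [|||cM cO] := root_count2 (erefl _) cong.
- by clear - u_gt0; lia.
- by apply: Odu; apply: vunitM; [exact: vunit1 | exact: vunitV].
- by apply: Odu; apply: vunitM => //; rewrite -exprVn; apply/vunitX/vunitV.
by rewrite -cM -cO !count_map.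
Qed.

(** The second edge of the polygon at p, of width k - u. With d 2A = 1 both end coefficients become
    1, so (w z)^(k-u) is congruent to -1 on the largest roots; [phip] relies on this exact value. *)
Lemma fiber_large ep (s : seq algC) (w : algC) : F - ep%:P = \prod_(z <- s) ('X - z%:P) -> M ep ->
  w ^+ (k - u) = q%:R ->
  [/\ count (fun z => M (w * z)) s = (k + u).+2, count (fun z => O (w * z)) s = (2 * k).+2 &
   forall z, z \in s -> U (w * z) -> M (z ^+ (k - u) * q%:R + 1)].
Proof.
move=> Fs Mep wk.
have ku0 : (0 < k - u)%N by rewrite subn_gt0.
have Mw : M w by apply: (@vmaxX_inv _ V w (k - u)); rewrite wk Mq.
have w0 : w != 0 by apply: contraNneq q_neq0 => w0; rewrite -wk w0 expr0n gtn_eqF.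
have Ow := vmaxW Mw; have Obe := vunit_ring Ube; have OA := OA; have O2 : O 2%:R by apply: vring_nat.
have O2A := vunit_ring UA2; have b0 := be_neq0.
have wk0 : w ^+ (k - u) != 0 by rewrite expf_neq0.
pose W := w ^+ (k - u).
have W0 : W != 0 by [].
have wd : w ^+ d = W * w ^+ (k + u).+2 by rewrite -exprD; congr (w ^+ _); clear - uk; lia.
have wd2 : w ^+ d = W * W * w ^+ (2 * u).+2 by rewrite -!exprD; congr (w ^+ _); clear - uk; lia.
have Msc : M (w ^+ d * ep) by apply: vmaxMl => //; exact: vringX.
have BW : B = be / W by rewrite Bbe -wk.
have qW : (k + u).+2%:R = W by rewrite -qE -wk.
have cong : pcong (w ^+ d *: ((F - ep%:P) \Po (w^-1 *: 'X)))
   ((d%:R * (2%:R * A)) *: 'X^((k + u).+2) + (d%:R * (1 / (2 * k).+2%:R)) *: 'X^((2 * k).+2)).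
  set H := (X in pcong _ X).
  have -> : H = (d%:R * (1 / (2 * k).+2%:R)) *: 'X^((2 * k).+2) +
     ((d%:R * (2%:R * A)) *: 'X^((k + u).+2) + (0 + (0 + (0 + 0)))) by rewrite /H; ring.
  apply: Gs_cong => //.
  - apply: tm_lead => //; first by rewrite mulr1 mul1r addn2.
    by apply: OiA => //; exact: vring1.
  - apply: (@tm_lead2 _ _ w0 Mw _ _ _ (2%:R * A / (k + u).+1%:R) d).
    + by rewrite qW wd; field.
    + by ring.
    + exact: OiA.
    by clear - uk u_gt0; lia.
  - apply: (@tm_small _ _ w0 Mw _ _ (A ^+ 2) d).
    + by rewrite mulrC.
    + by apply: OiA => //; exact: vringX.
    + by apply: OiA => //; exact: vringX.
    by clear - uk u_gt0; lia.
  - apply: (@tm_small _ _ w0 Mw _ _ (2%:R * be) (k + u).+2).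
    + by rewrite wd BW; field.
    + by apply: OiA => //; apply: vringM.
    + by apply: OiA => //; apply: vringM.
    by clear - uk u_gt0; lia.
  - apply: (@tm_small _ _ w0 Mw _ _ (2%:R * A * be) (k + u).+2).
    + by rewrite wd BW; field.
    + by apply: OiA => //; apply: vringM.
    + by apply: OiA => //; apply: vringM.
    by clear - uk u_gt0; lia.
  apply: (@tm_small _ _ w0 Mw _ _ (be ^+ 2) (2 * u).+2).
  - by rewrite wd2 BW; field.
  - by apply: OiA => //; exact: vringX.
  - by rewrite divr1; exact: vringX.
  by clear - u_gt0; lia.
have cong' := cong; rewrite (fiber_scaled Fs) // in cong.
have [|||cM cO] := root_count2 (erefl _) cong.
- by clear - uk; lia.
- by rewrite dA; exact: vunit1.
- by apply: Odu; apply: vunitM; [exact: vunit1 | exact: vunitV].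
split; [by rewrite -cM count_map | by rewrite -cO count_map |].
move=> z zs Uz; have := pcong_horner cong' (vunit_ring Uz).
rewrite Fs hornerZ horner_comp hornerZ hornerX mulKf //.
have -> : (\prod_(z0 <- s) ('X - z0%:P)).[z] = 0 by apply/eqP; rewrite -/(root _ _) root_prod_XsubC.
rewrite mulr0 sub0r dA addn2 div1r mulfV ?(vunit_neq0 Ud') // !scale1r hornerD !hornerXn => /vmaxN.
rewrite opprK (_ : (2 * k).+2 = (k - u) + (k + u).+2)%N; last by clear - uk; lia.
rewrite exprD -{1}[(w * z) ^+ (k + u).+2]mul1r -mulrDl mulrC vmaxM_unit; last exact: vunitX.
by rewrite addrC exprMn wk mulrC.
Qed.

End FiberP.

End LocalFiber.

(** * Sibling blocks *)

Lemma class_dvd (T : eqType) (R : rel T) (b : nat) (s : seq T) :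
  {in s, forall x, R x x} -> {in s & &, forall x y z, R x y -> R y z -> R x z} ->
  {in s &, forall x y, R x y -> R y x} -> {in s, forall x, count (R x) s = b} -> (b %| size s)%N.
Proof.
move: {2}(size s).+1 (ltnSn (size s)) => N.
elim: N s => // N IH s ltN Rr Rt Rs Rb; case: s ltN Rr Rt Rs Rb => // x s ltN Rr Rt Rs Rb.
pose s' := [seq y <- x :: s | ~~ R x y].
have xs := mem_head x s.
have sE : size (x :: s) = (b + size s')%N.
  by rewrite size_filter -(Rb x xs) -(count_predC (R x)).
rewrite sE dvdn_addr //; apply: IH.
- apply: leq_trans (_ : size s' < size (x :: s))%N _; last by rewrite -ltnS.
  by rewrite /s' /= Rr //= ltnS size_filter count_size.
- by move=> y; rewrite mem_filter => /andP[_ ys]; apply: Rr.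
- by move=> y z t; rewrite !mem_filter => /andP[_ ys] /andP[_ zs] /andP[_ ts]; apply: Rt.
- by move=> y z; rewrite !mem_filter => /andP[_ ys] /andP[_ zs]; apply: Rs.
move=> y; rewrite mem_filter => /andP[nxy ys]; rewrite -(Rb y ys) /s' count_filter.
apply: eq_in_count => z zs /=; case Ryz: (R y z) => //=.
by apply: contra nxy => Rxz; apply: (Rt x z y) => //; apply: Rs.
Qed.

Section Isolated.

Variables (q : nat) (V : place q).
Hypothesis q_pr : prime q.
Local Notation O := (vring V).
Local Notation M := (vmax V).
Local Notation U := (vunit V).

Variables (G F : {poly algC}) (T : algC) (fib : algC -> seq algC).
Local Notation g := (horner G).
Local Notation Lev := (Lev fib).
Hypothesis GE : G = 1 + T *: F.
Hypothesis T0 : T != 0.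
Hypothesis MT : M T^-1.
Hypothesis G1 : G.[1] = 1.
Hypothesis fibE : forall a, F - ((a - 1) / T)%:P = \prod_(y <- fib a) ('X - y%:P).
Hypothesis mem_fib : forall a y, (y \in fib a) = (G.[y] == a).
Hypothesis uniq_fib : forall m a, a \in Lev m -> uniq (fib a).
Hypothesis loc_near : forall x, M (x - 1) -> exists2 e, U e & x - 1 = e * (F.[x] * q%:R ^+ 2).
Hypothesis loc_ex : forall ep s, M ep -> F - ep%:P = \prod_(z <- s) ('X - z%:P) ->
  exists2 z, z \in s & M (z - 1).
Hypothesis loc_uniq : forall ep s, M ep -> F - ep%:P = \prod_(z <- s) ('X - z%:P) ->
  forall z z', uniq s -> z \in s -> z' \in s -> M (z - 1) -> M (z' - 1) -> z = z'.

Lemma Lev_neq1 m x : x \in Lev m -> x != 1.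
Proof.
rewrite (mem_Lev mem_fib); apply: contraTneq => ->.
have -> : iter m g 1 = 1 by elim: m => //= m ->.
exact: oner_neq0.
Qed.

Lemma F_horner x : F.[x] = (G.[x] - 1) / T.
Proof. by rewrite GE hornerD hornerC hornerZ addrC addKr mulrC mulKf. Qed.

(** Besides being strictly closest to 1, xs satisfies the condition under which the analysis of its
    fiber applies, since F takes the value (xs - 1) / T on that fiber. *)
Definition isolated m xs := [/\ xs \in Lev m, M ((xs - 1) / T) &
  forall x, x \in Lev m -> x != xs -> M ((xs - 1) / (x - 1))].

(** By [near1], g multiplies distances to 1 by a constant on the residue class of 1, so the ratios
    of level m are inherited there. Points in other classes are farther away, and the fiber of xs
    has only one point near 1. *)
Lemma isolatedS m xs : isolated m xs -> exists2 xs', isolated m.+1 xs' & g xs' = xs /\ M (xs' - 1).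
Proof.
move=> [xsL Mxs iso]; have [xs' xs'f Mxs'] := loc_ex Mxs (fibE xs).
have gx : g xs' = xs by apply/eqP; rewrite -mem_fib.
exists xs' => //; split; first by rewrite (mem_LevS mem_fib) gx.
  exact: vmaxMl (vmaxW Mxs') MT.
move=> x xL xx'; have gL : g x \in Lev m by rewrite -(mem_LevS mem_fib).
have x1 := Lev_neq1 xL; have gx1 := Lev_neq1 gL.
have [Mx|nMx] := boolP (M (x - 1)); last first.
  apply: vmaxMr => //; case Ox: (O (x - 1)); last by apply/vmaxW/vring_total; rewrite Ox.
  by apply: vunitVr; rewrite /vunit Ox.
have [gxs|ngx] := eqVneq (g x) xs.
  have xf : x \in fib xs by rewrite mem_fib gxs.
  by rewrite (loc_uniq Mxs (fibE xs) (uniq_fib xsL) xf xs'f Mx Mxs') eqxx in xx'.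
have [e Ue E] := loc_near Mx; have [e' Ue' E'] := loc_near Mxs'.
have Mg := iso _ gL ngx.
have -> : (xs' - 1) / (x - 1) = (e' / e) * ((xs - 1) / (g x - 1)).
  rewrite E E' !F_horner gx; have e0 := vunit_neq0 Ue; have q0 : q%:R != 0 :> algC by exact: vchar_neq0.
  have g0 : g x - 1 != 0 by rewrite subr_eq0.
  by field; rewrite T0 e0 q0 g0.
apply: vmaxMl => //; apply: vunit_ring; apply: vunitM => //; exact: vunitV.
Qed.

Lemma isolated_ex m : exists2 xs, isolated m.+1 xs & M ((g xs - 1) / T) /\ M (xs - 1).
Proof.
have [xs iso] : exists xs, isolated m xs.
  elim: m => [|m [xs /isolatedS[xs' iso' _]]]; last by exists xs'.
  exists 0; split; first by rewrite inE.
    by rewrite sub0r mulNr mul1r; apply: vmaxN.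
  by move=> x; rewrite inE => /eqP ->; rewrite eqxx.
have [xs' iso' [gx Mx]] := isolatedS iso; exists xs' => //; rewrite gx; split=> //.
by have [] := iso.
Qed.

End Isolated.

Section Block.

Variables (G : {poly algC}) (fib : algC -> seq algC) (d n : nat).
Local Notation g := (horner G).
Local Notation Lev := (Lev fib).
Hypothesis g_aut : forall (nu : autC) x, nu G.[x] = G.[nu x].
Hypothesis mem_fib : forall a y, (y \in fib a) = (G.[y] == a).
Hypothesis size_fib : forall a, size (fib a) = d.
Hypothesis uniq_Lev : forall m, uniq (Lev m).
Hypothesis trans_Lev : forall m x y, x \in Lev m -> y \in Lev m -> exists nu : autC, nu x = y.
Hypothesis Lev1 : forall x, x \in Lev n.+1 -> x != 1.

Variable cl : rel algC.
Hypothesis cl_aut : forall (nu : autC) x y, cl (nu x) (nu y) = cl x y.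
Hypothesis cl_refl : forall x, x \in Lev n.+1 -> cl x x.
Hypothesis cl_sym : forall x y, x \in Lev n.+1 -> cl x y -> cl y x /\ g y = g x.
Hypothesis cl_trans : forall x y z, x \in Lev n.+1 -> cl x y -> cl y z -> cl x z.

Definition cls x := [seq y <- fib (g x) | cl x y].

Let uniq_f x : x \in Lev n.+1 -> uniq (fib (g x)).
Proof. by move=> xL; apply: (uniq_fib uniq_Lev (n := n)); rewrite -(mem_LevS mem_fib). Qed.

Lemma fib_Lev1 x y : x \in Lev n.+1 -> y \in fib (g x) -> y \in Lev n.+1.
Proof. by move=> xL; rewrite mem_fib !(mem_LevS mem_fib) in xL * => /eqP ->. Qed.

Lemma cls_aut (nu : autC) x : x \in Lev n.+1 -> perm_eq (map nu (cls x)) (cls (nu x)).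
Proof.
move=> xL; have nxL : nu x \in Lev n.+1 by rewrite (Lev_aut g_aut mem_fib).
apply: uniq_perm; first by rewrite (map_inj_uniq (fmorph_inj nu)) filter_uniq ?uniq_f.
  by rewrite filter_uniq ?uniq_f.
move=> y; have -> : y = nu (autC_inv nu y) by rewrite autC_invKV.
rewrite (mem_map (fmorph_inj nu)) !mem_filter cl_aut !mem_fib -!g_aut.
by rewrite (inj_eq (fmorph_inj nu)).
Qed.

Lemma fib_perm (nu : autC) x : x \in Lev n.+1 -> perm_eq (map nu (fib (g x))) (fib (g (nu x))).
Proof.
move=> xL; have nxL : nu x \in Lev n.+1 by rewrite (Lev_aut g_aut mem_fib).
apply: uniq_perm; rewrite ?(map_inj_uniq (fmorph_inj nu)) ?uniq_f //.
move=> y; have -> : y = nu (autC_inv nu y) by rewrite autC_invKV.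
by rewrite (mem_map (fmorph_inj nu)) !mem_fib -!g_aut (inj_eq (fmorph_inj nu)).
Qed.

Lemma size_cls x y : x \in Lev n.+1 -> y \in Lev n.+1 -> size (cls x) = size (cls y).
Proof.
by move=> xL yL; have [nu <-] := trans_Lev xL yL; rewrite -(perm_size (cls_aut nu xL)) size_map.
Qed.

Lemma size_cls_dvd x : x \in Lev n.+1 -> (size (cls x) %| d)%N.
Proof.
move=> xL; rewrite -(size_fib (g x)); have inL := fib_Lev1 xL; apply: (@class_dvd _ cl).
- by move=> y /inL; apply: cl_refl.
- by move=> y z t /inL yL _ _; apply: cl_trans.
- by move=> y z /inL yL _ /(cl_sym yL)[].
move=> y yf; rewrite (size_cls xL (inL _ yf)) size_filter.
by move: yf; rewrite mem_fib => /eqP ->.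
Qed.

Definition psi (phi : algC -> algC) x := \prod_(y <- cls x) phi y.

Lemma psi_aut phi : (forall (nu : autC) x, nu (phi x) = phi (nu x)) ->
  forall (nu : autC) x, x \in Lev n.+1 -> nu (psi phi x) = psi phi (nu x).
Proof.
move=> phi_aut nu x xL; rewrite /psi rmorph_prod -(perm_big _ (cls_aut nu xL)) big_map.
by apply: eq_bigr => y _; rewrite phi_aut.
Qed.

(** A symmetric function of the block norms over the sibling set of x; each block enters once for
    each of its members. *)
Definition psi2 phi j x := (\prod_(y <- fib (g x)) ('X - (psi phi y)%:P))`_j.

Lemma psi2_aut phi j : (forall (nu : autC) x, nu (phi x) = phi (nu x)) ->
  forall (nu : autC) x, x \in Lev n.+1 -> nu (psi2 phi j x) = psi2 phi j (nu x).
Proof.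
move=> phi_aut nu x xL; rewrite /psi2 -(perm_big _ (fib_perm nu xL)) big_map -coef_map rmorph_prod /=.
congr (polyseq _)`_ _; rewrite big_seq [RHS]big_seq; apply: eq_bigr => y yf.
by rewrite rmorphB /= map_polyX map_polyC /= psi_aut // (fib_Lev1 xL yf).
Qed.

Lemma psi_dvd (q : nat) (V : place q) (q_pr : prime q) xs phi (P : pred algC) s :
  xs \in Lev n.+1 -> (forall x, x \in Lev n.+1 -> x != xs -> vmax V ((xs - 1) / (x - 1))) ->
  (forall (nu : autC) x, nu (phi x) = phi (nu x)) -> (0 < s)%N ->
  (forall y, y \in fib (g xs) -> vunit V (phi y ^+ s * q%:R ^+ P y)) ->
  (s %| count P (cls xs))%N.
Proof.
move=> xsL iso phi_aut s0 Uphi; have inL x (nu : autC) : x \in Lev n.+1 -> nu x \in Lev n.+1.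
  by rewrite (Lev_aut g_aut mem_fib).
apply: (@isolated_dvd _ V q_pr (Lev n.+1) xs (psi phi)) => //.
- by move=> nu x /inL.
- by move=> nu x; apply: psi_aut.
have -> : psi phi xs ^+ s * q%:R ^+ count P (cls xs) =
    \prod_(y <- cls xs) (phi y ^+ s * q%:R ^+ P y).
  rewrite /psi; elim: (cls xs) => [|y l IH]; first by rewrite !big_nil expr1n mulr1.
  by rewrite !big_cons -IH /= exprMn exprD; ring.
by rewrite big_seq; apply: vunit_prod => y; rewrite mem_filter => /andP[_]; apply: Uphi.
Qed.

Lemma coef_comp_scale (P : {poly algC}) (a : algC) i : (P \Po (a *: 'X))`_i = a ^+ i * P`_i.
Proof.
elim/poly_ind: P i => [|P x IH] i; first by rewrite comp_poly0 !coef0 mulr0.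
rewrite comp_polyD comp_polyM comp_polyX comp_polyC -scalerAr !coefD coefZ !coefMX !coefC.
case: i => [|i] /=; first by rewrite mulr0 !add0r mul1r.
by rewrite !addr0 IH exprS mulrA.
Qed.

(** With blocks of size 2, scaling by w ^+ 2 makes the norm of a block a unit when both members
    satisfy P and puts it in M otherwise. The coefficient of index d - N2 therefore has valuation -2
    N2 / s, an integer by isolation. *)
Lemma psi2_dvd (q : nat) (V : place q) (q_pr : prime q) xs phi (P : pred algC) (w : algC) s :
  xs \in Lev n.+1 -> (forall x, x \in Lev n.+1 -> x != xs -> vmax V ((xs - 1) / (x - 1))) ->
  (forall (nu : autC) x, nu (phi x) = phi (nu x)) -> (0 < s)%N -> w ^+ s = q%:R ->
  (forall y, y \in fib (g xs) -> vunit V (phi y ^+ s * q%:R ^+ P y)) -> size (cls xs) = 2%N ->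
  (s %| 2 * count (fun y => all P (cls y)) (fib (g xs)))%N.
Proof.
move=> xsL iso phi_aut s0 ws Uphi sz2; have inL x (nu : autC) : x \in Lev n.+1 -> nu x \in Lev n.+1.
  by rewrite (Lev_aut g_aut mem_fib).
have Mw : vmax V w by apply: (@vmaxX_inv _ V w s); rewrite ws vmax_char.
have w0 : w != 0.
  have q0 : q%:R != 0 :> algC by rewrite pnatr_eq0 -lt0n prime_gt0.
  by apply: contraNneq q0 => w0; rewrite -ws w0 expr0n gtn_eqF.
have wphi y : y \in fib (g xs) -> if P y then vunit V (w * phi y) else vmax V (w * phi y).
  move=> yf; have := Uphi y yf; case: (P y) => H.
    by apply: (vunitX_inv s0); rewrite exprMn ws mulrC.
  by rewrite mulr1 in H; apply: vmaxMr => //; apply/vunit_ring/(vunitX_inv s0).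
have psE y : y \in fib (g xs) -> w ^+ 2 * psi phi y = \prod_(z <- cls y) (w * phi z).
  move=> yf; rewrite -sz2 (size_cls xsL (fib_Lev1 xsL yf)) /psi.
  by elim: (cls y) => [|z l IH]; rewrite ?big_nil ?mulr1 // !big_cons -IH /= exprS; ring.
have clsf y z : y \in fib (g xs) -> z \in cls y -> z \in fib (g xs).
  by rewrite mem_filter !mem_fib => /eqP -> /andP[_].
have psO y : y \in fib (g xs) -> vring V (w ^+ 2 * psi phi y).
  move=> yf; rewrite psE // big_seq; apply: vring_prod => z zc.
  by have := wphi z (clsf y z yf zc); case: (P z) => [/vunit_ring|/vmaxW].
have psM y : y \in fib (g xs) -> vmax V (w ^+ 2 * psi phi y) = ~~ all P (cls y).
  move=> yf; rewrite psE //; case: allP => [Pa|/allP/allPn[z zc nP]] /=.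
    apply: vunit_nmax; rewrite big_seq; apply: vunit_prod => z zc.
    by have := wphi z (clsf y z yf zc); rewrite Pa.
  rewrite (big_rem z) //=; apply: vmaxMr.
    by have := wphi z (clsf y z yf zc); rewrite (negbTE nP).
  rewrite big_seq; apply: vring_prod => t /mem_rem tc.
  by have := wphi t (clsf y t yf tc); case: (P t) => [/vunit_ring|/vmaxW].
set N2 := count _ _.
have N2d : (N2 <= d)%N by rewrite -(size_fib (g xs)) count_size.
apply: (@isolated_dvd _ V q_pr (Lev n.+1) xs (psi2 phi (d - N2))) => //.
- by move=> nu x /inL.
- by move=> nu x; apply: psi2_aut.
pose ps := map (psi phi) (fib (g xs)).
have UC : vunit V (\prod_(z <- map ( *%R (w ^+ 2)) ps) ('X - z%:P))`_(d - N2).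
  have -> : (d - N2)%N = count (vmax V) (map ( *%R (w ^+ 2)) ps).
    rewrite -map_comp count_map -(size_fib (g xs)) -(count_predC (fun y => all P (cls y))) addKn.
    by apply: eq_in_count => y yf /=; rewrite psM.
  by apply: unit_coef_prod_XsubC => _ /mapP[_ /mapP[y yf ->] ->]; apply: psO.
have := scale_prod ps (expf_neq0 2 w0); rewrite !size_map size_fib => E.
have := congr1 (fun P : {poly algC} => P`_(d - N2)) E; rewrite /= coef_comp_scale coefZ => E2.
have psE2 : (\prod_(z <- ps) ('X - z%:P))`_(d - N2) = psi2 phi (d - N2) xs by rewrite /psi2 /ps big_map.
rewrite psE2 in E2.
have E3 : (\prod_(z <- map ( *%R (w ^+ 2)) ps) ('X - z%:P))`_(d - N2) = w ^+ 2 ^+ N2 * psi2 phi (d - N2) xs.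
  apply: (mulfI (_ : (w ^+ 2) ^- d != 0)); first by rewrite invr_eq0 !expf_neq0.
  rewrite -E2 mulrA; congr (_ * _); rewrite -{2}(subnK N2d) exprD exprVn invfM -mulrA mulVf ?mulr1 //.
  by rewrite !expf_neq0.
by rewrite E3 -exprM in UC; have := vunitX s UC; rewrite exprMn -exprM mulnC exprM ws mulrC.
Qed.

(* The prime r leaves only blocks of size 2, k + 1 and d; the prime p excludes the first two. *)
Theorem block_full (k u : nat) (r : nat) (Vr : place r) (r_pr : prime r) xr
    (p : nat) (Vp : place p) (p_pr : prime p) xp (phi : algC -> algC) (w : algC) :
  d = (2 * k + 2)%N -> (2 < k)%N -> (1 < u)%N -> (u < k)%N -> odd (k + u) ->
  xr \in Lev n.+1 -> (forall x, x \in Lev n.+1 -> x != xr -> vmax Vr ((xr - 1) / (x - 1))) ->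
  count (vring Vr) (fib (g xr)) = 2%N -> vring Vr xr ->
  (forall y, y \in fib (g xr) -> vunit Vr ((1 + y) ^+ k * r%:R ^+ (~~ vring Vr y))) ->
  xp \in Lev n.+1 -> (forall x, x \in Lev n.+1 -> x != xp -> vmax Vp ((xp - 1) / (x - 1))) ->
  (forall (nu : autC) x, nu (phi x) = phi (nu x)) -> w ^+ (k + u) = p%:R ->
  count (fun y => vunit Vp (w * y)) (fib (g xp)) = (k + u)%N ->
  (forall y, y \in fib (g xp) -> vunit Vp (phi y ^+ (k + u) * p%:R ^+ (vunit Vp (w * y)))) ->
  (exists x y, [/\ x \in Lev n.+1, x != y & cl x y]) ->
  forall x y, x \in Lev n.+1 -> g x = g y -> cl x y.
Proof.
move=> dE k2 u1 uk ku_odd xrL isoR cO Oxr UR xpL isoP phi_aut wE cP UP [x0 [y0 [x0L x0y0 cl0]]].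
set P := (fun y => vunit Vp (w * y)) in cP UP.
set b := size (cls xr).
have szb x : x \in Lev n.+1 -> size (cls x) = b by move=> xL; apply: size_cls.
have b2 : (2 <= b)%N.
  rewrite -(szb _ x0L); have := @uniq_leq_size _ [:: x0; y0] (cls x0).
  rewrite /= inE x0y0; apply=> // z; rewrite !inE mem_filter mem_fib => /orP[]/eqP ->.
    by rewrite cl_refl /=.
  by have [_ ->] := cl_sym x0L cl0; rewrite cl0 /=.
have bd : (b %| 2 * k + 2)%N by rewrite -dE; apply: size_cls_dvd.
have sub x : x \in Lev n.+1 -> {subset cls x <= fib (g x)}.
  by move=> xL y; rewrite mem_filter => /andP[].
have cnt_cls (Q : pred algC) x : (count Q (cls x) <= count Q (fib (g x)))%N.
  by rewrite /cls count_filter; apply: sub_count => y /= /andP[].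
have kn : (k %| count (fun y => ~~ vring Vr y) (cls xr))%N.
  apply: (@psi_dvd _ Vr r_pr xr (fun y => 1 + y)) => //; last exact: leq_trans k2.
  by move=> nu x; rewrite rmorphD rmorph1.
have bE : b = (count (vring Vr) (cls xr) + count (fun y => ~~ vring Vr y) (cls xr))%N.
  by rewrite /b -(count_predC (vring Vr)).
have o1 : (0 < count (vring Vr) (cls xr))%N.
  by rewrite -has_count; apply/hasP; exists xr => //; rewrite mem_filter cl_refl // mem_fib eqxx.
have o2 : (count (vring Vr) (cls xr) <= 2)%N by rewrite -cO.
have nn : (count (fun y => ~~ vring Vr y) (cls xr) <= 2 * k)%N.
  apply: leq_trans (cnt_cls _ xr) _; have := count_predC (vring Vr) (fib (g xr)).
  rewrite size_fib dE cO addnC => /addIn E.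
  by rewrite -E; apply: sub_count.
(* The size is o + j k with o = 1 or 2 integral members and j at most 2, and it divides 2k + 2; o =
   2, j = 1 and o = 1, j = 2 fail the divisibility. *)
have b3 : [\/ b = 2%N, b = k.+1 | b = d].
  move: kn bE bd o1 o2 nn b2 k2; rewrite dE; move: (count _ _) (count _ _); clearbody b; move: b {szb}; clear.
  move=> b o nn /dvdnP[j ->] -> /dvdnP[m E] o1 o2 le b2 k2.
  have jle : (j <= 2)%N by rewrite -(leq_pmul2r (_ : 0 < k)%N) //; lia.
  case: j jle E le b2 => [|[|[|j]]] // _ E le b2.
  - by constructor 1; lia.
  - constructor 2; case: o o1 o2 E b2 le => [|[|[|o]]] // _ _ E _ _; first by lia.
    by case: m E => [|[|m]] E; nia.
  constructor 3; case: o o1 o2 E b2 le => [|[|[|o]]] // _ _ E _ _; last by lia.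
  by case: m E => [|[|m]] E; nia.
have eP : (k + u %| count P (cls xp))%N.
  by apply: (@psi_dvd _ Vp p_pr xp phi P) => //; rewrite addn_gt0 (ltn_trans _ u1) ?orbT.
have nP : count (predC P) (fib (g xp)) = (k - u + 2)%N.
  have := count_predC P (fib (g xp)); rewrite cP size_fib dE; move: uk; clear; lia.
suff bdE : b = d.
  move=> x y xL gxy.
  have : size (cls x) = size (fib (g x)) by rewrite szb // size_fib.
  rewrite size_filter => /eqP; rewrite -all_count => /allP; apply.
  by rewrite mem_fib gxy.
case: b3 => // bE2; exfalso.
  have sz2 x : x \in Lev n.+1 -> size (cls x) = 2%N by move=> xL; rewrite szb.
  (* Blocks of size 2: k + u is odd and divides 2 N2, and N2 is at most k + u, so N2 is 0 or k +
     u. *)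
  have ku0 : (0 < k + u)%N by rewrite addn_gt0 (ltn_trans _ u1) ?orbT.
  have := @psi2_dvd _ Vp p_pr xp phi P w (k + u) xpL isoP phi_aut ku0 wE UP (sz2 _ xpL).
  rewrite Gauss_dvdr; last by rewrite coprimen2.
  set N2 := count _ _ => dv.
  have inL := fib_Lev1 xpL.
  have inc y : y \in fib (g xp) -> y \in cls y by move=> /inL yL; rewrite mem_filter cl_refl // mem_fib eqxx.
  have N2le : (N2 <= k + u)%N.
    rewrite -cP /N2 -!size_filter; apply: uniq_leq_size; first by rewrite filter_uniq // uniq_f.
    by move=> y; rewrite !mem_filter => /andP[/allP aP yf]; rewrite aP ?inc.
  have gy y : y \in fib (g xp) -> g y = g xp by rewrite mem_fib => /eqP.
  (* If no pair lies inside P, the k + u members of P have distinct partners outside P, where only k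
     - u + 2 points are available. The double sum counts this. *)
  case: (posnP N2) => [N20|N2gt].
    have le1 y : y \in fib (g xp) -> (count P (cls y) <= 1)%N.
      move=> yf; rewrite -ltnS -(sz2 y (inL _ yf)) ltn_neqAle count_size andbT -all_count.
      apply: contraL isT => aP; have : has (fun y => all P (cls y)) (fib (g xp)) by apply/hasP; exists y.
      by rewrite has_count -/N2 N20.
    have sumE : (\sum_(y <- fib (g xp)) count P (cls y) = 2 * (k + u))%N.
      transitivity (\sum_(y <- fib (g xp)) \sum_(z <- fib (g xp)) (cl y z && P z : nat))%N.
        rewrite big_seq [RHS]big_seq; apply: eq_bigr => y yf; rewrite /cls gy // count_filter.
        elim: (fib (g xp)) => [|z l IH]; rewrite ?big_nil // big_cons /= IH andbC.
        by [].
      rewrite exchange_big /= -cP.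
      transitivity (\sum_(z <- fib (g xp)) (2 * P z))%N; last first.
        by rewrite -big_distrr /=; congr (2 * _)%N; elim: (fib _) => [|z l IH]; rewrite ?big_nil // big_cons IH.
      rewrite big_seq [RHS]big_seq; apply: eq_bigr => z zf.
      case: (P z); last by rewrite big1 // => y _; rewrite andbF.
      rewrite muln1 -(sz2 z (inL _ zf)) size_filter gy //.
      transitivity (\sum_(y <- fib (g xp)) (cl z y : nat))%N.
        rewrite big_seq [RHS]big_seq; apply: eq_bigr => y yf; rewrite andbT; congr nat_of_bool.
        by apply/idP/idP => [/(cl_sym (inL _ yf))[]|/(cl_sym (inL _ zf))[]].
      by elim: (fib (g xp)) => [|y l IH]; rewrite ?big_nil // big_cons IH.
    have : (\sum_(y <- fib (g xp)) count P (cls y) <= \sum_(y <- fib (g xp)) 1)%N.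
      by rewrite big_seq [X in (_ <= X)%N]big_seq; apply: leq_sum => y /le1.
    by rewrite sumE sum1_size size_fib dE; move: u1; clear; lia.
  (* Now P is a union of pairs, which contradicts the oddness of k + u. *)
  have N2E : N2 = (k + u)%N by apply/eqP; rewrite eqn_leq N2le dvdn_leq.
  have aE y : y \in fib (g xp) -> P y -> all P (cls y).
    move=> yf Py; apply: contraT => na; have : (N2 < count P (fib (g xp)))%N.
      rewrite /N2 -!size_filter.
      have := @uniq_leq_size _ (y :: [seq y <- fib (g xp) | all P (cls y)]) [seq y <- fib (g xp) | P y].
      rewrite /= mem_filter (negbTE na) filter_uniq ?uniq_f //; apply=> [//|z].
      rewrite inE !mem_filter => /orP[/eqP ->|/andP[/allP az zf]]; first by rewrite Py yf.
      by rewrite az ?inc.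
    by rewrite cP N2E ltnn.
  have : (2 %| size [seq y <- fib (g xp) | P y])%N.
    apply: (@class_dvd _ cl).
    - by move=> y; rewrite mem_filter => /andP[_ /inL]; apply: cl_refl.
    - by move=> y z t; rewrite !mem_filter => /andP[_ /inL yL] _ _; apply: cl_trans.
    - by move=> y z; rewrite !mem_filter => /andP[_ /inL yL] _ /(cl_sym yL)[].
    move=> y; rewrite mem_filter => /andP[Py yf].
    rewrite -(sz2 y (inL _ yf)) size_filter gy // count_filter; apply: eq_in_count => z zf /=.
    case cyz: (cl y z) => //=; have /allP := aE y yf Py; apply.
    by rewrite mem_filter cyz gy.
  by rewrite size_filter cP dvdn2 ku_odd.
(* Blocks of size k + 1: too small to hold k + u intermediate roots, the block of xp would have to
   lie among the k - u + 2 remaining ones, which are too few. *)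
have szp : size (cls xp) = k.+1 by rewrite szb.
have e0 : count P (cls xp) = 0%N.
  have le := count_size P (cls xp); rewrite szp in le.
  case: (posnP (count P (cls xp))) => // pos; have := dvdn_leq pos eP.
  by move: le u1; clear; lia.
have := cnt_cls (predC P) xp; rewrite nP; have := count_predC P (cls xp); rewrite szp e0 add0n => ->.
by move: uk u1; clear; lia.
Qed.

End Block.

Section Units.

Variables (q : nat) (V : place q).
Hypothesis q_pr : prime q.
Local Notation O := (vring V).
Local Notation M := (vmax V).
Local Notation U := (vunit V).

(** 1 + y is a unit on both integral roots, with residues 1 and 2, whereas y itself fails on the one
    near 0; on nonintegral roots both have the same valuation. *)
Lemma phi_r_unit (k : nat) (y : algC) : U 2%:R -> [\/ M y, M (y - 1) | ~~ O y] ->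
  (~~ O y -> U (y ^+ k * q%:R)) -> U ((1 + y) ^+ k * q%:R ^+ (~~ O y)).
Proof.
move=> U2 cs big; case Oy: (O y) in cs big *; last first.
  have nO : ~~ O y by rewrite Oy.
  have My := vring_total nO; have y0 := nvring_neq0 nO.
  have -> : 1 + y = (1 + y^-1) * y by rewrite mulrDl mul1r mulVf // addrC.
  rewrite /= expr1 exprMn -mulrA; apply: vunitM; last exact: big.
  by apply/vunitX/vunitD => //; exact: vunit1.
rewrite /= mulr1; apply: vunitX; case: cs => // My.
  by apply: vunitD => //; exact: vunit1.
have -> : 1 + y = 2%:R + (y - 1) by ring.
exact: vunitD.
Qed.

(* At p, phip is a unit on the integral and on the largest roots of a fiber, and has the valuation
   of the root on the intermediate ones. *)
Definition phip (v : nat) (y : algC) := 2%:R + y / (1 + q%:R * y ^+ v.+1).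

Lemma phip_aut v (nu : autC) y : nu (phip v y) = phip v (nu y).
Proof. by rewrite /phip [LHS]rmorphD rmorph_nat fmorph_div rmorphD rmorph1 rmorphM rmorph_nat rmorphXn. Qed.

Lemma phip_unit (k u : nat) (w y : algC) : (1 < u)%N -> (u < k)%N -> U 2%:R -> U 3%:R ->
  w ^+ (k + u) = q%:R ->
  [\/ M y, M (y - 1) | ~~ O y] -> (~~ O y -> O (w * y) -> U (w * y)) ->
  (~~ O (w * y) -> M (y ^+ (k - u) * q%:R + 1)) ->
  U (phip (k - u) y ^+ (k + u) * q%:R ^+ (U (w * y))).
Proof.
move=> u1 uk U2 U3 wE cs mid big.
have Mq : M q%:R := vmax_char V.
have ku0 : (0 < k + u)%N by rewrite addn_gt0 (ltn_trans _ u1) ?orbT.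
have Mw : M w by apply: (@vmaxX_inv _ V w (k + u)); rewrite wE.
have Ow := vmaxW Mw.
have small : O y -> U (phip (k - u) y) -> U (phip (k - u) y ^+ (k + u) * q%:R ^+ (U (w * y))).
  move=> Oy Up; have -> : U (w * y) = false.
    by apply: contraTF (vmaxMr Mw Oy) => /vunit_nmax ->.
  by rewrite mulr1; apply: vunitX.
have mO : O y -> M (q%:R * y ^+ (k - u).+1) by move=> Oy; apply: vmaxMr => //; exact: vringX.
have mU : O y -> U (1 + q%:R * y ^+ (k - u).+1).
  by move=> Oy; apply: vunitD; [exact: vunit1 | exact: mO].
case: cs => [My|My|nO].
- have Oy := vmaxW My; apply: small => //; apply: vunitD => //; apply: vmaxMr => //.
  by apply/vunitVr/mU.
- have Oy : O y by rewrite -[y](subrK 1); apply: vringD; [exact: vmaxW | exact: vring1].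
  apply: small => //; have U1 := mU Oy; have M1 := mO Oy; rewrite /phip.
  set m := q%:R * _ in U1 M1 *.
  have -> : 2%:R + y / (1 + m) = 3%:R + (y - 1 - m) / (1 + m).
    by have := vunit_neq0 U1 => n0; field.
  by apply: vunitD => //; apply: vmaxMr; [exact: vmaxB | exact: vunitVr].
have y0 := nvring_neq0 nO.
case Owy: (O (w * y)).
  have Uwy := mid nO Owy; rewrite Uwy /= expr1 -wE -exprMn; apply: vunitX.
  have M1 : M (q%:R * y ^+ (k - u).+1).
    have -> : q%:R * y ^+ (k - u).+1 = w ^+ (2 * u - 1) * (w * y) ^+ (k - u).+1.
      by rewrite -wE exprMn mulrA -exprD; congr (w ^+ _ * _); move: u1 uk; clear; lia.
    apply: vmaxMr; last exact: vringX.
    by apply: vmaxX => //; move: u1; clear; lia.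
  have U1 : U (1 + q%:R * y ^+ (k - u).+1) by apply: vunitD => //; exact: vunit1.
  rewrite /phip mulrDl addrC; have -> : y / (1 + q%:R * y ^+ (k - u).+1) * w = (w * y) / (1 + q%:R * y ^+ (k - u).+1).
    by rewrite mulrAC [y * w]mulrC.
  apply: vunitD; first by apply: vunitM => //; exact: vunitV.
  by apply: vmaxMl => //; exact: vring_nat.
have -> : U (w * y) = false by rewrite /vunit Owy.
rewrite mulr1; apply: vunitX; have := big (negbT Owy); set m := _ + 1 => Mm.
have My := vring_total nO.
(* On the largest roots the denominator of [phip] is y (-1 + t) with t in M, so [phip] is congruent
   to 2 - 1 = 1. *)
pose t := y^-1 + m.
have Mt : M t by apply: vmaxD.
have E : 1 + q%:R * y ^+ (k - u).+1 = y * (-1 + t).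
  by rewrite /t /m exprS mulrDr [y * (y^-1 + _)]mulrDr mulfV //; ring.
have Ut : U (-1 + t) by apply: vunitD => //; apply/vunitN/vunit1.
have t0 := vunit_neq0 Ut.
have -> : phip (k - u) y = (-1 + 2%:R * t) / (-1 + t).
  by rewrite /phip E; move: t0; move: (t) => t' t0; field; rewrite ?y0 ?t0.
apply: vunitM; last exact: vunitV.
apply: vunitD; first by apply/vunitN/vunit1.
by apply: vmaxMl => //; exact: vring_nat.
Qed.

End Units.

(** * Arithmetic of the parameters *)

Lemma nat_square m : (0 < m)%N -> (forall q, prime q -> ~~ odd (logn q m)) ->
  exists t, m = (t ^ 2)%N.
Proof.
move=> m0 ev; exists (\prod_(q <- primes m) q ^ (logn q m)./2)%N.
rewrite {1}(prod_prime_decomp m0) prime_decompE big_map /=.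
have : {subset primes m <= primes m} by [].
elim: {1 3 4}(primes m) => [|q l IH] sub; first by rewrite !big_nil exp1n.
rewrite !big_cons expnMn -IH; last by move=> x xl; apply: sub; rewrite inE xl orbT.
congr (_ * _)%N; rewrite -expnM muln2 -{1}(odd_double_half (logn q m)).
have := sub q (mem_head _ _); rewrite mem_primes => /and3P[qp _ _].
by rewrite (negbTE (ev q qp)).
Qed.

(** Numerator times denominator represents the square class of y up to sign; if all its valuations
    were even it would be a square. *)
Lemma odd_prime_ex (y : algC) : y \in Crat -> y != 0 ->
  (forall t, t \in Crat -> y != t ^+ 2 /\ y != - t ^+ 2) ->
  exists2 q, prime q & exists2 v : int, odd (absz v) & forall V : place q, vunit V (y * q%:R ^ v).
Proof.
case/CratP => a -> ; rewrite fmorph_eq0 => a0 nsq.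
pose m := (absz (numq a) * absz (denq a))%N.
have b0 : (0 < absz (denq a))%N by rewrite absz_gt0 denq_neq0.
have m0 : (0 < m)%N by rewrite muln_gt0 b0 absz_gt0 numq_eq0 a0.
have [b bE] : exists b : nat, denq a = b by exists (absz (denq a)); rewrite absz_denq.
have bn0 : b%:R != 0 :> algC by rewrite pnatr_eq0; apply: contraTneq (denq_gt0 a) => b00; rewrite bE b00.
have [e aE] : exists e : bool, ratr a * b%:R ^+ 2 = (-1) ^+ e * m%:R :> algC.
  exists (numq a < 0); rewrite /ratr bE -[(Posz b)%:~R]/(b%:R) expr2 mulrA divfK // /m bE natrM mulrA; congr (_ * _).
  by rewrite {1}[numq a]intEsign rmorphM rmorph_sign.
apply: contrapT => none.
have ev q : prime q -> ~~ odd (logn q m).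
  move=> qp; apply/negP => oddl; apply: none; exists q => //.
  have [m' cm mE] := pfactor_coprime qp m0; have [b' cb b'E] := pfactor_coprime qp b0.
  rewrite bE /= in b'E; set l := logn q m in oddl mE; set f := logn q b in b'E.
  exists (f%:Z * 2 - l%:Z); first by move: oddl; clear; lia.
  move=> V; have q0 : q%:R != 0 :> algC by rewrite pnatr_eq0 -lt0n prime_gt0.
  have -> : ratr a * q%:R ^ (f%:Z * 2 - l%:Z) = (-1) ^+ e * m'%:R / b'%:R ^+ 2 :> algC.
    have -> : ratr a = (-1) ^+ e * m%:R / b%:R ^+ 2 :> algC by rewrite -aE mulfK // expf_neq0.
    rewrite mE {1}b'E !natrM !natrX expfzDr // -exprz_exp -exprnP -exprz_inv -exprnP exprVn.
    have b'0 : b'%:R != 0 :> algC by apply: contraNneq bn0 => b'0; rewrite b'E natrM b'0 mul0r.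
    have q1 : q%:R ^+ l != 0 :> algC by rewrite expf_neq0.
    have q2 : q%:R ^+ f != 0 :> algC by rewrite expf_neq0.
    have -> : (q%:R ^+ f) ^ 2 = (q%:R ^+ f) ^+ 2 :> algC by [].
    by field; rewrite b'0 q1 q2.
  apply: vunitM; last by apply/vunitV/vunitX/(vunit_coprime V).
  by apply: vunitM; [apply/vunitX/vunitN/vunit1 | exact: (vunit_coprime V)].
have [t tE] := nat_square m0 ev.
have tr : t%:R / b%:R \in Crat by rewrite rpred_div // rpred_nat.
have [n1 n2] := nsq _ tr.
have E : ratr a = (-1) ^+ e * (t%:R / b%:R) ^+ 2 :> algC.
  by rewrite expr_div_n mulrA -natrX -tE -aE mulfK // expf_neq0.
by case: e {aE} E => E; move: n1 n2; rewrite E ?mul1r ?mulN1r ?eqxx.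
Qed.

Section RatInt.
Variables (q : nat) (V : place q).
Hypothesis q_pr : prime q.

Lemma vunit_square_even (y s : algC) (v : int) : y != 0 -> s \in Crat -> s != 0 ->
  vunit V (y * q%:R ^ v) -> vunit V (y * s ^+ 2) -> ~~ odd (absz v).
Proof.
move=> y0 sr s0 U1 U2; have [j Uj] := vunit_rat V q_pr sr s0.
have q0 : q%:R != 0 :> algC by exact: vchar_neq0.
have : vunit V (q%:R ^ (v + j * 2)).
  have -> : q%:R ^ (v + j * 2) = (y * q%:R ^ v) / (y * s ^+ 2) * (s * q%:R ^ j) ^+ 2 :> algC.
    rewrite expfzDr // -exprz_exp -[(q%:R ^ j) ^ 2]/((q%:R ^ j) ^+ 2).
    by field; rewrite y0 s0.
  by apply: vunitM; [apply: vunitM => //; exact: vunitV | exact: vunitX].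
by move/vunit_expz; clear; lia.
Qed.

Lemma rat_int (z : algC) : z \in Crat -> vring V z -> exists i : nat, vmax V (z - i%:R).
Proof.
case/CratP => a -> Oa; pose b := absz (denq a).
have b0 : (0 < b)%N by rewrite absz_gt0 denq_neq0.
have bE : denq a = b by rewrite absz_denq.
have aE : ratr a = (numq a)%:~R / b%:R :> algC by rewrite /ratr bE.
have bn0 : b%:R != 0 :> algC by rewrite pnatr_eq0 -lt0n.
have cqb : coprime q b.
  rewrite prime_coprime //; apply/negP => qb.
  have Mb : vmax V b%:R by rewrite vmax_nat.
  have : vmax V (numq a)%:~R by have := vmaxMl Oa Mb; rewrite aE divfK.
  have : vmax V (absz (numq a))%:R -> (q %| absz (numq a))%N by rewrite vmax_nat.
  move=> H Mn; have /H qa : vmax V (absz (numq a))%:R.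
    move: Mn; rewrite [X in X%:~R]intEsign rmorphM rmorph_sign.
    by rewrite vmaxM_unit //; apply/vunitX/vunitN/vunit1.
  have := coprime_num_den a; rewrite -/b => /eqP gcd1.
  have : (q %| gcdn (absz (numq a)) b)%N by rewrite dvdn_gcd qa.
  by rewrite gcd1 dvdn1 => /eqP q1; move: q_pr; rewrite q1.
have Ub := vunit_coprime V cqb.
have : coprimez b%:Z q%:Z by rewrite coprimezE coprime_sym.
case/coprimezP => -[s t] /= E.
pose i := ((numq a * s) %% q%:Z)%Z.
have i0 : 0 <= i by rewrite modz_ge0 // eqz_nat -lt0n prime_gt0.
exists (absz i).
have -> : (absz i)%:R = i%:~R :> algC by rewrite -[in RHS](gez0_abs i0).
have -> : ratr a - i%:~R = ratr a * (t%:~R * q%:R) + ((numq a * s) %/ q%:Z)%Z%:~R * q%:R :> algC.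
  have E1 : s%:~R * b%:R + t%:~R * q%:R = 1 :> algC.
    by rewrite -[b%:R]/((Posz b)%:~R) -[q%:R]/((Posz q)%:~R) -!intrM -intrD E.
  have E2 : (numq a)%:~R * s%:~R = ((numq a * s) %/ q%:Z)%Z%:~R * q%:R + i%:~R :> algC.
    by rewrite -intrM {1}(divz_eq (numq a * s) q%:Z) intrD intrM.
  have -> : t%:~R * q%:R = 1 - s%:~R * b%:R :> algC by rewrite -[X in X - _]E1 addrC addKr.
  rewrite mulrBr mulr1 [s%:~R * _]mulrC mulrA aE divfK // E2; ring.
apply: vmaxD; apply: vmaxMl; rewrite ?vmax_char //; try exact: vring_int.
by apply: vmaxMl; [exact: vring_int | exact: vmax_char].
Qed.

End RatInt.

(* For w = (4d)! and r dividing 16 d^2 w^4 + 1: (4 d w^2)^2 = -1 and (4 d w^2 + 1)^2 = 2d (2w)^2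
   modulo r. *)
Lemma good_r (d : nat) : (0 < d)%N -> exists r, [/\ prime r, (4 * d < r)%N,
  (exists i, r %| i ^ 2 + 1)%N & exists j w : nat, [/\ (r %| j ^ 2 + (r - 2 * d %% r) * w ^ 2)%N & ~~ (r %| w)%N]].
Proof.
move=> d0; pose w := ((4 * d)`!)%N; pose m := (16 * d ^ 2 * w ^ 4 + 1)%N.
have w0 : (0 < w)%N by exact: fact_gt0.
have m1 : (1 < m)%N by rewrite /m addn1 ltnS !muln_gt0 d0 w0.
exists (pdiv m); have rp := pdiv_prime m1; set r := pdiv m in rp *.
have rm : (r %| m)%N by exact: pdiv_dvd.
have r4 : (4 * d < r)%N.
  rewrite ltnNge; apply/negP => le; have rw : (r %| w)%N by rewrite dvdn_fact // prime_gt0.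
  have : (r %| 1)%N by move: rm; rewrite /m dvdn_addr // dvdn_mull // dvdn_exp.
  by rewrite dvdn1 => /eqP r1; rewrite r1 in rp.
have nrw : ~~ (r %| 2 * w)%N.
  rewrite Euclid_dvdM // negb_or; apply/andP; split.
    by apply/negP => /dvdn_leq; move=> /(_ isT); move: r4 d0; clear; lia.
  apply/negP => rw; have : (r %| 1)%N by move: rm; rewrite /m dvdn_addr // dvdn_mull // dvdn_exp.
  by rewrite dvdn1 => /eqP r1; rewrite r1 in rp.
split=> //.
  by exists (4 * d * w ^ 2)%N; rewrite (_ : _ + 1 = m)%N // /m; ring.
exists (4 * d * w ^ 2 + 1)%N, (2 * w)%N; split=> //.
have lt : (2 * d < r)%N by move: r4; clear; lia.
rewrite modn_small //.
have -> : ((4 * d * w ^ 2 + 1) ^ 2 + (r - 2 * d) * (2 * w) ^ 2 = m + r * (2 * w) ^ 2)%N.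
  rewrite mulnBl /m; have := leq_mul (ltnW lt) (leqnn ((2 * w) ^ 2)%N).
  have -> : (2 * d * (2 * w) ^ 2 = 8 * d * w ^ 2)%N by ring.
  move: (r * (2 * w) ^ 2)%N => R le.
  have -> : ((4 * d * w ^ 2 + 1) ^ 2 = 16 * d ^ 2 * w ^ 4 + 8 * d * w ^ 2 + 1)%N by ring.
  by move: le; clear; lia.
by rewrite dvdn_add // dvdn_mulr.
Qed.

(** Squaring identifies 1 and -1 modulo r, so it is not injective and hence not surjective. *)
Lemma nonresidue r : prime r -> (2 < r)%N -> exists e : nat, forall x : nat, (x ^ 2 != e %[mod r])%N.
Proof.
move=> rp r2; have r0 := prime_gt0 rp.
pose f (x : 'I_r) : 'I_r := Ordinal (ltn_pmod (x ^ 2) r0).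
have ninj : ~ {in 'I_r &, injective f}.
  have l1 : (1 < r)%N by exact: prime_gt1.
  have lr : (r.-1 < r)%N by rewrite prednK.
  move/(_ (Ordinal l1) (Ordinal lr) isT isT) => H.
  have : f (Ordinal l1) = f (Ordinal lr).
    apply: val_inj => /=; case: r {f H l1 lr r0 rp} r2 => [|[|r]] // _ /=.
    have -> : (r.+1 ^ 2 = 1 + r * r.+2)%N by ring.
    by rewrite modnMDr_r // || rewrite addnC modnMDl.
  by move/H/(congr1 val) => /=; move: r2; clear; lia.
have [a na] : exists a : 'I_r, a \notin codom f.
  apply: contrapT => none; apply: ninj; apply/image_injP.
  apply/eqP; apply: eq_card => a; rewrite [in RHS]inE.
  by apply: contrapT => /negP na; apply: none; exists a; move: na; rewrite /codom; case: (_ \in _).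
exists a => x; apply: contra na => /eqP E; apply/codomP.
exists (Ordinal (ltn_pmod x r0)); apply: val_inj => /=.
by rewrite modnXm E modn_small.
Qed.

Lemma good_N (p r W : nat) (K : nat) : prime p -> prime r -> (2 < r)%N -> p != r -> (0 < W)%N ->
  coprime W (p * r) -> exists N l : nat, [/\ (K < N)%N, (W %| N)%N, coprime N (p * r),
    prime l /\ coprime l (W * p * r) & (exists2 m, N = (l * m)%N & ~~ (l %| m)%N) /\
    forall x : nat, (x ^ 2 != N %[mod r])%N].
Proof.
move=> pp rp r2 pr W0 cW.
have [l lbig lp] := prime_above (K + W * p * r).
have p0 := prime_gt0 pp; have r0 := prime_gt0 rp.
have Wpr0 : (0 < W * p * r)%N by rewrite !muln_gt0 W0 p0 r0.
have cl : coprime l (W * p * r).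
  rewrite prime_coprime //; apply/negP => /(dvdn_leq Wpr0); move: lbig; clear; lia.
have [e eP] := nonresidue rp r2.
have clW : coprime r (l * W).
  move: cl cW; rewrite !coprimeMr => /andP[/andP[_ _] clr] /andP[_ cWr].
  by rewrite coprime_sym clr coprime_sym cWr.
have [s sE] : exists s, (l * W * s = e %[mod r])%N.
  have lW0 : (0 < l * W)%N by rewrite muln_gt0 prime_gt0.
  have [s t E _] := egcdnP r lW0; exists (s * e)%N.
  move: clW; rewrite coprime_sym => /eqP g1; rewrite g1 in E.
  rewrite mulnA [(l * W * s)%N]mulnC E mulnDl mul1n [(t * r)%N]mulnC -mulnA mulnC modnMDl.
  by [].
have cplr : coprime (p * l) r.
  move: cl; rewrite coprimeMl !coprimeMr => /andP[_ ->]; rewrite andbT.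
  by rewrite prime_coprime // dvdn_prime2.
(* N will be l W m: m is 1 modulo p l, so l divides N once and p does not, while its residue modulo
   r puts N in the class of the nonresidue e. The size of l makes N exceed K. *)
pose m := chinese (p * l) r 1 s.
have m1 : (m = 1 %[mod p * l])%N by apply: chinese_modl.
have ms : (m = s %[mod r])%N by apply: chinese_modr.
have nd q : prime q -> (q %| p * l)%N -> ~~ (q %| m)%N.
  move=> qp qpl; apply/negP => qm; have : (m %% q = 1 %% q)%N.
    by rewrite -(modn_dvdm m qpl) m1 modn_dvdm.
  by move: qm; rewrite /dvdn => /eqP ->; rewrite modn_small ?prime_gt1.
have npm : ~~ (p %| m)%N by apply: nd => //; exact: dvdn_mulr.
have nlm : ~~ (l %| m)%N by apply: nd => //; exact: dvdn_mull.
have m0 : (0 < m)%N by rewrite lt0n; apply: contraNneq npm => ->; exact: dvdn0.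
have NE : (l * (W * m) = e %[mod r])%N by rewrite mulnA -modnMmr ms modnMmr.
have cNr : coprime r (l * (W * m)).
  rewrite prime_coprime //; apply/negP => rN; have := eP 0%N; rewrite -NE exp0n // mod0n.
  by rewrite eq_sym -/(dvdn _ _) rN.
exists (l * (W * m))%N, l; split.
- by apply: leq_trans (leq_pmulr l _); [move: lbig; clear; lia | rewrite muln_gt0 W0].
- by rewrite mulnCA dvdn_mulr.
- rewrite coprimeMr [coprime _ r]coprime_sym cNr andbT coprime_sym prime_coprime //.
  rewrite !Euclid_dvdM // !negb_or npm andbT; move: cl cW; rewrite !coprimeMr => /andP[/andP[_ clp] _] /andP[cWp _].
  by rewrite -!prime_coprime // coprime_sym clp coprime_sym.
- by [].
split=> [|x]; last by rewrite NE; exact: eP.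
exists (W * m)%N => //; rewrite Euclid_dvdM // negb_or nlm andbT.
by move: cl; rewrite !coprimeMr => /andP[/andP[clW' _] _]; rewrite -prime_coprime.
Qed.

(** * Separability and transitivity from total ramification at l *)

Section Eisenstein.

Variables (l : nat) (V : place l).
Hypothesis l_pr : prime l.
Local Notation O := (vring V).
Local Notation M := (vmax V).
Local Notation U := (vunit V).
Variables (F G : {poly algC}) (D : algC) (d : nat) (fib : algC -> seq algC).
Hypothesis d2 : (2 <= d)%N.
Hypothesis szF : size F = d.+1.
Hypothesis lcF : lead_coef F = 1.
Hypothesis FO : forall i, O F`_i.
Hypothesis D0 : D != 0.
Hypothesis D_rat : D \in Crat.
Hypothesis UDl : U (D / l%:R).
Hypothesis GE : G = 1 + D ^+ d.-1 *: F.
Hypothesis g_aut : forall (nu : autC) x, nu G.[x] = G.[nu x].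
Hypothesis mem_fib : forall a y, (y \in fib a) = (G.[y] == a).
Hypothesis size_fib : forall a, size (fib a) = d.
Local Notation g := (horner G).
Local Notation Lev := (Lev fib).

Let MD : M D.
Proof.
have -> : D = D / l%:R * l%:R by rewrite divfK // vchar_neq0.
by apply: vmaxMl; [exact: vunit_ring | exact: vmax_char].
Qed.

Let d_gt0 : (0 < d)%N. Proof. exact: leq_trans d2. Qed.

Lemma eis_expand x : D * G.[x] =
  D + (D * x) ^+ d + \sum_(i < d) F`_i * D ^+ (d - i) * (D * x) ^+ i.
Proof.
rewrite GE hornerD hornerC hornerZ mulrDr mulr1 mulrA -exprS prednK // -addrA; congr (_ + _).
rewrite horner_coef szF big_ord_recr /= -[F`_d]/(F`_(d.+1.-1)) -szF -lead_coefE lcF mul1r mulrDr addrC exprMn; congr (_ + _).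
rewrite big_distrr /=; apply: eq_bigr => i _; rewrite exprMn.
have lt := ltn_ord i; rewrite -{1}(subnK (ltnW lt)) exprD; ring.
Qed.

(** The equation for X = D x is X^d = D g(x) - D (1 + m) with m in M: X has 1/d of the valuation of
    D g(x), or of D when g(x) = 0. The condition on D / (D x) keeps D negligible on the next
    level. *)
Lemma eis_step x : (g x = 0 \/ M (D * g x) /\ M (D / (D * g x))) ->
  [/\ M (D * x), M (D / (D * x)), D * x != 0 &
   if g x == 0 then U ((D * x) ^+ d / D) else U ((D * x) ^+ d / (D * g x))].
Proof.
move=> hb; have E := eis_expand x; set X := D * x in E *; set S := \sum_(i < d) _ in E.
have MB : M (D * g x) by case: hb => [->|[]//]; rewrite mulr0 vmax0.
have OX : O X.
  apply: contraT => nO; have X0 := nvring_neq0 nO; have MX := vring_total nO.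
  suff : M 1 by rewrite vmax1.
  have -> : 1 = (D * g x - D) * X^-1 ^+ d - \sum_(i < d) F`_i * (D * X^-1) ^+ (d - i).
    have Xd : X ^+ d != 0 by rewrite expf_neq0.
    have -> : \sum_(i < d) F`_i * (D * X^-1) ^+ (d - i) = S * X^-1 ^+ d.
      rewrite /S big_distrl /=; apply: eq_bigr => i _; rewrite exprMn -!mulrA; congr (_ * (_ * _)).
      have le := ltnW (ltn_ord i); have -> : X^-1 ^+ d = X^-1 ^+ i * X^-1 ^+ (d - i) by rewrite -exprD subnKC.
      by rewrite mulrA -exprMn mulfV // expr1n mul1r.
    by rewrite E exprVn -mulrBl (_ : D + X ^+ d + S - D - S = X ^+ d) ?mulfV //; ring.
  apply: vmaxB.
    by apply: vmaxMr; [exact: vmaxB | apply/vringX/vmaxW].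
  apply: vmax_sum => i _; apply: vmaxMl => //; apply: vmaxX; last by rewrite subn_gt0.
  by apply: vmaxMl => //; exact: vmaxW.
have MS : exists2 m, M m & S = D * m \/ ~~ M X.
  case MX: (M X); last by exists 0; [exact: vmax0 | right].
  exists (\sum_(i < d) F`_i * D ^+ (d - i).-1 * X ^+ i).
    apply: vmax_sum => i _; case: (posnP i) => [i0|i0].
      rewrite i0 subn0 mulr1; apply: vmaxMl => //; apply: vmaxX => //; move: d2; clear; lia.
    apply: vmaxMl; last exact: vmaxX.
    by apply: vringM => //; apply/vringX/vmaxW.
  left; rewrite /S big_distrr /=; apply: eq_bigr => i _.
  have -> : (d - i = (d - i).-1.+1)%N by rewrite prednK // subn_gt0.
  by rewrite exprS /=; ring.
have MX : M X.
  apply: (@vmaxX_inv _ V X d); have -> : X ^+ d = D * g x - D - S by rewrite E; ring.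
  apply: vmaxB; first exact: vmaxB.
  apply: vmax_sum => i _; apply: vmaxMr; last exact: vringX.
  by apply: vmaxMl => //; apply: vmaxX => //; rewrite subn_gt0.
have {MS}[m Mm Sm] : exists2 m, M m & S = D * m.
  by have [m Mm [E'|]] := MS; [exists m | rewrite MX].
have XE : X ^+ d = D * g x - D * (1 + m) by rewrite E Sm; ring.
have U1 : U (1 + m) by apply: vunitD => //; exact: vunit1.
have key Y : Y != 0 -> U (X ^+ d / Y) -> (Y = D \/ M (D / Y)) ->
    [/\ M X, M (D / X), X != 0 & U (X ^+ d / Y)].
  move=> Y0 UY hY; have X0 : X != 0.
    by apply: contraTneq (vunit_neq0 UY) => ->; rewrite expr0n gtn_eqF // mul0r eqxx.
  split=> //; have -> : D / X = (D / Y) * (X ^+ d / Y)^-1 * X ^+ d.-1.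
    rewrite -{1}(prednK d_gt0) exprS; have X1 : X ^+ d.-1 != 0 by rewrite expf_neq0.
    by field; rewrite X0 Y0 X1.
  apply: vmaxMl; last by apply: vmaxX => //; move: d2; clear; lia.
  apply: vringM; last exact: vunitVr.
  by case: hY => [->|/vmaxW //]; rewrite divff // vring1.
case: (g x =P 0) => [g0|/eqP g0].
  apply: key => //; last by left.
  by rewrite XE g0 mulr0 sub0r mulrC mulrN mulKf // vunitN.
case: hb => [g00|[_ MDB]]; first by rewrite g00 eqxx in g0.
have B0 : D * g x != 0 by rewrite mulf_neq0.
apply: key => //; last by right.
rewrite XE mulrBl divff // mulrAC; apply: vunitD; first exact: vunit1.
by apply: vmaxN; apply: vmaxMr => //; exact: vunit_ring.
Qed.

Lemma eis_Lev n x : x \in Lev n.+1 ->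
  [/\ M (D * x), M (D / (D * x)), D * x != 0 & U ((D * x) ^+ (d ^ n.+1) / l%:R)].
Proof.
elim: n x => [|n IH] x; rewrite (mem_LevS mem_fib).
  rewrite inE => /eqP g0; have [|h1 h2 h3] := @eis_step x; first by left.
  rewrite g0 eqxx expn1 => h4; split=> //.
  have -> : (D * x) ^+ d / l%:R = (D * x) ^+ d / D * (D / l%:R) by rewrite mulrA divfK.
  exact: vunitM.
move=> /IH[h1 h2 h3 h4]; have [|k1 k2 k3 k4] := @eis_step x; first by right.
split=> //; have g0 : g x != 0 by apply: contraNneq h3 => ->; rewrite mulr0.
rewrite (negbTE g0) in k4.
rewrite expnS exprM -[(D * x) ^+ d](divfK h3) exprMn -mulrA; apply: vunitM => //; exact: vunitX.
Qed.

(** D x has valuation 1/d^n, so the orbit of x has at least d^n elements; it is contained in a list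
    of length d^n, which must then be duplicate-free and equal to the orbit. *)
Lemma eis_main n : uniq (Lev n) /\
  forall x y, x \in Lev n -> y \in Lev n -> exists nu : autC, nu x = y.
Proof.
case: n => [|n].
  split=> // x y; rewrite !inE => /eqP -> /eqP ->; exists idfun; exact: rmorph0.
have nuD (nu : autC) : nu D = D by case/CratP: D_rat => a ->; rewrite fmorph_rat.
have orb x : x \in Lev n.+1 -> exists s : seq algC, [/\ uniq s,
    (forall y, (y \in s) <-> (exists nu : autC, nu x = y)) & (d ^ n.+1 <= size s)%N].
  move=> xL; have [nu|s [us sP dv]] := @orbit_size_dvd _ V l_pr (D * x) (d ^ n.+1).
    rewrite rmorphM /= nuD; have nL : nu x \in Lev n.+1 by rewrite (Lev_aut g_aut mem_fib).
    by have [] := eis_Lev nL.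
  exists (map (fun z => z / D) s); split.
  - by rewrite map_inj_uniq // => a b /(mulIf (_ : D^-1 != 0)); apply; rewrite invr_eq0.
  - move=> y; split=> [/mapP[z /sP[nu <-] ->]|[nu <-]].
      by exists nu; rewrite rmorphM /= nuD mulrC mulKf.
    apply/mapP; exists (nu (D * x)); first by apply/sP; exists nu.
    by rewrite rmorphM /= nuD mulrC mulKf.
  rewrite size_map; apply: dvdn_leq dv; have /sP xs : exists nu : autC, nu (D * x) = D * x by exists idfun.
  by case: (s) xs.
have szL := size_Lev size_fib n.+1.
have key x s : x \in Lev n.+1 -> uniq s -> (forall y, (y \in s) <-> (exists nu : autC, nu x = y)) ->
    (d ^ n.+1 <= size s)%N -> {subset s <= Lev n.+1}.
  by move=> xL us sP le y /sP[nu <-]; rewrite (Lev_aut g_aut mem_fib).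
split=> [|x y xL yL].
  have [x xL] : exists x, x \in Lev n.+1.
    have : (0 < size (Lev n.+1))%N by rewrite szL expn_gt0 d_gt0.
    by case: (Lev n.+1) => // x s _; exists x; rewrite mem_head.
  have [s [us sP le]] := orb x xL.
  by apply: (leq_size_uniq us (key x s xL us sP le)); rewrite szL.
have [s [us sP le]] := orb x xL.
have [|_ sE] := uniq_min_size us (key x s xL us sP le); first by rewrite szL.
by apply/sP; rewrite sE.
Qed.

End Eisenstein.

(** * Square class of the critical orbit at p and r *)

Section BigOrbit.

Variables (q : nat) (V : place q).
Hypothesis q_pr : prime q.
Local Notation O := (vring V).
Local Notation M := (vmax V).
Local Notation U := (vunit V).
Variables (F G : {poly algC}) (T ka B N P : algC) (d : nat).
Local Notation g := (horner G).
Hypothesis d2 : (2 <= d)%N.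
Hypothesis d_even : ~~ odd d.
Hypothesis szF : size F = d.+1.
Hypothesis lcF : lead_coef F = 1.
Hypothesis FO : forall i, O (q%:R ^+ 2 * F`_i).
Hypothesis GE : G = 1 + T *: F.
Hypothesis g_aut : forall (nu : autC) x, nu G.[x] = G.[nu x].
Hypothesis ka_rat : ka \in Crat.
Hypothesis N_rat : N \in Crat.
Hypothesis P_rat : P \in Crat.
Hypothesis UN : U N.
Hypothesis MP : O (P / q%:R).
Hypothesis P0 : P != 0.
Hypothesis TE : T = (N / P ^+ 2) ^+ d.-1.
Hypothesis BE : B = P^-1.
Hypothesis Fka : M (F.[ka] / B ^+ 2 + d%:R / 8%:R).
Hypothesis U2d : U (2%:R * d%:R).
Hypothesis U2 : U 2%:R.

Let d_gt0 : (0 < d)%N. Proof. exact: leq_trans d2. Qed.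
Let q0 : q%:R != 0 :> algC. Proof. exact: vchar_neq0. Qed.
Let N0 : N != 0. Proof. exact: vunit_neq0 UN. Qed.
Let T0 : T != 0. Proof. by rewrite TE expf_neq0 // mulf_neq0 // invr_eq0 expf_neq0. Qed.
Let MP' : M P.
Proof.
have -> : P = P / q%:R * q%:R by rewrite divfK.
by apply: vmaxMl => //; exact: vmax_char.
Qed.

Lemma F_big y : O (y^-1 / q%:R ^+ 3) -> y != 0 -> M (F.[y] / y ^+ d - 1).
Proof.
move=> Oy y0; rewrite horner_coef szF big_ord_recr /= -[F`_d]/(F`_(d.+1.-1)) -szF -lead_coefE lcF mul1r.
rewrite mulrDl divff ?expf_neq0 // addrK big_distrl /=; apply: vmax_sum => i _.
have Oy' : O y^-1.
  have -> : y^-1 = y^-1 / q%:R ^+ 3 * q%:R ^+ 3 by rewrite divfK // expf_neq0.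
  by apply: vringM => //; apply/vringX/vring_nat.
have lt := ltn_ord i.
have -> : F`_i * y ^+ i / y ^+ d = (q%:R ^+ 2 * F`_i) * (y^-1 / q%:R ^+ 3) * q%:R * y^-1 ^+ (d - i).-1.
  have -> : y ^+ d = y ^+ i * y ^+ (d - i) by rewrite -exprD subnKC // ltnW.
  rewrite exprVn.
  have -> : (d - i = (d - i).-1.+1)%N by rewrite prednK // subn_gt0.
  rewrite exprS /=; have h1 : y ^+ i != 0 by rewrite expf_neq0.
  have h2 : y ^+ (d - i).-1 != 0 by rewrite expf_neq0.
  by field; rewrite y0 q0 h1 h2.
apply: vmaxMr; last exact: vringX.
by apply: vmaxMl; [apply: vringM | exact: vmax_char].
Qed.

(** T is N times a square since d - 1 is odd. The first critical value is governed by [F_at_c],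
    where -d/8 = -2d/16; afterwards the orbit is so large that F(y) is close to y^d, a square. The
    bound with q ^+ 3 keeps the orbit large along the induction. *)
Lemma big_orbit n : exists s c, [/\ s \in Crat, s != 0,
    M (iter n.+1 g ka * s ^+ 2 - N * c), c = - (2%:R * d%:R) / 4%:R ^+ 2 \/ c = 1 &
    O ((iter n.+1 g ka)^-1 / q%:R ^+ 3) /\ iter n.+1 g ka != 0].
Proof.
have Uc c : c = - (2%:R * d%:R) / 4%:R ^+ 2 \/ c = 1 -> U c.
  case=> ->; last exact: vunit1.
  apply: vunitM; first exact: vunitN.
  by apply/vunitV/vunitX; rewrite (_ : 4%:R = 2%:R * 2%:R); [exact: vunitM | ring].
pose e := d./2.-1.
have dE : d.-1 = (e.*2).+1.
  by rewrite /e; move: d2 d_even; clear; lia.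
have dE2 : d = (e.*2).+2 by rewrite -(prednK d_gt0) dE.
have iterR m : iter m g ka \in Crat.
  apply: autC_sep => nu; rewrite (iter_aut (g := g) g_aut) //.
  by case/CratP: ka_rat => a ->; rewrite fmorph_rat.
have OPq i : O (P ^+ i) by apply/vringX/vmaxW.
have Pe : P ^+ e != 0 by rewrite expf_neq0.
have Ne : N ^+ e != 0 by rewrite expf_neq0.
have fin y s c : y != 0 -> s != 0 -> M (y * s ^+ 2 - N * c) -> U c -> O (s ^+ 2 / q%:R ^+ 3) ->
    O (y^-1 / q%:R ^+ 3).
  move=> y0 s0 My Uc' Os.
  have Uy : U (y * s ^+ 2).
    by apply: (@vunit_eqmax _ V (N * c)); [exact: vunitM | rewrite vmax_sym].
  have -> : y^-1 / q%:R ^+ 3 = (s ^+ 2 / q%:R ^+ 3) * (y * s ^+ 2)^-1.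
    by field; rewrite y0 q0 s0.
  by apply: vringM => //; exact: vunitVr.
have nz y s c : M (y * s ^+ 2 - N * c) -> U c -> y != 0.
  move=> My Uc'; apply: contraTneq My => ->; rewrite mul0r sub0r.
  apply/negP => /vmaxN; rewrite opprK => MN.
  by have := vunit_nmax (vunitM UN Uc'); rewrite MN.
have Xd1 (x : algC) : x ^+ d.-1 = x * x ^+ e * x ^+ e by rewrite dE -addnn exprS exprD mulrA.
have Xd (x : algC) : x ^+ d = x ^+ 2 * x ^+ e * x ^+ e by rewrite {1}dE2 -addnn !exprS exprD expr0; ring.
have Td : T = (N * N ^+ e * N ^+ e) / (P * P ^+ e * P ^+ e) ^+ 2.
  by rewrite TE expr_div_n exprAC !Xd1.
have e4 : 4%:R != 0 :> algC by rewrite pnatr_eq0.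
have e8 : 8%:R != 0 :> algC by rewrite pnatr_eq0.
elim: n => [|n [s [c [srat s0 My cE [Oy y0]]]]].
  (* With d - 1 = 2e + 1, the factor T B^2 is N (N^e / P^d)^2. *)
  exists (P ^+ d / N ^+ e), (- (2%:R * d%:R) / 4%:R ^+ 2).
  have sr : P ^+ d / N ^+ e \in Crat by rewrite rpred_div ?rpredX.
  have s0 : P ^+ d / N ^+ e != 0 by rewrite mulf_neq0 ?invr_eq0 ?expf_neq0.
  have M1 : M (iter 1 g ka * (P ^+ d / N ^+ e) ^+ 2 - N * (- (2%:R * d%:R) / 4%:R ^+ 2)).
    rewrite /= GE hornerD hornerC hornerZ.
    have -> : (1 + T * F.[ka]) * (P ^+ d / N ^+ e) ^+ 2 - N * (- (2%:R * d%:R) / 4%:R ^+ 2) =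
        (P ^+ d) ^+ 2 / (N ^+ e) ^+ 2 + N * (F.[ka] / B ^+ 2 + d%:R / 8%:R).
      rewrite Td BE !Xd.
      by field; rewrite P0 Pe Ne.
    apply: vmaxD.
      apply: vmaxMr; first by apply: vmaxX => //; apply: vmaxX.
      by apply: vunitVr; do 2!apply: vunitX.
    by apply: vmaxMl => //; exact: vunit_ring.
  have Uc1 : U (- (2%:R * d%:R) / 4%:R ^+ 2) by apply: Uc; left.
  have y0 := nz _ _ _ M1 Uc1.
  split=> //; first by left.
  split=> //; apply: (fin _ _ _ y0 s0 M1 Uc1).
  have -> : (P ^+ d / N ^+ e) ^+ 2 / q%:R ^+ 3 = (P / q%:R) ^+ 3 * P ^+ (d + d - 3) * (N ^+ e) ^- 2.
    have -> : (P ^+ d / N ^+ e) ^+ 2 = P ^+ 3 * P ^+ (d + d - 3) * (N ^+ e) ^- 2.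
      by rewrite -exprD subnKC ?expr_div_n -?exprM ?muln2 ?addnn //; move: d2; clear; lia.
    rewrite expr_div_n; ring.
  apply: vringM; last by apply/vunitVr/vunitX/vunitX.
  by apply: vringM => //; exact: vringX.
set y := iter n.+1 g ka in My Oy y0.
have MF := F_big Oy y0.
have yd : y ^+ e.+1 != 0 by rewrite expf_neq0.
have sr : P ^+ d.-1 / (N ^+ e * y ^+ e.+1) \in Crat.
  by rewrite rpred_div ?rpredX ?rpredM ?rpredX // iterR.
have s1 : P ^+ d.-1 / (N ^+ e * y ^+ e.+1) != 0.
  by rewrite mulf_neq0 ?invr_eq0 ?mulf_neq0 ?expf_neq0.
have Oyi : O y^-1.
  have -> : y^-1 = y^-1 / q%:R ^+ 3 * q%:R ^+ 3 by rewrite divfK // expf_neq0.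
  by apply: vringM => //; apply/vringX/vring_nat.
have Osq i j : (0 < j)%N -> O (P ^+ i / (N ^+ e * y ^+ j) / q%:R ^+ 3).
  move=> j0; have -> : P ^+ i / (N ^+ e * y ^+ j) / q%:R ^+ 3 =
      P ^+ i / N ^+ e * y^-1 ^+ j.-1 * (y^-1 / q%:R ^+ 3).
    rewrite -{1}(prednK j0) exprS exprVn; have h : y ^+ j.-1 != 0 by rewrite expf_neq0.
    by field; rewrite Ne y0 h q0.
  apply: vringM => //; apply: vringM; last exact: vringX.
  by apply: vringM => //; apply/vunitVr/vunitX.
have Os1 i j : O (P ^+ i / (N ^+ e * y ^+ j)).
  have -> : P ^+ i / (N ^+ e * y ^+ j) = P ^+ i / N ^+ e * y^-1 ^+ j by rewrite exprVn invfM mulrA.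
  apply: vringM; last exact: vringX.
  by apply: vringM => //; apply/vunitVr/vunitX.
exists (P ^+ d.-1 / (N ^+ e * y ^+ e.+1)), 1.
have M1 : M (iter n.+2 g ka * (P ^+ d.-1 / (N ^+ e * y ^+ e.+1)) ^+ 2 - N * 1).
  rewrite iterS -/y GE hornerD hornerC hornerZ.
  have -> : (1 + T * F.[y]) * (P ^+ d.-1 / (N ^+ e * y ^+ e.+1)) ^+ 2 - N * 1 =
     (P ^+ d.-1 / (N ^+ e * y ^+ e.+1)) ^+ 2 + N * (F.[y] / y ^+ d - 1).
    have h : y ^+ e != 0 by rewrite expf_neq0.
    rewrite Td !Xd !Xd1 [y ^+ e.+1]exprS.
    by field; rewrite P0 Pe Ne y0 h.
  apply: vmaxD; last by apply: vmaxMl => //; exact: vunit_ring.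
  have -> : P ^+ d.-1 = P * P ^+ (e.*2) by rewrite dE exprS.
  apply: vmaxX => //; rewrite -mulrA; apply: vmaxMr => //.
have y1 := nz _ _ _ M1 (vunit1 V).
split=> //; first by right.
split=> //; apply: (fin _ _ _ y1 s1 M1 (vunit1 V)).
rewrite expr2 -mulrA; apply: vringM => //; exact: Osq.
Qed.

End BigOrbit.

(** * The rational data *)

Lemma common_den (L : seq rat) : exists2 W : nat, (0 < W)%N &
  forall x, x \in L -> exists z : int, W%:R * x = z%:~R.
Proof.
elim: L => [|a L [W W0 IH]]; first by exists 1%N.
have [b bE] : exists b : nat, denq a = b by exists (absz (denq a)); rewrite absz_denq.
have b0 : (0 < b)%N by have := denq_gt0 a; rewrite bE.
exists (W * b)%N => [|x]; first by rewrite muln_gt0 W0.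
rewrite inE => /orP[/eqP ->|/IH[z zE]]; last first.
  by exists (b%:Z * z); rewrite natrM mulrAC zE mulrC -[b%:R]/((b%:Z)%:~R) -intrM.
exists (W%:Z * numq a); rewrite natrM -mulrA intrM; congr (_ * _).
have bn : b%:R != 0 :> rat by rewrite pnatr_eq0 -lt0n.
by apply: (mulIf (_ : b%:R^-1 != 0)); rewrite ?invr_eq0 // mulrAC mulfV // mul1r -{1}[a]divq_num_den bE.
Qed.

(** Only the part of a common denominator prime to p r is kept, as N must be prime to p r; the
    discarded part is a unit at every other prime. *)
Lemma den_away (p r : nat) (L : seq rat) : prime p -> prime r -> exists W : nat,
  [/\ (0 < W)%N, coprime W (p * r) & forall x, x \in L -> forall q (V : place q), prime q ->
     q != p -> q != r -> vring V (W%:R * ratr x)].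
Proof.
move=> pp rp; have [W0 W00 WL] := common_den L.
pose pi : nat_pred := [pred q | (q == p) || (q == r)].
exists (W0`_(pi^'))%N; split; first exact: part_gt0.
  rewrite coprimeMr ![coprime (W0`_ _) _]coprime_sym.
  by rewrite !(pnat_coprime (pi := pi)) ?part_pnat // pnatE // !inE eqxx ?orbT.
move=> x xL q V qp nqp nqr; have [z zE] := WL x xL.
have U1 : vunit V (W0`_pi)%N%:R.
  apply: vunit_coprime; rewrite prime_coprime //; apply/negP => qW.
  have := pnat_dvd qW (part_pnat pi W0); rewrite pnatE // !inE.
  by rewrite (negbTE nqp) (negbTE nqr).
rewrite -(vringM_unit _ U1) mulrA -natrM partnC //.
have -> : W0%:R * ratr x = z%:~R :> algC by rewrite -(rmorph_nat (ratr : {rmorphism rat -> algC})) -rmorphM /= zE rmorph_int.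
exact: vring_int.
Qed.

Lemma ratr_I1 (k u : nat) (A B : rat) : ratr (I1 k u A B) = I1 k u (ratr A) (ratr B) :> algC.
Proof.
rewrite /I1 /hsq !big_cons !big_nil /= !rmorphD !fmorph_div /= !rmorphM /= !rmorph_nat rmorph1 rmorph0.
by [].
Qed.

Lemma ratr_I0 (k u : nat) (A B : rat) : ratr (I0 k u A B) = I0 k u (ratr A) (ratr B) :> algC.
Proof.
rewrite /I0 /hsq !big_cons !big_nil /= !rmorphD !fmorph_div /= !rmorphM /= !rmorph_nat rmorph1 rmorph0.
by [].
Qed.

Section Core.

Variables (k u p r : nat).
Hypothesis p_pr : prime p.
Hypothesis r_pr : prime r.
Hypothesis pE : p = (k + u).+2.
Hypothesis u3 : (3 < u)%N.
Hypothesis uk2 : (u.+2 < k)%N.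
Hypothesis r_big : (4 * (2 * k + 2) < r)%N.
Local Notation d := (2 * k + 2)%N.

Definition A1 : rat := (2 * d)%:R^-1.
Definition B1 : rat := (p%:R * r%:R)^-1.
Definition kap : rat := I1 k u A1 B1 / I0 k u A1 B1.
Definition FQ := Fint k u A1 B1 kap.
Definition hQ : {poly rat} := 'X^k + A1 *: 'X^u + B1%:P.

Let A : algC := ratr A1.
Let B : algC := ratr B1.
Let c : algC := ratr kap.
Local Notation F := (Fint k u A B c).
Local Notation h := ('X^k + A *: 'X^u + B%:P : {poly algC}).

Lemma FQ_map : map_poly ratr FQ = F. Proof. exact: map_Fint. Qed.

Lemma hQ_map : map_poly ratr hQ = h.
Proof. by rewrite /hQ !rmorphD /= map_polyZ !map_polyXn map_polyC. Qed.

Lemma cE : c = I1 k u A B / I0 k u A B.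
Proof. by rewrite -ratr_I1 -ratr_I0 -fmorph_div. Qed.

Lemma AE : A = (2 * d)%:R^-1. Proof. by rewrite /A /A1 fmorphV rmorph_nat. Qed.
Lemma BE : B = (p%:R * r%:R)^-1. Proof. by rewrite /B /B1 fmorphV rmorphM /= !rmorph_nat. Qed.

Lemma dA : d%:R * (2%:R * A) = 1.
Proof. by rewrite mulrA AE -natrM mulnC mulfV // pnatr_eq0 muln_eq0 addnS. Qed.

Lemma p_neq_r : p != r.
Proof. by rewrite neq_ltn pE; move: r_big uk2; clear; lia. Qed.

(** It holds at r because r > 4d, and at p because 2p > d; all denominators met in F are of this
    kind. *)
Definition nice q (V : place q) := forall n, (0 < n)%N -> (n <= d)%N -> n != p -> vunit V n%:R.

Lemma nice_r (V : place r) : nice V.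
Proof.
move=> n n0 nd _; rewrite vunit_nat //; apply/negP => /(dvdn_leq n0).
by move: nd r_big; clear; lia.
Qed.

Lemma nice_p (V : place p) : nice V.
Proof.
move=> n n0 nd np; rewrite vunit_nat //; apply/negP => /dvdnP[[|[|m]] nE].
- by rewrite nE in n0.
- by rewrite nE mul1n eqxx in np.
by move: nd; rewrite nE pE; move: u3; clear; nia.
Qed.

Section Loc.

Variables (q : nat) (V : place q) (be : algC).
Hypothesis q_pr : prime q.
Hypothesis Bbe : B = be / q%:R.
Hypothesis Ube : vunit V be.
Hypothesis nc : nice V.
Hypothesis Oku2 : vring V (q%:R / (k + u).+2%:R).

Let arith (n : nat) : (0 < n)%N -> (n <= d)%N -> n != (k + u).+2 -> vunit V n%:R.
Proof. by rewrite -pE; apply: nc. Qed.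
Local Ltac ar := apply: arith; move: u3 uk2; clear; lia.
Let Ud : vunit V d%:R. Proof. ar. Qed.
Let U2 : vunit V 2%:R. Proof. ar. Qed.
Let Uk1 : vunit V (2 * k).+1%:R. Proof. ar. Qed.
Let Uku1 : vunit V (k + u).+1%:R. Proof. ar. Qed.
Let Uu1 : vunit V (2 * u).+1%:R. Proof. ar. Qed.
Let Uu2 : vunit V (2 * u).+2%:R. Proof. ar. Qed.
Let Uk1' : vunit V k.+1%:R. Proof. ar. Qed.
Let Uk2' : vunit V k.+2%:R. Proof. ar. Qed.
Let Uu1' : vunit V u.+1%:R. Proof. ar. Qed.
Let Uu2' : vunit V u.+2%:R. Proof. ar. Qed.
Let UA2 : vunit V (2%:R * A).
Proof. by rewrite -(vunitMr _ Ud) dA vunit1. Qed.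
Let u_gt0 : (0 < u)%N. Proof. by move: u3; clear; lia. Qed.
Let uk : (u < k)%N. Proof. by move: uk2; clear; lia. Qed.

Lemma loc_U2 : vunit V 2%:R. Proof. exact: U2. Qed.
Lemma loc_U3 : vunit V 3%:R. Proof. ar. Qed.
Lemma loc_Ud : vunit V d%:R. Proof. exact: Ud. Qed.
Lemma loc_near x : vmax V (x - 1) -> exists2 e, vunit V e & x - 1 = e * (F.[x] * q%:R ^+ 2).
Proof. exact: (near1 q_pr Bbe Ube UA2 Ud U2 Uk1 Uku1 Oku2 Uu1 Uu2 Uk1' Uk2' Uu1' Uu2' cE). Qed.
Lemma loc_c : vmax V (2%:R * c - 1) /\ vring V c.
Proof. exact: (c_half q_pr Bbe Ube UA2 Ud U2 Uk1 Uku1 Oku2 Uu1 Uu2 Uk1' Uk2' Uu1' Uu2' cE). Qed.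
Lemma loc_I0 : I0 k u A B != 0.
Proof. by have [] := (I0_unit q_pr Bbe Ube UA2 Ud U2 Uk1 Uku1 Oku2 Uu1 Uu2 Uk1' Uk2' Uu1' Uu2'). Qed.
Lemma loc_coef i : vring V (q%:R ^+ 2 * F`_i).
Proof. exact: (F_coef_vring q_pr Bbe Ube UA2 Ud U2 Uk1 Uku1 Oku2 Uu1 Uu2 Uk1' Uk2' Uu1' Uu2' cE). Qed.
Lemma loc_Fc : vmax V (F.[c] / B ^+ 2 + d%:R / 8%:R).
Proof. exact: (F_at_c q_pr Bbe Ube UA2 Ud U2 Uk1 Uku1 Oku2 Uu1 Uu2 Uk1' Uk2' Uu1' Uu2' cE). Qed.

Section LocFiber.
Variables (ep : algC) (s : seq algC).
Hypothesis Mep : vmax V ep.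
Hypothesis Fs : F - ep%:P = \prod_(z <- s) ('X - z%:P).
Lemma loc_ex : exists2 z, z \in s & vmax V (z - 1).
Proof. exact: (fiber_ex1 q_pr Bbe Ube UA2 Ud U2 Uk1 Uku1 Oku2 Uu1 Uu2 Uk1' Uk2' Uu1' Uu2' cE Mep Fs). Qed.
Lemma loc_uniq z z' : uniq s -> z \in s -> z' \in s -> vmax V (z - 1) -> vmax V (z' - 1) -> z = z'.
Proof. exact: (fiber_uniq1 q_pr Bbe Ube UA2 Ud U2 Uk1 Uku1 Oku2 Uu1 Uu2 Uk1' Uk2' Uu1' Uu2' cE Mep Fs). Qed.
Lemma loc_cases z : z \in s -> [\/ vmax V z, vmax V (z - 1) | ~~ vring V z].
Proof. exact: (fiber_cases q_pr Bbe Ube UA2 Ud U2 Uk1 Uku1 Oku2 Uu1 Uu2 Uk1' Uk2' Uu1' Uu2' cE Mep Fs). Qed.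
Lemma loc_count : count (vmax V) s = 1%N /\ count (vring V) s = 2%N.
Proof. exact: (fiber_count0 q_pr Bbe Ube UA2 Ud U2 Uk1 Uku1 Oku2 Uu1 Uu2 Uk1' Uk2' Uu1' Uu2' cE Mep Fs). Qed.
Lemma loc_scale_k z : vunit V (k + u).+2%:R -> z \in s -> ~~ vring V z -> vunit V (z ^+ k * q%:R).
Proof.
move=> U1 zs nO.
apply: (fiber_scale_k q_pr u_gt0 uk Bbe Ube UA2 Ud U2 Uk1 Uku1 Oku2 Uu1 Uu2 Uk1' Uk2' Uu1' Uu2' cE
  (w := k.-root q%:R) Fs Mep U1 _ zs nO).
by rewrite rootCK // (leq_ltn_trans _ uk).
Qed.
Lemma loc_mid w : q = (k + u).+2 -> w ^+ (k + u) = q%:R ->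
  count (fun z => vmax V (w * z)) s = 2%N /\ count (fun z => vring V (w * z)) s = (k + u).+2.
Proof.
move=> qE; exact: (fiber_mid q_pr u_gt0 uk Bbe Ube UA2 Ud U2 Uk1 Uku1 Oku2 Uu1 Uu2 Uk1' Uk2' Uu1' Uu2' cE
  qE Fs Mep).
Qed.
Lemma loc_large w : q = (k + u).+2 -> w ^+ (k - u) = q%:R ->
  [/\ count (fun z => vmax V (w * z)) s = (k + u).+2, count (fun z => vring V (w * z)) s = (2 * k).+2 &
   forall z, z \in s -> vunit V (w * z) -> vmax V (z ^+ (k - u) * q%:R + 1)].
Proof.
move=> qE; exact: (fiber_large q_pr u_gt0 uk Bbe Ube UA2 Ud U2 Uk1 Uku1 Oku2 Uu1 Uu2 Uk1' Uk2' Uu1' Uu2' cE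
  qE dA Fs Mep).
Qed.

Lemma loc_phi_r y : vunit V (k + u).+2%:R -> y \in s ->
  vunit V ((1 + y) ^+ k * q%:R ^+ (~~ vring V y)).
Proof.
by move=> U1 ys; apply: phi_r_unit => //; [exact: loc_cases | exact: loc_scale_k].
Qed.

(** The roots of a fiber at p fall into 2 integral, k + u intermediate and k - u large ones; the
    inclusions between the scaled counts are turned into equalities by cardinality. *)
Lemma loc_phi_p w : q = (k + u).+2 -> w ^+ (k + u) = q%:R -> size s = d ->
  count (fun y => vunit V (w * y)) s = (k + u)%N /\
  forall y, y \in s -> vunit V (phip q (k - u) y ^+ (k + u) * q%:R ^+ (vunit V (w * y))).
Proof.
move=> qE wE szs; have [cM cO] := loc_mid qE wE.
have ku0 : (0 < k + u)%N by move: u3; clear; lia.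
have kmu0 : (0 < k - u)%N by rewrite subn_gt0.
have Mw : vmax V w by apply: (@vmaxX_inv _ V w (k + u)); rewrite wE vmax_char.
have w0 : w != 0.
  have q0 : q%:R != 0 :> algC by exact: vchar_neq0.
  by apply: contraNneq q0 => w0; rewrite -wE w0 expr0n gtn_eqF.
pose w2 := (k - u).-root (q%:R : algC).
have w2E : w2 ^+ (k - u) = q%:R by rewrite rootCK.
have [cM2 cO2 big] := loc_large qE w2E.
have [_ c2] := loc_count.
have Mr : vmax V (w2 / w).
  apply: (@vmaxX_inv _ V _ ((k - u) * (k + u))).
  rewrite expr_div_n exprM w2E [((k - u) * _)%N]mulnC exprM wE.
  have -> : q%:R ^+ (k + u) / q%:R ^+ (k - u) = q%:R ^+ (2 * u) :> algC.
    have -> : (k + u = 2 * u + (k - u))%N by move: uk; clear; lia.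
    by rewrite exprD mulfK // expf_neq0 // vchar_neq0.
  by apply: vmaxX; [exact: vmax_char | move: u3; clear; lia].
split.
  have : (count (fun z => vring V (w * z)%R) s =
     count (fun z => vmax V (w * z)%R) s + count (fun y => vunit V (w * y)%R) s)%N.
    elim: (s) => //= z l ->; rewrite /vunit; case Mz: (vmax V (w * z)).
      by rewrite (vmaxW Mz) /= add0n addnA.
    by rewrite andbT add0n addnCA.
  by rewrite cM cO add2n => -[->].
move=> y ys; apply: (@phip_unit _ V k u w y) => //.
- by move: u3; clear; lia.
- exact: loc_U3.
- exact: loc_cases.
- move=> nO Ow; rewrite /vunit Ow /=; apply: contra nO.
  apply: (count_sub_eq (P := vring V) (P' := fun z => vmax V (w * z)) _ _ ys); last by rewrite c2 cM.
  by move=> x Ox; apply: vmaxMr.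
move=> nO; apply: big => //; apply/andP; split.
  have /allP : all (fun z => vring V (w2 * z)) s by rewrite all_count cO2 szs addn2.
  by apply.
apply: contra nO.
apply: (count_sub_eq (P := fun z => vring V (w * z)) (P' := fun z => vmax V (w2 * z)) _ _ ys); last by rewrite cO cM2.
move=> x Ox; have -> : w2 * x = w2 / w * (w * x) by rewrite mulrA divfK.
exact: vmaxMr.
Qed.

End LocFiber.
End Loc.

(** A nonzero double root satisfies k z^(k-u) = -A u, so it is integral at r, and then so is B =
    -(z^k + A z^u), against the choice of B. *)
Lemma h_no_common_root (z : algC) : root h z -> h^`().[z] != 0.
Proof.
move=> /eqP hz; apply/eqP => dz; have [V] := place_exists r_pr.
have r0 : r%:R != 0 :> algC by rewrite pnatr_eq0 -lt0n prime_gt0.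
have p0 : p%:R != 0 :> algC by rewrite pnatr_eq0 -lt0n prime_gt0.
have nB : ~~ vring V B.
  apply/negP => OB; have := vmaxMl OB (vmax_char V); rewrite BE invfM mulfVK // => Mp.
  have : vunit V p%:R^-1.
    apply: vunitV; rewrite vunit_nat // dvdn_prime2 // eq_sym; exact: p_neq_r.
  by move/vunit_nmax; rewrite Mp.
move: dz hz; rewrite !derivD derivZ !derivXn derivC addr0 !(hornerD, hornerZ, hornerMn, hornerXn, hornerC) => dz hz.
have u0 : (0 < u)%N by move: u3; clear; lia.
have [z0|z0] := eqVneq z 0.
  move: hz; rewrite z0 !expr0n !gtn_eqF //; last by move: uk2; clear; lia.
  by rewrite mulr0 !add0r => B0; rewrite B0 vring0 in nB.
have E : z ^+ (k - u) * k%:R = - (A * u%:R).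
  have zu : z ^+ u.-1 != 0 by rewrite expf_neq0.
  apply: (mulfI zu); apply/eqP; rewrite -subr_eq0 -dz; apply/eqP.
  have -> : k.-1 = (u.-1 + (k - u))%N by move: u0 uk2; clear; lia.
  by rewrite exprD -(mulr_natr (_ * _) k) -(mulr_natr (z ^+ _) u); ring.
have nn n : (0 < n)%N -> (n <= d)%N -> vunit V n%:R.
  move=> n0 nd; rewrite vunit_nat //; apply/negP => /(dvdn_leq n0).
  by move: nd r_big; clear; lia.
have UA : vunit V A.
  have := dA; rewrite mulrA -natrM => dA'.
  have U2d : vunit V (d * 2)%:R by rewrite vunit_nat //; apply/negP => /dvdn_leq; move: r_big; clear; lia.
  by rewrite -(vunitMr _ U2d) dA' vunit1.
have Uk : vunit V k%:R by apply: nn; move: uk2; clear; lia.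
have Oz : vring V z.
  apply: (@vringX_inv _ V z (k - u)); first by move: uk2; clear; lia.
  rewrite -(vringM_unit _ Uk) mulrC E; apply: vringN; apply: vringM; first exact: vunit_ring.
  exact: vring_nat.
have OA := vunit_ring UA.
case/negP: nB; have -> : B = - (z ^+ k + A * z ^+ u) by apply/eqP; rewrite -addr_eq0 addrC hz.
by apply: vringN; apply: vringD; [exact: vringX | apply: vringM => //; exact: vringX].
Qed.

Lemma hQ_bezout : exists aQ bQ : {poly rat}, aQ * hQ + bQ * hQ^`() = 1.
Proof.
have : coprimep hQ hQ^`().
  rewrite -(coprimep_map (ratr : {rmorphism rat -> algC})) -deriv_map hQ_map.
  exact: (Pdiv.ClosedField.root_coprimep h_no_common_root).
by case/Bezout_eq1_coprimepP => -[a b] /= E; exists a, b.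
Qed.

(** [kap] is integral at r by [loc_c], so vanishing would make B integral there. *)
Lemma hQ_kap : hQ.[kap] != 0.
Proof.
have [V] := place_exists r_pr.
have r0 : r%:R != 0 :> algC by rewrite pnatr_eq0 -lt0n prime_gt0.
have Up : vunit V p%:R^-1.
  by apply: vunitV; rewrite vunit_nat // dvdn_prime2 // eq_sym; exact: p_neq_r.
have Bbe : B = p%:R^-1 / r%:R by rewrite BE invfM.
have Uku2 : vunit V (k + u).+2%:R by rewrite -pE -[p%:R]invrK; apply: vunitV.
have Oku2 : vring V (r%:R / (k + u).+2%:R) by apply: vringM; [exact: vring_nat | exact: vunitVr].
have [_ Oc] := loc_c r_pr Bbe Up (@nice_r V) Oku2.
rewrite -(fmorph_eq0 (ratr : {rmorphism rat -> algC})) -horner_map hQ_map.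
rewrite !(hornerD, hornerZ, hornerXn, hornerC) -/c; apply/eqP => E.
have OA : vring V A.
  have U2 := loc_U2 (@nice_r V); have Ud := loc_Ud (@nice_r V).
  by apply: vunit_ring; rewrite -(vunitMr _ U2) -(vunitMr _ Ud) dA vunit1.
have OB : vring V B.
  have -> : B = - (c ^+ k + A * c ^+ u) by apply/eqP; rewrite -addr_eq0 addrC; apply/eqP; exact: E.
  by apply: vringN; apply: vringD; [exact: vringX | apply: vringM => //; exact: vringX].
by have := vmaxMl OB (vmax_char V); rewrite Bbe divfK // (vunit_nmax Up).
Qed.

End Core.

(** * Automorphisms of the preimage tree *)

Lemma horner_ext (R : numFieldType) (P Q : {poly R}) : (forall w, P.[w] = Q.[w]) -> P = Q.
Proof.
move=> PQ; apply/eqP; rewrite -subr_eq0; apply: contraT => nz.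
pose rs := [seq (i%:R : R) | i <- iota 0 (size (P - Q))].
have := @max_poly_roots _ (P - Q) rs nz; rewrite size_map size_iota ltnn; apply.
  by apply/allP => _ /mapP[i _ ->]; rewrite /root hornerD hornerN PQ subrr.
by rewrite map_inj_uniq ?iota_uniq // => i j /eqP; rewrite eqr_nat => /eqP.
Qed.

Lemma prod_scale_sub (K : fieldType) (a w : K) (s : seq K) : a != 0 ->
  \prod_(x <- s) (w / a - x) = a ^- size s * \prod_(x <- s) (w - a * x).
Proof.
move=> a0; elim: s => [|x s IH]; first by rewrite !big_nil expr0 invr1 mulr1.
rewrite !big_cons IH /= exprS; have as0 : a ^+ size s != 0 by rewrite expf_neq0.
by field; rewrite as0.
Qed.

Section TreeSurjection.

Variables (F : {poly rat}) (D : rat) (d : nat) (fib : algC -> seq algC).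
Hypothesis D0 : D != 0.
Hypothesis d_gt0 : (0 < d)%N.
Hypothesis F0 : F.[0] = 0.
Hypothesis F1 : F.[1] = 0.
Let DC : algC := ratr D.
Local Notation G := (map_poly ratr (1 + D ^+ d.-1 *: F) : {poly algC}).
Local Notation g := (horner G).
Local Notation Lev := (Lev fib).
Hypothesis mem_fib : forall a y, (y \in fib a) = (G.[y] == a).
Hypothesis size_fib : forall a, size (fib a) = d.
Hypothesis fibE : forall a, G - a%:P = (DC ^+ d.-1) *: \prod_(y <- fib a) ('X - y%:P).
Hypothesis uniq_Lev : forall n, uniq (Lev n).
Hypothesis swaps : forall n, all_swaps g fib n.+1.

Definition f_of : {poly rat} := D%:P + D ^+ d *: (F \Po (D^-1 *: 'X)).
Local Notation f := f_of.
Let fC : {poly algC} := map_poly ratr f.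

Let DC0 : DC != 0. Proof. by rewrite fmorph_eq0. Qed.

Lemma deriv_f_of : f^`() = D ^+ d.-1 *: (F^`() \Po (D^-1 *: 'X)).
Proof.
rewrite derivD derivC add0r derivZ deriv_comp derivZ derivX alg_polyC mulrC mul_polyC scalerA.
by rewrite -{1}(prednK d_gt0) exprSr mulfK.
Qed.

Lemma f_of_at0 : f.[0] = D.
Proof. by rewrite hornerD hornerC hornerZ horner_comp hornerZ hornerX mulr0 F0 mulr0 addr0. Qed.

Let g_aut (nu : autC) x : nu G.[x] = G.[nu x].
Proof. by rewrite -{2}(map_ratr_gal nu) horner_map. Qed.

Let fC_aut (nu : autC) x : nu fC.[x] = fC.[nu x].
Proof. by rewrite /fC -{2}(map_ratr_gal nu) horner_map. Qed.

Lemma f_conj x : fC.[DC * x] = DC * G.[x].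
Proof.
rewrite /fC /f rmorphD /= map_polyC map_polyZ map_comp_poly map_polyZ map_polyX.
rewrite rmorphD rmorph1 /= map_polyZ !(hornerD, hornerC, hornerZ) horner_comp hornerZ hornerX.
rewrite fmorphV mulKf // !rmorphXn mulrDr mulr1 mulrA -exprS prednK //.
Qed.

Lemma f_iter n x : iter n (horner fC) (DC * x) = DC * iter n g x.
Proof. by elim: n => //= n ->; rewrite f_conj. Qed.

Lemma map_poly_iter n : map_poly ratr (poly_iter f n) = poly_iter fC n.
Proof. by elim: n => [|n IH]; rewrite /poly_iter /= ?map_polyX // map_comp_poly -/(poly_iter f n) IH. Qed.

Lemma root_iter n z : root (map_poly ratr (poly_iter f n)) z = (iter n (horner fC) z == 0).
Proof. by rewrite map_poly_iter /root horner_poly_iter. Qed.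

Lemma Lev_root n x : (x \in Lev n) = (iter n (horner fC) (DC * x) == 0).
Proof. by rewrite (mem_Lev mem_fib) f_iter mulf_eq0 (negbTE DC0). Qed.

Let fC_at0 : fC.[0] = DC.
Proof. by rewrite -{1}(rmorph0 (ratr : {rmorphism rat -> algC})) horner_map f_of_at0. Qed.

Let G1 : G.[1] = 1.
Proof.
rewrite -{1}(rmorph1 (ratr : {rmorphism rat -> algC})) horner_map hornerD hornerC hornerZ F1 mulr0 addr0.
exact: rmorph1.
Qed.

Let fC_atD : fC.[DC] = DC.
Proof. by rewrite -{1}[DC]mulr1 f_conj G1 mulr1. Qed.

Let iter_D n : iter n (horner fC) DC = DC.
Proof. by elim: n => //= n ->. Qed.

Let iter_0 n : (0 < n)%N -> iter n (horner fC) 0 = DC.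
Proof. by case: n => // n _; rewrite iterSr fC_at0 iter_D. Qed.

Lemma f_not_periodic : ~ periodic_point f 0.
Proof.
case=> n n0 E; have : ratr (iter n (horner f) 0) = iter n (horner fC) 0 :> algC.
  by clear; elim: n => [|n /= <-]; rewrite ?rmorph0 // horner_map.
by rewrite E rmorph0 iter_0 // => /esym/eqP; rewrite (negbTE DC0).
Qed.

(** Over [algC] the n-th iterate is a constant times the product of 'X - D x over level n, which has
    no repetition. *)
Lemma f_separable n : separable_poly (poly_iter f n).
Proof.
rewrite -(separable_map (ratr : {rmorphism rat -> algC})).
have [e eE] := iter_G_prod fibE n.
pose c := DC * (DC ^+ d.-1) ^+ e / DC ^+ size (Lev n).
have c0 : c != 0.
  rewrite /c; apply: mulf_neq0; last by rewrite invr_eq0 expf_neq0.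
  by apply: mulf_neq0 => //; do 2!apply: expf_neq0.
have -> : map_poly ratr (poly_iter f n) = c *: \prod_(x <- map ( *%R DC) (Lev n)) ('X - x%:P).
  apply: horner_ext => w; rewrite map_poly_iter horner_poly_iter.
  have wE : w = DC * (w / DC) by rewrite mulrC divfK.
  have key : \prod_(a <- Lev n) (w / DC - a) = DC ^- size (Lev n) * \prod_(i <- Lev n) (w - DC * i).
    exact: prod_scale_sub.
  rewrite {1}wE f_iter eE hornerZ big_map horner_prod key.
  under [in RHS]eq_bigr do rewrite hornerXsubC.
  rewrite /c; move: (\prod_(i <- _) _) (DC ^- size _) ((DC ^+ d.-1) ^+ e) => x y z.
  by rewrite -[RHS]mulrA -[RHS]mulrA.
rewrite (eqp_separable (eqp_scale _ c0)) separable_prod_XsubC map_inj_uniq //.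
exact: mulfI.
Qed.

Section Tau.

Variable tau : tree_aut f.

Let lev n (x : vertex f) := iter n (horner fC) (val x) == 0.

Let vertex_lev (x : vertex f) : exists n, lev n x.
Proof. by have /asboolP[n] := valP x; rewrite root_iter; exists n. Qed.

Let mkv z (h : preimage_vertex f z) : vertex f := exist (fun a => is_true (preimage_vertex f a)) z h.

Let lev_vertex n z : iter n (horner fC) z == 0 -> preimage_vertex f z.
Proof. by move=> zn; apply/asboolP; exists n; rewrite root_iter. Qed.

Let lev_disj n n' x : lev n x -> lev n' x -> n = n'.
Proof.
suff H a b : (a < b)%N -> lev a x -> lev b x -> False.
  by move=> h h'; case: (ltngtP n n') => // lt; [case: (H _ _ lt h h') | case: (H _ _ lt h' h)].
move=> lt /eqP ha; rewrite /lev -(subnK (ltnW lt)) iterD ha iter_0 ?subn_gt0 //.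
by rewrite (negbTE DC0).
Qed.

Let not_D (x : vertex f) : val x != DC.
Proof.
have [n] := vertex_lev x; rewrite /lev; apply: contraTneq => ->.
by rewrite iter_D.
Qed.

Let parent n x : lev n.+1 x -> {y : vertex f | val y = fC.[val x] & lev n y}.
Proof.
rewrite /lev iterSr => hx; exists (mkv (@lev_vertex _ _ hx)) => //.
Qed.

Let tau_inj : injective tau. Proof. exact: bij_inj (tree_aut_bij tau). Qed.

(** Adjacency is undirected, so the direction of edges has to be recovered. A reversed edge would
    make [tau x] the parent of [tau y], hence x the parent of y, contradicting levels; at the root
    it would make D a vertex, but D is a fixed point of f and never reaches 0. *)
Let tau_lev n : (forall x, lev n x -> lev n (tau x)) /\
  (forall x y, lev n.+1 x -> val y = fC.[val x] -> val (tau y) = fC.[val (tau x)]).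
Proof.
elim: n => [|n [IH1 IH2]].
  have h0 x : lev 0 x -> x = root_vertex f by move=> /eqP E; apply: val_inj.
  split=> [x /h0 ->|x y hx yE]; first by rewrite tree_aut_root /lev /=.
  have y0 : y = root_vertex f by apply: h0; rewrite /lev /= yE; move: hx; rewrite /lev iterSr.
  have : adjacent x y by rewrite /adjacent yE eqxx.
  rewrite -(tree_aut_adj tau) /adjacent => /orP[/eqP <- //|/eqP E].
  have := not_D (tau x); rewrite -E y0 tree_aut_root /= fC_at0 eqxx //.
have H1 x : lev n.+1 x -> lev n.+1 (tau x).
  move=> hx; have [y yE hy] := parent hx.
  by have := IH1 y hy; rewrite /lev (IH2 x y hx yE) -iterSr.
split=> // x y hx yE.
have hy : lev n.+1 y by move: hx; rewrite /lev yE -iterSr.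
have : adjacent x y by rewrite /adjacent yE eqxx.
rewrite -(tree_aut_adj tau) /adjacent => /orP[/eqP <- //|/eqP E].
have [z zE hz] := parent hy.
have E' : tau x = tau z by apply: val_inj; rewrite -E -(IH2 y z hy zE).
have xz := tau_inj E'; rewrite xz in hx; have := lev_disj hx hz => /eqP.
by rewrite eqn_leq ltnNge leqnSn.
Qed.

Let tauv (z : algC) : algC := if insub z is Some v then val (tau v) else z.

Let tauvE (v : vertex f) : tauv (val v) = val (tau v).
Proof. by rewrite /tauv valK. Qed.

Let Lev_vertex n x : x \in Lev n -> {v : vertex f | val v = DC * x & lev n v}.
Proof. by rewrite Lev_root => hx; exists (mkv (@lev_vertex _ _ hx)). Qed.

Let level_realized n : exists nu : autC, forall v, lev n v -> nu (val v) = val (tau v).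
Proof.
elim: n => [|n [nu nuE]].
  exists idfun => v /eqP E; have -> : v = root_vertex f by apply: val_inj.
  by rewrite tree_aut_root.
have nuD (mu : autC) : mu DC = DC by rewrite /DC fmorph_rat.
(* After undoing an automorphism that agrees with [tau] one level above, [tau] only permutes
   siblings, and such permutations are realized. *)
pose t x := autC_inv nu (tauv (DC * x)) / DC.
have tP x : x \in Lev n.+1 -> exists2 v : vertex f, val v = DC * x /\ lev n.+1 v & DC * t x = autC_inv nu (val (tau v)).
  move=> xL; have [v vE hv] := Lev_vertex xL; exists v => //.
  by rewrite /t -vE tauvE mulrC divfK.
have [||mu muE] := realized_fiber_perm (t := t) mem_fib uniq_Lev (@swaps n).
- move=> x xL; have [v [vE hv] tE] := tP x xL; have [y yE hy] := parent hv.
  apply: (mulfI DC0); rewrite -!f_conj tE -vE -fC_aut -(proj2 (tau_lev n) v y hv yE) -nuE // autC_invK.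
  exact: yE.
- move=> x x' xL xL' E; have [v [vE hv] tE] := tP x xL; have [v' [vE' hv'] tE'] := tP x' xL'.
  have : autC_inv nu (val (tau v)) = autC_inv nu (val (tau v')) by rewrite -tE -tE' E.
  by move/fmorph_inj/val_inj/tau_inj => vv; apply: (mulfI DC0); rewrite -vE -vE' vv.
exists (nu \o mu) => v hv.
have vE : val v = DC * (val v / DC) by rewrite mulrC divfK.
have xL : val v / DC \in Lev n.+1 by rewrite Lev_root -vE.
have [v' [v'E hv'] tE] := tP _ xL.
have <- : v' = v by apply: val_inj; rewrite v'E -vE.
by rewrite v'E /= rmorphM /= nuD muE // tE autC_invKV.
Qed.

Let descend n j (v : vertex f) : lev n v -> exists v' : vertex f,
  lev (n + j) v' /\ val v = iter j (horner fC) (val v') /\ val (tau v) = iter j (horner fC) (val (tau v')).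
Proof.
elim: j => [|j IH] hv; first by exists v; rewrite addn0.
have [v1 [h1 [e1 e2]]] := IH hv.
have [y yf] : exists y, y \in fib (val v1 / DC).
  by have := size_fib (val v1 / DC); case: (fib _) => [|y s] sz; [move: d_gt0; rewrite -sz | exists y; rewrite mem_head].
have fy : fC.[DC * y] = val v1.
  by rewrite f_conj; move: yf; rewrite mem_fib => /eqP ->; rewrite mulrC divfK.
have hy : iter (n + j).+1 (horner fC) (DC * y) == 0 by rewrite iterSr fy.
pose v2 : vertex f := mkv (@lev_vertex _ _ hy).
have h2 : lev (n + j).+1 v2 by [].
exists v2; rewrite addnS; split=> //; rewrite !iterSr /= fy -e1; split=> //.
by rewrite -(proj2 (tau_lev (n + j)) v2 v1 h2) ?fy.
Qed.

(** Finitely many vertices lie below a common level n by [descend]: each is the image under an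
    iterate of f of a vertex of level n, so agreement on that level suffices. Compactness does the
    rest. *)
Lemma tau_realized : exists s : galQ, arboreal_rep f s = tau.
Proof.
have [|nu nuE] := @autC_compact (fun x y => forall v : vertex f, val v = x -> y = val (tau v)).
  move=> s.
  have [n nP] : exists n, forall v : vertex f, val v \in s -> exists2 m, (m <= n)%N & lev m v.
    elim: s => [|x s [n IH]]; first by exists 0%N.
    have [[v vx]|nv] := pselect (exists v : vertex f, val v = x).
      have [m hm] := vertex_lev v; exists (maxn m n) => w; rewrite inE => /orP[/eqP wx|/IH[m' le h]].
        by exists m; rewrite ?leq_maxl //; have -> : w = v by apply: val_inj; rewrite wx vx.
      by exists m' => //; apply: leq_trans le (leq_maxr _ _).
    exists n => w; rewrite inE => /orP[/eqP wx|/IH //].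
    by case: nv; exists w.
  have [nu nuE] := level_realized n; exists nu => x xs v vx.
  rewrite -vx in xs *; have [m le hm] := nP v xs.
  have [v' [h' [-> ->]]] := descend (n - m) hm.
  rewrite subnKC // in h'; rewrite -nuE //.
  by elim: (n - m)%N => //= j <-; rewrite fC_aut.
exists (GalQ (autC_bij nu)); apply: tree_aut_eqP => v; apply: val_inj => /=.
exact: nuE.
Qed.

End Tau.

End TreeSurjection.

(** * Realizing all sibling transpositions *)

Section Main.

Variables (k u p r : nat).
Hypothesis p_pr : prime p.
Hypothesis r_pr : prime r.
Hypothesis pE : p = (k + u).+2.
Hypothesis u3 : (3 < u)%N.
Hypothesis uk2 : (u.+2 < k)%N.
Hypothesis ku_odd : odd (k + u).
Hypothesis r_big : (4 * (2 * k + 2) < r)%N.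
Local Notation d := (2 * k + 2)%N.
Hypothesis sq_m1 : (exists i, r %| i ^ 2 + 1)%N.
Hypothesis sq_2d : exists j w : nat,
  (r %| j ^ 2 + (r - 2 * d %% r) * w ^ 2)%N /\ ~~ (r %| w)%N.

Local Notation A1 := (A1 k).
Local Notation B1 := (B1 p r).
Local Notation kap := (kap k u p r).
Local Notation FQ := (FQ k u p r).
Local Notation hQ := (hQ k u p r).

Variables (aQ bQ : {poly rat}) (W N l m : nat).
Hypothesis bezQ : aQ * hQ + bQ * hQ^`() = 1.

(** What has to be integral at a good prime. The inverses make h(kap) and 6d units, the Bezout
    coefficients make h separable modulo the prime, and F(kap) serves at the primes dividing N. *)
Definition rat_data : seq rat :=
  [:: kap; FQ.[kap]; A1; B1; hQ.[kap]^-1; (6 * d)%:R^-1] ++ FQ ++ aQ ++ bQ.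

Hypothesis W_den : forall x, x \in rat_data -> forall q (V : place q), prime q ->
  q != p -> q != r -> vring V (W%:R * ratr x).
Hypothesis W_N : (W %| N)%N.
Hypothesis N_pr : coprime N (p * r).
Hypothesis l_pr : prime l.
Hypothesis l_W : coprime l (W * p * r).
Hypothesis N_l : N = (l * m)%N.
Hypothesis l_m : ~~ (l %| m)%N.
Hypothesis N_nonres : forall x : nat, (x ^ 2 != N %[mod r])%N.

Definition DQ : rat := N%:R / (p%:R * r%:R) ^+ 2.
Definition GQ : {poly rat} := 1 + DQ ^+ d.-1 *: FQ.

Let A : algC := ratr A1.
Let B : algC := ratr B1.
Let c : algC := ratr kap.
Local Notation F := (Fint k u A B c).
Local Notation h := ('X^k + A *: 'X^u + B%:P : {poly algC}).
Let D : algC := ratr DQ.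
Let P : algC := p%:R * r%:R.
Let T : algC := D ^+ d.-1.
Definition G : {poly algC} := 1 + T *: F.
Definition fib (a : algC) : seq algC := sval (closed_field_poly_normal (G - a%:P)).
Local Notation g := (horner G).
Local Notation Lev := (Lev fib).

Lemma GQ_map : map_poly ratr GQ = G.
Proof. by rewrite /GQ rmorphD rmorph1 /= map_polyZ FQ_map rmorphXn. Qed.

Let FQm : map_poly ratr FQ = F := FQ_map k u p r.
Let hQm : map_poly ratr hQ = h := hQ_map k u p r.

Let r0 : r%:R != 0 :> algC. Proof. by rewrite pnatr_eq0 -lt0n prime_gt0. Qed.
Let p0 : p%:R != 0 :> algC. Proof. by rewrite pnatr_eq0 -lt0n prime_gt0. Qed.
Let P0 : P != 0. Proof. by rewrite mulf_neq0. Qed.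
Let N_gt0 : (0 < N)%N.
Proof. by rewrite N_l muln_gt0 prime_gt0 //= lt0n; apply: contraNneq l_m => ->; rewrite dvdn0. Qed.
Let N0 : N%:R != 0 :> algC. Proof. by rewrite pnatr_eq0 -lt0n. Qed.
Let DE : D = N%:R / P ^+ 2.
Proof. by rewrite /D /DQ fmorph_div rmorphXn rmorphM /= !rmorph_nat. Qed.
Let D0 : D != 0. Proof. by rewrite DE mulf_neq0 // invr_eq0 expf_neq0. Qed.
Let T0 : T != 0. Proof. by rewrite expf_neq0. Qed.
Let BP : B = P^-1. Proof. exact: BE. Qed.
Let u_gt0 : (0 < u)%N. Proof. by move: u3; clear; lia. Qed.
Let uk : (u < k)%N. Proof. by move: uk2; clear; lia. Qed.
Let szF : size F = d.+1. Proof. by rewrite (lead_Fint A B c uk u_gt0).1 addnS. Qed.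
Let lcF : lead_coef F = 1. Proof. exact: (lead_Fint A B c uk u_gt0).2. Qed.
Let d5 : (5 <= d)%N. Proof. by move: uk2; clear; lia. Qed.
Let d_even : ~~ odd d. Proof. by clear; lia. Qed.
Let D_rat : D \in Crat. Proof. by apply/CratP; exists DQ. Qed.

Lemma g_aut (nu : autC) x : nu G.[x] = G.[nu x].
Proof. by rewrite -GQ_map -{2}(map_ratr_gal nu GQ) horner_map. Qed.
Lemma h_aut (nu : autC) x : nu h.[x] = h.[nu x].
Proof. by rewrite -hQm -{2}(map_ratr_gal nu hQ) horner_map. Qed.

Let lcG a : lead_coef (G - a%:P) = T.
Proof.
have -> : G - a%:P = T *: F + (1 - a)%:P by rewrite /G polyCB; ring.
rewrite lead_coefDl ?lead_coefZ ?lcF ?mulr1 //.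
by rewrite size_scale // szF; apply: leq_ltn_trans (size_polyC_leq1 _) _; rewrite ltnS addn2.
Qed.

Lemma fibE a : G - a%:P = T *: \prod_(y <- fib a) ('X - y%:P).
Proof. by rewrite /fib; case: closed_field_poly_normal => s /= {1}->; rewrite lcG. Qed.

Lemma fibF a : F - ((a - 1) / T)%:P = \prod_(y <- fib a) ('X - y%:P).
Proof.
apply: (scalerI T0); rewrite -fibE /G scalerBr -[_ *: _%:P]mul_polyC -polyCM mulrC divfK // polyCB.
by ring.
Qed.

Lemma mem_fib a y : (y \in fib a) = (G.[y] == a).
Proof. by rewrite -root_prod_XsubC -(rootZ _ _ T0) -fibE /root hornerD hornerN hornerC subr_eq0. Qed.

Lemma size_fib a : size (fib a) = d.
Proof.
have := congr1 (fun Q : {poly algC} => size Q) (fibF a).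
rewrite /= size_prod_XsubC size_polyDl szF; first by case.
by rewrite size_polyN; apply: leq_ltn_trans (size_polyC_leq1 _) _; rewrite ltnS addn2.
Qed.

Let Up_r (V : place r) : vunit V p%:R^-1.
Proof. by apply: vunitV; rewrite vunit_nat // dvdn_prime2 // eq_sym; exact: (p_neq_r pE uk2 r_big). Qed.
Let Ur_p (V : place p) : vunit V r%:R^-1.
Proof. by apply: vunitV; rewrite vunit_nat // dvdn_prime2 //; exact: (p_neq_r pE uk2 r_big). Qed.
Let Br : B = p%:R^-1 / r%:R. Proof. by rewrite BP /P invfM. Qed.
Let Bp : B = r%:R^-1 / p%:R. Proof. by rewrite BP /P invfM mulrC. Qed.
Let nr (V : place r) : nice k p V. Proof. exact: nice_r. Qed.
Let np (V : place p) : nice k p V. Proof. exact: (nice_p p_pr pE u3). Qed.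
Let Uku2_r (V : place r) : vunit V (k + u).+2%:R.
Proof. by rewrite -pE -[p%:R]invrK; apply/vunitV/Up_r. Qed.
Let Oku2_r (V : place r) : vring V (r%:R / (k + u).+2%:R).
Proof. by apply: vringM; [exact: vring_nat | apply/vunitVr/Uku2_r]. Qed.
Let Oku2_p (V : place p) : vring V (p%:R / (k + u).+2%:R).
Proof. by rewrite -pE divff // vring1. Qed.

Let F1 : F.[1] = 0.
Proof.
have [V] := place_exists r_pr; have I00 := loc_I0 pE u3 uk2 r_pr Br (Up_r V) (@nr V) (Oku2_r V).
by rewrite /c cE Fint_at1.
Qed.
Lemma G_at0 : G.[0] = 1. Proof. by rewrite /G hornerD hornerC hornerZ Fint_at0 mulr0 addr0. Qed.
Lemma G_at1 : G.[1] = 1. Proof. by rewrite /G hornerD hornerC hornerZ F1 mulr0 addr0. Qed.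

Lemma derG : G^`() = (d%:R * T) *: (('X - c%:P) * h ^+ 2).
Proof. by rewrite /G derivD derivC add0r derivZ deriv_Fint scalerA mulrC. Qed.

Let data_good q (V : place q) x : prime q -> q != p -> q != r -> ~~ (q %| W)%N -> x \in rat_data ->
  vring V (ratr x).
Proof.
move=> qp nqp nqr qW xL; have UW : vunit V W%:R by rewrite vunit_nat.
by rewrite -(vringM_unit _ UW); apply: W_den.
Qed.

Let in_F i : FQ`_i \in rat_data \/ FQ`_i = 0.
Proof.
case: (ltnP i (size FQ)) => lt; last by right; rewrite nth_default.
by left; rewrite !mem_cat mem_nth ?orbT.
Qed.

Let F_good q (V : place q) i : prime q -> q != p -> q != r -> ~~ (q %| W)%N -> vring V F`_i.
Proof.
move=> qp nqp nqr qW; rewrite -FQm coef_map; case: (in_F i) => [xL|->]; first exact: data_good.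
by rewrite raddf0; exact: vring0.
Qed.

Let l_p : l != p.
Proof.
move: l_W; rewrite !coprimeMr => /andP[/andP[_ cl] _].
by move: cl; rewrite prime_coprime // dvdn_prime2.
Qed.
Let l_r : l != r.
Proof. by move: l_W; rewrite !coprimeMr => /andP[_]; rewrite prime_coprime // dvdn_prime2. Qed.

Let UP q (V : place q) : prime q -> q != p -> q != r -> vunit V P.
Proof. by move=> qp nqp nqr; apply: vunitM; rewrite vunit_nat // dvdn_prime2. Qed.

Lemma Lev_main n : uniq (Lev n) /\
  forall x y, x \in Lev n -> y \in Lev n -> exists nu : autC, nu x = y.
Proof.
have [V] := place_exists l_pr.
apply: (@eis_main l V l_pr F G D d) => //.
- by apply: leq_trans d5.
- move=> i; apply: F_good => //; move: l_W; rewrite !coprimeMr => /andP[/andP[cl _] _].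
  by rewrite -prime_coprime.
- rewrite DE N_l natrM; have l0 : l%:R != 0 :> algC by rewrite pnatr_eq0 -lt0n prime_gt0.
  have -> : l%:R * m%:R / P ^+ 2 / l%:R = m%:R / P ^+ 2 by field; rewrite l0 P0.
  by apply: vunitM; [rewrite vunit_nat | apply/vunitV/vunitX/UP].
- exact: g_aut.
- exact: mem_fib.
exact: size_fib.
Qed.

Lemma uniq_Lev n : uniq (Lev n). Proof. by have [] := Lev_main n. Qed.
Lemma trans_Lev n x y : x \in Lev n -> y \in Lev n -> exists nu : autC, nu x = y.
Proof. by have [_] := Lev_main n; apply. Qed.

Let MT q (V : place q) : prime q -> vring V (P / q%:R) -> vunit V N%:R -> vmax V T^-1.
Proof.
move=> qp OP UN; have q0 : q%:R != 0 :> algC by rewrite pnatr_eq0 -lt0n prime_gt0.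
have MP : vmax V P.
  have -> : P = P / q%:R * q%:R by rewrite divfK.
  by apply: vmaxMl => //; exact: vmax_char.
rewrite /T -exprVn DE invf_div; apply: vmaxX; last by move: d5; clear; lia.
by apply: vmaxMr; [exact: vmaxX | exact: vunitVr].
Qed.

Let UN_r (V : place r) : vunit V N%:R.
Proof. by apply: vunit_coprime; move: N_pr; rewrite coprimeMr coprime_sym => /andP[_]; rewrite coprime_sym. Qed.
Let UN_p (V : place p) : vunit V N%:R.
Proof. by apply: vunit_coprime; move: N_pr; rewrite coprimeMr => /andP[]; rewrite coprime_sym. Qed.
Let OP_r (V : place r) : vring V (P / r%:R). Proof. by rewrite /P mulfK //; exact: vring_nat. Qed.
Let OP_p (V : place p) : vring V (P / p%:R). Proof. by rewrite /P mulrC mulKf //; exact: vring_nat. Qed.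

Let uniq_f n a : a \in Lev n -> uniq (fib a).
Proof. exact: (uniq_fib uniq_Lev). Qed.

Lemma block_level n (cl : rel algC) :
  (forall (nu : autC) x y, cl (nu x) (nu y) = cl x y) ->
  (forall x, x \in Lev n.+1 -> cl x x) ->
  (forall x y, x \in Lev n.+1 -> cl x y -> cl y x /\ g y = g x) ->
  (forall x y z, x \in Lev n.+1 -> cl x y -> cl y z -> cl x z) ->
  (exists x y, [/\ x \in Lev n.+1, x != y & cl x y]) ->
  forall x y, x \in Lev n.+1 -> g x = g y -> cl x y.
Proof.
move=> cl_aut cl_refl cl_sym cl_trans ntr.
have [Vr] := place_exists r_pr; have [Vp] := place_exists p_pr.
have [xr [xrL _ isoR] [Mgr Mxr]] := isolated_ex r_pr (erefl G) T0 (MT r_pr (OP_r Vr) (UN_r Vr)) G_at1 fibF mem_fib uniq_f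
  (loc_near pE u3 uk2 r_pr Br (Up_r Vr) (@nr Vr) (Oku2_r Vr))
  (loc_ex pE u3 uk2 r_pr Br (Up_r Vr) (@nr Vr) (Oku2_r Vr))
  (loc_uniq pE u3 uk2 r_pr Br (Up_r Vr) (@nr Vr) (Oku2_r Vr)) n.
have [xp [xpL _ isoP] [Mgp Mxp]] := isolated_ex p_pr (erefl G) T0 (MT p_pr (OP_p Vp) (UN_p Vp)) G_at1 fibF mem_fib uniq_f
  (loc_near pE u3 uk2 p_pr Bp (Ur_p Vp) (@np Vp) (Oku2_p Vp))
  (loc_ex pE u3 uk2 p_pr Bp (Ur_p Vp) (@np Vp) (Oku2_p Vp))
  (loc_uniq pE u3 uk2 p_pr Bp (Ur_p Vp) (@np Vp) (Oku2_p Vp)) n.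
have ku0 : (0 < k + u)%N by rewrite addn_gt0 u_gt0 orbT.
pose w := (k + u).-root (p%:R : algC).
have wE : w ^+ (k + u) = p%:R by rewrite rootCK.
have [cP UPp] := loc_phi_p pE u3 uk2 p_pr Bp (Ur_p Vp) (@np Vp) (Oku2_p Vp) Mgp (fibF (g xp)) pE wE (size_fib _).
have [_ cO] := loc_count pE u3 uk2 r_pr Br (Up_r Vr) (@nr Vr) (Oku2_r Vr) Mgr (fibF (g xr)).
apply: (block_full g_aut mem_fib size_fib uniq_Lev trans_Lev _ cl_aut cl_refl cl_sym cl_trans
  (k := k) (u := u) (Vr := Vr) r_pr (xr := xr) (Vp := Vp) p_pr (xp := xp) (phi := phip p (k - u)) (w := w)) => //.
- by move=> x; apply: (Lev_neq1 G_at1 mem_fib).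
- by move: uk2; clear; lia.
- by move: u3; clear; lia.
- exact/vunit_ring/near1_unit.
- move=> y yf.
  exact: (loc_phi_r pE u3 uk2 r_pr Br (Up_r Vr) (@nr Vr) (Oku2_r Vr) Mgr (fibF (g xr)) (Uku2_r Vr) yf).
exact: phip_aut.
Qed.

Let c_rat : c \in Crat. Proof. by apply/CratP; exists kap. Qed.
Let N_rat : N%:R \in Crat. Proof. exact: rpred_nat. Qed.
Let P_rat : P \in Crat. Proof. by rewrite rpredM ?rpred_nat. Qed.

Let big_pr q (V : place q) be : prime q -> B = be / q%:R -> vunit V be -> nice k p V ->
  vring V (q%:R / (k + u).+2%:R) -> vunit V N%:R -> vring V (P / q%:R) ->
  forall n, exists s e, [/\ s \in Crat, s != 0, vmax V (iter n.+1 g c * s ^+ 2 - N%:R * e),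
    e = - (2%:R * d%:R) / 4%:R ^+ 2 \/ e = 1 &
    vring V ((iter n.+1 g c)^-1 / q%:R ^+ 3) /\ iter n.+1 g c != 0].
Proof.
move=> qp Bbe Ube nc Oq UN OP n.
apply: (big_orbit qp (F := F) (G := G) (T := T) (B := B) (P := P) (d := d)) => //.
- by apply: leq_trans d5.
- exact: (loc_coef pE u3 uk2 qp Bbe Ube nc Oq).
- exact: g_aut.
- by rewrite /T DE.
- exact: (loc_Fc pE u3 uk2 qp Bbe Ube nc Oq).
- by apply: vunitM; [exact: (loc_U2 pE u3 uk2 nc) | exact: (loc_Ud pE u3 uk2 nc)].
exact: (loc_U2 pE u3 uk2 nc).
Qed.

Let U4 q (V : place q) : vunit V 2%:R -> vunit V 4%:R.
Proof. by move=> U2; rewrite (_ : 4%:R = 2%:R * 2%:R); [exact: vunitM | ring]. Qed.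

Let orbit_nsq n t : t \in Crat -> iter n.+1 g c != t ^+ 2 /\ iter n.+1 g c != - t ^+ 2.
Proof.
move=> tr; have [V] := place_exists r_pr.
have [s [e [sr s0 My eE [_ y0]]]] := big_pr r_pr Br (Up_r V) (@nr V) (Oku2_r V) (UN_r V) (OP_r V) n.
set y := iter n.+1 g c in My y0 *.
have U2 := loc_U2 pE u3 uk2 (@nr V); have Ud := loc_Ud pE u3 uk2 (@nr V); have U4' := U4 U2.
have [i dvi] := sq_m1.
have Mi : vmax V (i%:R ^+ 2 + 1 : algC) by rewrite -natrX natr1 -addn1 vmax_nat.
have [j [w [dvj nw]]] := sq_2d.
have Uw : vunit V w%:R by rewrite vunit_nat.
have Mj : vmax V (j%:R ^+ 2 - (2 * d)%:R * w%:R ^+ 2).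
  have lt : (2 * d < r)%N by move: r_big; clear; lia.
  have : vmax V (j ^ 2 + (r - 2 * d) * w ^ 2)%:R by rewrite vmax_nat //; rewrite modn_small in dvj.
  rewrite natrD natrM natrB ?(ltnW lt) // !natrX => H.
  have -> : j%:R ^+ 2 - (2 * d)%:R * w%:R ^+ 2 = (j%:R ^+ 2 + (r%:R - (2 * d)%:R) * w%:R ^+ 2) - w%:R ^+ 2 * r%:R :> algC by ring.
  by apply: vmaxB => //; apply: vmaxMl; [apply/vringX/vring_nat | exact: vmax_char].
have key (x : algC) : x \in Crat -> vmax V (x ^+ 2 - N%:R) -> False.
  move=> xr Mx.
  have Ox : vring V x.
    apply: (@vringX_inv _ V x 2) => //; rewrite -[x ^+ 2](subrK N%:R).
    by apply: vringD; [exact: vmaxW | exact: vring_nat].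
  have [a Ma] := rat_int r_pr xr Ox.
  have : vmax V (a%:R ^+ 2 - N%:R).
    apply: vmax_trans Mx; apply: vmax_subX => //; [exact: vring_nat | by rewrite vmax_sym].
  rewrite -natrX => H; have /negP[] := N_nonres a.
  case: (leqP N (a ^ 2)) => le; first by rewrite eqn_mod_dvd // -(vmax_nat V) // natrB.
  by rewrite eq_sym eqn_mod_dvd ?(ltnW le) // -(vmax_nat V) // natrB ?(ltnW le) // vmax_sym.
have sqs (x : algC) : x \in Crat -> vmax V (x ^+ 2 - N%:R * e) -> False.
  move=> xr Mx; case: eE => eE; last by apply: (key x) => //; rewrite eE mulr1 in Mx.
  have Uj : vunit V j%:R.
    apply: (vunitX_inv (n := 2)) => //; apply: (@vunit_eqmax _ V ((2 * d)%:R * w%:R ^+ 2)).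
      by apply: vunitM; [rewrite natrM; exact: vunitM | exact: vunitX].
    by rewrite vmax_sym.
  have Ui : vunit V i%:R.
    apply: (vunitX_inv (n := 2)) => //; apply: (@vunit_eqmax _ V (-1)); first exact/vunitN/vunit1.
    by rewrite -opprD vmaxN // addrC.
  have Ox : vring V x.
    apply: (@vringX_inv _ V x 2) => //; rewrite -[x ^+ 2](subrK (N%:R * e)).
    apply: vringD; first exact: vmaxW.
    apply: vringM; first exact: vring_nat.
    rewrite eE; apply: vringM; last by apply/vunitVr/vunitX.
    by apply: vringN; apply: vringM; exact: vring_nat.
  (* Modulo r, i^2 = -1 and j^2 = 2d w^2, so this factor has square -16 / (2d) and cancels the
     constant e. *)
  apply: (key (x * 4%:R * i%:R * w%:R / j%:R)).
    by rewrite rpred_div ?rpredM ?rpred_nat.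
  have j0 := vunit_neq0 Uj.
  have e4 : 4%:R != 0 :> algC by rewrite pnatr_eq0.
  have -> : (x * 4%:R * i%:R * w%:R / j%:R) ^+ 2 - N%:R =
     (4%:R * i%:R * w%:R / j%:R) ^+ 2 * (x ^+ 2 - N%:R * e) +
     N%:R / j%:R ^+ 2 * (- (2 * d)%:R * w%:R ^+ 2 * (i%:R ^+ 2 + 1) - (j%:R ^+ 2 - (2 * d)%:R * w%:R ^+ 2)).
    by rewrite eE natrM; field; rewrite ?j0 ?e4.
  have Oji : vring V j%:R^-1 by apply: vunitVr.
  have On a : vring V a%:R by exact: vring_nat.
  apply: vmaxD; apply: vmaxMl => //.
  - by apply: vringX; do 3!apply: vringM => //.
  - by rewrite -exprVn; apply: vringM => //; exact: vringX.
  by apply: vmaxB => //; apply: vmaxMl => //; apply: vringM; [exact: vringN | exact: vringX].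
have i_neg (x : algC) : x \in Crat -> vmax V (- x ^+ 2 - N%:R * e) -> False.
  move=> xr Mx; have Ui : vunit V i%:R.
    apply: (vunitX_inv (n := 2)) => //; apply: (@vunit_eqmax _ V (-1)); first exact/vunitN/vunit1.
    by rewrite -opprD vmaxN // addrC.
  have Ox2 : vring V (x ^+ 2).
    have -> : x ^+ 2 = - (- x ^+ 2 - N%:R * e) - N%:R * e by ring.
    apply: vringB; first exact/vringN/vmaxW.
    apply: vringM; first exact: vring_nat.
    case: eE => ->; last exact: vring1.
    apply: vringM; last by apply/vunitVr/vunitX.
    by apply: vringN; apply: vringM; exact: vring_nat.
  apply: (sqs (x * i%:R)); first by rewrite rpredM ?rpred_nat.
  have -> : (x * i%:R) ^+ 2 - N%:R * e = x ^+ 2 * (i%:R ^+ 2 + 1) + (- x ^+ 2 - N%:R * e) by ring.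
  by apply: vmaxD => //; apply: vmaxMl.
split; apply/eqP => yE; rewrite yE in My.
  by apply: (sqs (t * s)); rewrite ?rpredM // exprMn.
by apply: (i_neg (t * s)); rewrite ?rpredM // exprMn -mulNr.
Qed.

(** The critical value has odd valuation somewhere, by [orbit_nsq]. At p and r it is a unit times a
    square by [big_orbit], and at the remaining primes dividing N it is congruent to 1; none of
    these can be q. *)
Lemma good_prime n : exists q, [/\ prime q, q != p, q != r, ~~ (q %| N)%N &
  exists2 v : int, odd (absz v) & forall V : place q, vunit V (iter n.+1 g c * q%:R ^ v)].
Proof.
have y0 : iter n.+1 g c != 0.
  have [V] := place_exists r_pr.
  by have [s [e [_ _ _ _ [_ ->]]]] := big_pr r_pr Br (Up_r V) (@nr V) (Oku2_r V) (UN_r V) (OP_r V) n.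
have yr : iter n.+1 g c \in Crat.
  apply: autC_sep => nu; rewrite (iter_aut g_aut) //.
  by case/CratP: c_rat => a ->; rewrite fmorph_rat.
have [q qp [v vodd vU]] := odd_prime_ex yr y0 (@orbit_nsq n).
have even be (V : place q) : B = be / q%:R -> vunit V be -> nice k p V ->
    vring V (q%:R / (k + u).+2%:R) -> vunit V N%:R -> vring V (P / q%:R) -> False.
  move=> Bbe Ube nc Oq UN OP.
  have [s [e [sr s0 My eE _]]] := big_pr qp Bbe Ube nc Oq UN OP n.
  have Ue : vunit V e.
    have U2 := loc_U2 pE u3 uk2 nc; have Ud := loc_Ud pE u3 uk2 nc.
    case: eE => ->; last exact: vunit1.
    by apply: vunitM; [apply/vunitN/vunitM | apply/vunitV/vunitX/U4].
  have Uy : vunit V (iter n.+1 g c * s ^+ 2).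
    by apply: (@vunit_eqmax _ V (N%:R * e)); [exact: vunitM | rewrite vmax_sym].
  by have := vunit_square_even qp y0 sr s0 (vU V) Uy; rewrite vodd.
have nqp : q != p.
  apply/eqP => E; move: vU qp even; rewrite E => _ _ even; have [V] := place_exists p_pr.
  exact: (even r%:R^-1 V Bp (Ur_p V) (@np V) (Oku2_p V) (UN_p V) (OP_p V)).
have nqr : q != r.
  apply/eqP => E; move: vU qp even; rewrite E => _ _ even; have [V] := place_exists r_pr.
  exact: (even p%:R^-1 V Br (Up_r V) (@nr V) (Oku2_r V) (UN_r V) (OP_r V)).
exists q; split=> //; last by exists v.
apply/negP => qN; have [V] := place_exists qp.
have MN : vmax V N%:R by rewrite vmax_nat.
have UPP := UP V qp nqp nqr.
have NO x : x \in rat_data -> vring V (N%:R * ratr x).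
  move=> xL; have /dvdnP[m' NE] := W_N; rewrite NE natrM -mulrA; apply: vringM; first exact: vring_nat.
  exact: W_den.
(* T contains D at least twice: one factor N cancels the denominators of the data, since W divides
   N, and another one gives membership in M. *)
have TN x : vring V (N%:R * x) -> vmax V (T * x).
  move=> Ox; have -> : T * x = (D ^+ d.-2 / P ^+ 2) * (N%:R * x).
    have -> : T = D ^+ d.-2 * D by rewrite -exprSr; congr (D ^+ _); move: d5; clear; lia.
    by rewrite {2}DE; field; rewrite P0.
  apply: vmaxMr => //; apply: vmaxMr; last by apply/vunitVr/vunitX.
  apply: vmaxX; last by move: d5; clear; lia.
  by rewrite DE; apply: vmaxMr => //; apply/vunitVr/vunitX.
have TF i : vmax V (T * F`_i).
  rewrite -FQm coef_map; case: (in_F i) => [xL|->]; last by rewrite raddf0 mulr0 vmax0.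
  exact/TN/NO.
have y1 i : vmax V (iter i.+1 g c - 1).
  elim: i => [|i IH].
    rewrite /= /G hornerD hornerC hornerZ addrC addKr; apply: TN.
    have -> : F.[c] = ratr FQ.[kap] by rewrite -horner_map FQm.
    by apply: NO; rewrite !inE eqxx ?orbT.
  rewrite iterS {1}/G hornerD hornerC hornerZ addrC addKr -hornerZ.
  apply: vmax_horner0 => [j|]; first by rewrite coefZ.
  by rewrite -[iter _ _ _](subrK 1); apply: vringD; [exact: vmaxW | exact: vring1].
have Uy : vunit V (iter n.+1 g c * 1 ^+ 2) by rewrite expr1n mulr1; exact/near1_unit/y1.
have := vunit_square_even qp y0 (rpred1 _) (oner_neq0 _) (vU V) Uy.
by rewrite vodd.
Qed.

Theorem all_levels n : all_swaps g fib n.+1.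
Proof.
have [ns] := ubnP n; elim: ns n => // ns IH n ltn.
have [q [qp nqp nqr qN [v vodd vU]]] := good_prime n.
have [V] := place_exists qp.
have qW : ~~ (q %| W)%N by apply: contra qN => /dvdn_trans; apply.
have good x : x \in rat_data -> vring V (ratr x) by exact: data_good.
have goodp (Q : {poly rat}) : (forall x, x \in (Q : seq rat) -> x \in rat_data) ->
    forall i, vring V (map_poly ratr Q)`_i.
  move=> sub i; rewrite coef_map; case: (ltnP i (size Q)) => lt; first by apply/good/sub/mem_nth.
  by rewrite nth_default // raddf0; exact: vring0.
have FO i : vring V F`_i by apply: F_good.
have UD : vunit V D.
  by rewrite DE; apply: vunitM; [rewrite vunit_nat | apply/vunitV/vunitX/UP].
have UT : vunit V T by exact: vunitX.
have GO i : vring V G`_i.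
  rewrite /G coefD coef1 coefZ; apply: vringD; first exact: vring_nat.
  by apply: vringM => //; exact: vunit_ring.
have O6d : vring V ((6 * d)%:R^-1 : algC).
  have := good (6 * d)%:R^-1; rewrite fmorphV rmorph_nat; apply.
  by rewrite !inE eqxx ?orbT.
have U6d : vunit V (6 * d)%:R.
  have n0 : (6 * d)%:R != 0 :> algC by rewrite pnatr_eq0 muln_eq0 addn2.
  by apply: vunitE => //; exact: vring_nat.
have Udv x : (x %| 6 * d)%N -> vunit V x%:R.
  move=> /dvdnP[y E]; rewrite vunit_nat //; move: U6d; rewrite E vunit_nat // Euclid_dvdM // negb_or.
  by case/andP.
have Oc : vring V c by apply: good; rewrite !inE eqxx.
have OA : vring V A by apply: good; rewrite !inE eqxx ?orbT.
have OB : vring V B by apply: good; rewrite !inE eqxx ?orbT.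
have hO i : vring V h`_i.
  rewrite !coefD coefZ !coefXn coefC; apply: vringD.
    by apply: vringD; [exact: vring_nat | apply: vringM => //; exact: vring_nat].
  by case: ifP => // _; exact: vring0.
have hmonic : lead_coef h = 1.
  rewrite -addrA lead_coefDl ?lead_coefXn // size_polyXn ltnS.
  apply: leq_trans (size_polyD _ _) _; rewrite geq_max; apply/andP; split.
    by apply: leq_trans (size_scale_leq _ _) _; rewrite size_polyXn.
  by apply: leq_trans (size_polyC_leq1 _) _; exact: leq_ltn_trans uk.
have U2 : vunit V 2%:R by apply: Udv; apply: dvdn_mulr.
have U3 : vunit V 3%:R by apply: Udv; apply: dvdn_mulr.
have Trat : T \in Crat by apply: rpredX.
have Ulh : vunit V (lead_coef h) by rewrite hmonic; exact: vunit1.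
have Uhc : vunit V h.[c].
  have hE : h.[c] = ratr hQ.[kap] by rewrite -horner_map hQm.
  apply: vunitE; first by rewrite hE fmorph_eq0 hQ_kap.
    exact: vring_horner.
  by rewrite hE -fmorphV; apply: good; rewrite !inE eqxx ?orbT.
have bez : exists a b : {poly algC}, [/\ forall i, vring V a`_i, forall i, vring V b`_i &
    a * h + b * h^`() = 1].
  exists (map_poly ratr aQ), (map_poly ratr bQ); split.
  - by apply: goodp => x xa; rewrite !mem_cat xa ?orbT.
  - by apply: goodp => x xa; rewrite !mem_cat xa ?orbT.
  by rewrite -hQm deriv_map -!rmorphM -rmorphD /= bezQ rmorph1.
have [si [Z [A' [B' [Zodd ABZ siE Zfam]]]]] := ramified_level qp g_aut h_aut Trat c_rat fibE size_fib mem_fib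
   uniq_Lev d5 d_even GO hO UT (Udv d (dvdn_mull _ (dvdnn _))) U2 U3 Oc Uhc Ulh derG bez G_at0 G_at1 vodd (vU V).
apply: (level_all_swaps g_aut mem_fib size_fib uniq_Lev trans_Lev d5 d_even Zodd ABZ siE Zfam).
  exact: block_level.
by move=> m' ltm; apply: IH; apply: leq_trans ltm _; rewrite -ltnS.
Qed.

End Main.

(** * The infinite family *)

Section Final.

Variables (k u p r : nat).
Hypothesis p_pr : prime p.
Hypothesis r_pr : prime r.
Hypothesis pE : p = (k + u).+2.
Hypothesis u3 : (3 < u)%N.
Hypothesis uk2 : (u.+2 < k)%N.
Hypothesis ku_odd : odd (k + u).
Hypothesis r_big : (4 * (2 * k + 2) < r)%N.
Local Notation d := (2 * k + 2)%N.
Hypothesis sq_m1 : (exists i, r %| i ^ 2 + 1)%N.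
Hypothesis sq_2d : exists j w : nat,
  (r %| j ^ 2 + (r - 2 * d %% r) * w ^ 2)%N /\ ~~ (r %| w)%N.

Lemma deriv_scaled (D A B c : rat) : D != 0 ->
  (f_of (Fint k u A B c) D d)^`() = d%:R *: (('X - (c * D)%:P) *
     ('X^k + (A * D ^+ (k - u)) *: 'X^u + (B * D ^+ k)%:P) ^+ 2).
Proof.
move=> D0; have d0 : (0 < d)%N by rewrite addn2.
rewrite deriv_f_of // deriv_Fint; apply: horner_ext => w.
rewrite !(hornerZ, horner_comp, hornerM, hornerD, hornerN, hornerC, hornerX, hornerXn, horner_exp).
have E : D ^+ k = D ^+ u * D ^+ (k - u) by rewrite -exprD subnKC //; move: uk2; clear; lia.
have -> : D ^+ d.-1 = D * (D ^+ u * D ^+ (k - u)) ^+ 2.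
  rewrite -E -exprM -exprS; congr (D ^+ _); clear; lia.
have u0 : D ^+ u != 0 by rewrite expf_neq0.
have v0 : D ^+ (k - u) != 0 by rewrite expf_neq0.
rewrite !exprMn !exprVn E; field; by rewrite D0 u0 v0.
Qed.

(** N, and with it D = f(0), can be taken arbitrarily large while p and r stay fixed; infinitude of
    the set of parameters follows from this alone. *)
Lemma family_unbounded (K : nat) : exists2 N : nat, (K < N)%N &
  let D := N%:R / (p%:R * r%:R) ^+ 2 : rat in
  exists f : {poly rat},
    [/\ f^`() = d%:R *: (('X - (kap k u p r * D)%:P) *
          ('X^k + (A1 k * D ^+ (k - u)) *: 'X^u + (B1 p r * D ^+ k)%:P) ^+ 2) /\ f.[0] = D,
        ~ periodic_point f 0,
        (forall n : nat, separable_poly (poly_iter f n)) &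
        (forall tau : tree_aut f, exists s : galQ, arboreal_rep f s = tau)].
Proof.
have [aQ [bQ bez]] := hQ_bezout p_pr r_pr pE u3 uk2 r_big.
have [W [W0 cW Wden]] := den_away (rat_data k u p r aQ bQ) p_pr r_pr.
have r2 : (2 < r)%N by move: r_big; clear; lia.
have pr := p_neq_r pE uk2 r_big.
have [N [l [KN WN cN [l_pr l_W] [[m N_l l_m] nres]]]] := good_N K p_pr r_pr r2 pr W0 cW.
exists N => //= ; rewrite -/(DQ p r N).
have N0 : (0 < N)%N by apply: leq_ltn_trans KN.
have D0 : DQ p r N != 0.
  rewrite /DQ mulf_neq0 ?invr_eq0 ?expf_neq0 ?mulf_neq0 ?pnatr_eq0 -?lt0n //; exact: prime_gt0.
have GE : map_poly ratr (1 + DQ p r N ^+ d.-1 *: FQ k u p r) = G k u p r N := GQ_map k u p r N.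
have d0 : (0 < d)%N by rewrite addn2.
have F0 : (FQ k u p r).[0] = 0 by exact: Fint_at0.
have F1 : (FQ k u p r).[1] = 0.
  have := G_at1 p_pr r_pr pE u3 uk2 r_big N.
  rewrite -GE -{1}(rmorph1 (ratr : {rmorphism rat -> algC})) horner_map hornerD hornerC hornerZ.
  move/eqP; rewrite -(rmorph1 (ratr : {rmorphism rat -> algC})) (inj_eq (fmorph_inj _)).
  by rewrite addrC -subr_eq0 addrK mulf_eq0 expf_eq0 (negbTE D0) andbF => /eqP.
have mf := mem_fib p_pr r_pr u3 uk2 l_pr N_l l_m.
have sf := size_fib p_pr r_pr u3 uk2 l_pr N_l l_m.
have fE := fibE p_pr r_pr u3 uk2 l_pr N_l l_m.
have uL := uniq_Lev p_pr r_pr u3 uk2 Wden l_pr l_W N_l l_m.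
have sw n : all_swaps (horner (G k u p r N)) (fib k u p r N) n.+1.
  exact: (all_levels p_pr r_pr pE u3 uk2 ku_odd r_big sq_m1 sq_2d bez Wden WN cN l_pr l_W N_l l_m nres).
rewrite -GE in mf fE sw.
exists (f_of (FQ k u p r) (DQ p r N) d); split.
- by split; [exact: deriv_scaled | exact: f_of_at0].
- exact: (f_not_periodic D0 d0 F0 F1).
- by move=> n; apply: (f_separable (fib := fib k u p r N)).
exact: (tau_realized D0 d0 F0 F1 mf sf uL sw).
Qed.

End Final.

Theorem theorem4p5 (d p : nat) (d_even : ~~ odd d) (d_ge20 : (20 <= d)%N)
    (p_prime : prime p) (p_le : (p <= d - 3)%N) (p_ge : (d./2 + 5 <= p)%N) :
  let k := (d./2 - 1)%N in
  let u := (p - k - 2)%N in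
  infinite_set [set q : rat * rat * rat * rat |
    let: (A, B, C, D) := q in
    exists f : {poly rat},
      [/\ f^`() = (2 * k + 2)%:R *: (('X - C%:P) *
                    ('X^k + A *: 'X^u + B%:P) ^+ 2) /\ f.[0] = D,
          ~ periodic_point f 0,
          (forall n : nat, separable_poly (poly_iter f n)) &
          (forall tau : tree_aut f, exists s : galQ, arboreal_rep f s = tau)]].
Proof.
move=> k u.
have dE : d = (2 * k + 2)%N by rewrite /k; move: d_even d_ge20; clear; lia.
have pE : p = (k + u).+2 by rewrite /u /k; move: p_ge d_ge20; clear; lia.
have u3 : (3 < u)%N by rewrite /u /k; move: p_ge d_ge20; clear; lia.
have uk2 : (u.+2 < k)%N by move: p_le; rewrite dE pE; clear; lia.
have ku_odd : odd (k + u).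
  case: (even_prime p_prime) => [p2|]; last by rewrite pE /= negbK.
  by move: p_ge d_ge20; rewrite p2; clear; lia.
clearbody k u.
have [r [r_pr r_big sq1 sq2]] := good_r (leq_trans (isT : 0 < 20)%N d_ge20).
rewrite dE in r_big sq2 => {d_even d_ge20 p_le p_ge dE}.
move=> /finite_seqP[s sE].
have pr0 : (p%:R * r%:R) ^+ 2 != 0 :> rat.
  by rewrite expf_neq0 // mulf_neq0 // pnatr_eq0 -lt0n prime_gt0.
(* K bounds the last coordinates of a supposed finite list, scaled by (p r)^2 so as to be compared
   with N itself. *)
have [K KP] : exists K : nat, forall q, q \in s -> q.2 * (p%:R * r%:R) ^+ 2 < K%:R.
  elim: (s) => [|q l [K IH]]; first by exists 0%N.
  exists (maxn (Num.bound `|q.2 * (p%:R * r%:R) ^+ 2|) K) => q'; rewrite inE => /orP[/eqP ->|/IH lt].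
    apply: le_lt_trans (ler_norm _) _; apply: lt_le_trans (archi_boundP (normr_ge0 _)) _.
    by rewrite ler_nat leq_maxl.
  by apply: lt_le_trans lt _; rewrite ler_nat leq_maxr.
have [N KN [f fP]] := family_unbounded p_prime r_pr pE u3 uk2 ku_odd r_big sq1 sq2 K.
set D : rat := N%:R / _ in fP.
have : [set` s] (A1 k * D ^+ (k - u), B1 p r * D ^+ k, kap k u p r * D, D).
  by rewrite -sE /=; exists f.
move=> /= /KP /=; rewrite /D divfK // ltr_nat ltnNge ltnW //.
Qed.
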